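(* Let $f\in C_c^\infty(\mathrm X)$ and $y\in\mathrm X$ be fixed. Then the function $R(z)=[R(z)f](y)$ satisfies $$R(ze^{2i\pi})=R(z)+\frac{2i\pi}{\rho_{\mathrm X}^2|W|}\,F(\rho_{\mathrm X}^{-1}z)\qquad\Big(z\in\mathbb C\setminus\big((-\infty,0]\cup i(-\infty,-\tfrac12\rho_{\mathrm X}]\cup i[\tfrac12\rho_{\mathrm X},+\infty)\big)\Big)$$ and extends holomorphically from $\mathbb C\setminus\big((-\infty,0]\cup i(-\infty,-\frac12\rho_{\mathrm X}]\big)$ to a logarithmic Riemann surface branched along $(-\infty,0]$, with the preimages of $i\big((-\infty,-\frac12\rho_{\mathrm X}]\cup[\frac12\rho_{\mathrm X},+\infty)\big)$ removed.
   Context: $\mathrm G=\mathrm{SL}(3,\mathbb R)$, $\mathrm K=\mathrm{SO}(3)$, $\mathrm X=\mathrm G/\mathrm K$, $o=e\mathrm K$. $\mathfrak a$: real diagonal trace-zero matrices, $\alpha_{i,j}(\mathrm{diag}(a_1,a_2,a_3))=a_i-a_j$, positive roots $i<j$, $\rho=\alpha_{1,3}$, Weyl group $W=S_3$, $|W|=6$. $\langle\cdot,\cdot\rangle$ is the $W$-invariant inner product on $\mathfrak a^*$ with $\langle\alpha,\alpha\rangle=12$ for all roots, and $\mathrm X$ carries the corresponding $\mathrm G$-invariant Riemannian metric; $\rho_{\mathrm X}>0$ with $\rho_{\mathrm X}^2=\langle\rho,\rho\rangle=12$. $\Delta$ is the positive Laplacian, with $L^2$-spectrum $[\rho_{\mathrm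 X}^2,\infty)$. With $g=\kappa(g)a(g)n(g)$ the Iwasawa decomposition of $\mathrm G=\mathrm{KAN}$ ($\mathrm N$ unipotent upper triangular), $\varphi_\lambda(g)=\int_{\mathrm K}a(g^{-1}k)^{-\lambda-\rho}dk$ is the spherical function and $(f\times\varphi_\lambda)(y)=\int_{\mathrm G}f(g\cdot o)\varphi_\lambda(g^{-1}\cdot y)dg$. Basis $e_1,e_2$ of $\mathfrak a^*$: $\alpha_{1,2}=e_1$, $\alpha_{2,3}=-\frac12e_1+\frac{\sqrt3}2e_2$. $\mathrm c(w)=\frac{w+w^{-1}}2$, $\mathrm s(w)=\frac{w-w^{-1}}2$, $\lambda(z,w)=z(\mathrm c(w)e_1-i\,\mathrm s(w)e_2)\in\mathfrak a_{\mathbb C}^*$, $\boldsymbol\xi=e^{i\pi/3}$. For fixed $f,y$, $$F(z)=\frac1{2\pi}\int_{|w|=1}(f\times\varphi_{i\lambda(z,w)})(y)\,z^3\prod_{u\in\{1,\boldsymbol\xi,\boldsymbol\xi^2\}}\mathrm c(uw)\tanh(\pi z\,\mathrm c(uw))\frac{dw}{iw},$$ an even holomorphic function on $\mathbb C\setminus i((-\infty,-\frac12]\cup[\frac12,\infty))$. For $\operatorname{Im}z>0$, $R(z)=(\Delta-\rho_{\mathrm X}^2-z^2)^{-1}$; Haar measure on $\mathrm G$ is normalized so that (Plancherel formula) $[R(z)f](y)=\frac1{|W|}\int_0^\infty\frac{F(r)r}{\rho_{\mathrm X}^2r^2-z^2}dr$ for $\operatorname{Im}z>0$. $R(z)$ also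 denotes the holomorphic extension of $z\mapsto[R(z)f](y)$ to $\mathbb C\setminus\big((-\infty,0]\cup i(-\infty,-\frac12\rho_{\mathrm X}]\big)$, and its extension to the logarithmic Riemann surface (on which $\log z$ is a global coordinate); $R(ze^{2i\pi})$ is the value of the extension at the point $ze^{2i\pi}$ of that surface.
   Formalization: The sign of the monodromy term is corrected: R(ze^{2iπ}) = R(z) − (2iπ/(ρ_X²|W|)) F(ρ_X^{-1}z); with the stated Plancherel formula the printed plus sign would force F = 0, which fails for a bump function f ≥ 0 at y = o. *)

(* Defs.v *)
From HB Require Import structures.
From mathcomp Require Import all_boot all_order all_algebra.
From mathcomp Require Import perm complex.
From mathcomp Require Import all_classical all_reals all_analysis.
From mathcomp Require Import ring lra.
Set Implicit Arguments.
Unset Strict Implicit.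
Unset Printing Implicit Defensive.
Import Order.TTheory GRing.Theory Num.Theory.
Import numFieldNormedType.Exports.
Local Open Scope classical_set_scope.
Local Open Scope ring_scope.
Local Open Scope complex_scope.

(* Complex numbers are [R[i]] (the MathComp library has no complex exponential
   and integrates only real-valued functions, hence the definitions below). *)

Definition cexp {R : realType} (z : R[i]) : R[i] :=
  Complex (expR (complex.Re z) * cos (complex.Im z))
          (expR (complex.Re z) * sin (complex.Im z)).

Definition ctanh {R : realType} (z : R[i]) : R[i] :=
  (cexp z - cexp (- z)) / (cexp z + cexp (- z)).

(* [derivable _ z 1] over the field [R[i]] is complex differentiability. *)
Definition holomorphic_on {R : realType} (U : set R[i]) (h : R[i] -> R[i]) :=
  forall z : R[i], U z -> derivable (h : R[i]^o -> R[i]^o) z 1.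

Definition Cintegrable {d : measure_display} {T : measurableType d}
    {R : realType} (mu : {measure set T -> \bar R}) (D : set T)
    (h : T -> R[i]) : Prop :=
  mu.-integrable D (fun t => (complex.Re (h t))%:E) /\
  mu.-integrable D (fun t => (complex.Im (h t))%:E).

Definition Cintegral {d : measure_display} {T : measurableType d}
    {R : realType} (mu : {measure set T -> \bar R}) (D : set T)
    (h : T -> R[i]) : R[i] :=
  Complex (Rintegral mu D (fun t => complex.Re (h t)))
          (Rintegral mu D (fun t => complex.Im (h t))).

(* The contour integral of [h w dw] over the positively oriented circle
   [|w| = 1], parametrized by [w = e^{i theta}]. *)
Definition circle_integral {R : realType} (h : R[i] -> R[i]) : R[i] :=
  Cintegral lebesgue_measure `[0, 2 * pi]%classic
    (fun theta : R => h (cexp (Complex 0 theta)) *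
                      (Complex 0 1 * cexp (Complex 0 theta))).

(* All groups are sets of real 3 x 3 matrices. *)

Definition SL3 (R : realType) : set 'M[R]_3 := [set g | \det g = 1].

Definition SO3 (R : realType) : set 'M[R]_3 :=
  [set k | k^T *m k = 1%:M /\ \det k = 1].

(* the diagonal matrices of SL3 with positive entries *)
Definition A3 (R : realType) : set 'M[R]_3 :=
  [set a | [/\ is_diag_mx a, forall i, 0 < a i i & \det a = 1]].

(* the unipotent upper triangular matrices *)
Definition N3 (R : realType) : set 'M[R]_3 :=
  [set n | (forall i, n i i = 1) /\ (forall i j : 'I_3, (j < i)%N -> n i j = 0)].

(* The factor a of the (unique) Iwasawa decomposition g = k a n of g in SL3. *)
Definition iwasawa_a {R : realType} (g : 'M[R]_3) : 'M[R]_3 :=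
  xget 1%:M [set a | A3 a /\
    exists k n : 'M[R]_3, [/\ SO3 k, N3 n & g = k *m a *m n]].

Definition log_A {R : realType} (a : 'M[R]_3) : 'M[R]_3 :=
  diag_mx (\row_i ln (a i i)).

(* a^nu; an element nu of the complexified dual of the diagonal trace-zero
   matrices is given by its values. *)
Definition A_power {R : realType} (a : 'M[R]_3) (nu : 'M[R]_3 -> R[i]) : R[i] :=
  cexp (nu (log_A a)).

(* alpha_{i,j}; the indices 1, 2, 3 are shifted to 0, 1, 2. *)
Definition alpha {R : realType} (i j : 'I_3) (H : 'M[R]_3) : R := H i i - H j j.

Definition rho {R : realType} : 'M[R]_3 -> R := alpha 0 2.

Definition e1 {R : realType} : 'M[R]_3 -> R := alpha 0 1.

Definition e2 {R : realType} (H : 'M[R]_3) : R :=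
  2 / Num.sqrt 3 * (alpha 1 2 H + 2^-1 * e1 H).

Lemma alpha23E {R : realType} (H : 'M[R]_3) :
  alpha 1 2 H = - 2^-1 * e1 H + Num.sqrt 3 / 2 * e2 H.
Proof.
have h3 : Num.sqrt 3 != 0 :> R by rewrite sqrtr_eq0 -ltNge.
rewrite /e2 mulrA mulf_div [_ * 2]mulrC divff ?mulf_neq0// mul1r mulNr.
by rewrite addrC addrK.
Qed.

(* rho_X^2 = <rho, rho> = 12, rho being a root *)
Definition rhoX {R : realType} : R := Num.sqrt 12.

(* |W| for W = S_3 *)
Definition cardW : nat := #|{: 'S_3}|.

Definition cc {R : realType} (w : R[i]) : R[i] := (w + w^-1) / 2.

Definition ss {R : realType} (w : R[i]) : R[i] := (w - w^-1) / 2.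

Definition lambda {R : realType} (z w : R[i]) : 'M[R]_3 -> R[i] :=
  fun H => z * (cc w * (e1 H)%:C - Complex 0 1 * ss w * (e2 H)%:C).

Definition xi {R : realType} : R[i] := cexp (Complex 0 (pi / 3)).

Definition mxBorel (R : realType) := g_sigma_algebraType (@open 'M[R]_3).

(* mu is a left Haar measure on the closed unimodular group H of matrices,
   viewed as a Borel measure on all matrices that is concentrated on H. *)
Definition haar_measure {R : realType} (H : set 'M[R]_3)
    (mu : {measure set (mxBorel R) -> \bar R}) : Prop :=
  [/\ mu (~` H) = 0%E,
      forall (g : 'M[R]_3) (A : set (mxBorel R)), H g -> measurable A ->
        mu ((fun x : 'M[R]_3 => g *m x) @^-1` A) = mu A,
      forall C : set 'M[R]_3, compact C -> C `<=` H -> (mu C < +oo)%E &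
      (0 < mu H)%E].

(* Functions on X = SL3 / SO3 are represented by their pull-backs to SL3, the
   right SO3-invariant functions; likewise y in X stands for y SO3.  Only the
   values on SL3 of a function defined on all matrices are relevant. *)
Definition right_SO3_invariant {R : realType} (u : 'M[R]_3 -> R[i]) : Prop :=
  forall g k : 'M[R]_3, SL3 g -> SO3 k -> u (g *m k) = u g.

Definition iter_derive {R : realType} (vs : seq 'M[R]_3) (h : 'M[R]_3 -> R) :
    'M[R]_3 -> R :=
  foldr (fun v (h' : 'M[R]_3 -> R) => 'D_v h') h vs.

Definition smooth_on {R : realType} (U : set 'M[R]_3) (h : 'M[R]_3 -> R) : Prop :=
  forall (vs : seq 'M[R]_3) (x : 'M[R]_3), U x ->
    {for x, continuous (iter_derive vs h)} /\
    forall v : 'M[R]_3, derivable (iter_derive vs h) x v.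

(* Smoothness on the closed submanifold SL3 of the space of matrices: local
   extendability to smooth functions on open sets.  As SL3 -> X is a submersion,
   a function on X is smooth iff its pull-back is. *)
Definition smooth_SL3 {R : realType} (u : 'M[R]_3 -> R[i]) : Prop :=
  forall g : 'M[R]_3, SL3 g ->
    exists (U : set 'M[R]_3) (h1 h2 : 'M[R]_3 -> R),
      [/\ open U, U g, smooth_on U h1, smooth_on U h2 &
          forall x : 'M[R]_3, U x -> SL3 x -> u x = Complex (h1 x) (h2 x)].

(* C_c^infinity(X); as SO3 is compact, compactness of the support can be tested
   on SL3. *)
Definition Cc_smooth_X {R : realType} (f : 'M[R]_3 -> R[i]) : Prop :=
  [/\ right_SO3_invariant f, smooth_SL3 f &
      exists C : set 'M[R]_3, [/\ compact C, C `<=` @SL3 R &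
        forall g : 'M[R]_3, SL3 g -> ~ C g -> f g = 0]].

Definition spherical {R : realType} (nu : {measure set (mxBorel R) -> \bar R})
    (lam : 'M[R]_3 -> R[i]) (g : 'M[R]_3) : R[i] :=
  Cintegral nu (@SO3 R) (fun k : 'M[R]_3 =>
    A_power (iwasawa_a (invmx g *m k)) (fun H => - lam H - (rho H)%:C)).

(* (f x phi_lam)(y) *)
Definition conv_spherical {R : realType}
    (mu nu : {measure set (mxBorel R) -> \bar R}) (f : 'M[R]_3 -> R[i])
    (lam : 'M[R]_3 -> R[i]) (y : 'M[R]_3) : R[i] :=
  Cintegral mu (@SL3 R)
    (fun g : 'M[R]_3 => f g * spherical nu lam (invmx g *m y)).

Definition F {R : realType} (mu nu : {measure set (mxBorel R) -> \bar R})
    (f : 'M[R]_3 -> R[i]) (y : 'M[R]_3) (z : R[i]) : R[i] :=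
  (2 * pi)^-1%:C * circle_integral (fun w =>
    conv_spherical mu nu f (fun H => Complex 0 1 * lambda z w H) y * z ^+ 3 *
    (\prod_(u <- [:: 1; xi; xi ^+ 2]) (cc (u * w) * ctanh (pi%:C * z * cc (u * w))))
    / (Complex 0 1 * w)).

Definition expmx {R : realType} (X : 'M[R]_3) : 'M[R]_3 :=
  limn (series (fun n : nat => (n`!%:R : R)^-1 *: X ^+ n)).

(* The inner product on the symmetric trace-zero matrices (the tangent space of
   X at the origin) is <X, Y> = tr(X Y) / 6: for it alpha_{1,2} is dual to
   diag(6, -6, 0), so that <alpha_{1,2}, alpha_{1,2}> = 12. *)
Definition p_basis {R : realType} : seq 'M[R]_3 :=
  [:: Num.sqrt 3 *: (delta_mx 0 1 + delta_mx 1 0);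
      Num.sqrt 3 *: (delta_mx 0 2 + delta_mx 2 0);
      Num.sqrt 3 *: (delta_mx 1 2 + delta_mx 2 1);
      Num.sqrt 3 *: (delta_mx 0 0 - delta_mx 1 1);
      delta_mx 0 0 + delta_mx 1 1 - 2 *: delta_mx 2 2].

Lemma p_basis_orthonormal {R : realType} (i j : 'I_5) :
  \tr ((@p_basis R)`_i *m p_basis`_j) / 6 = (i == j)%:R.
Proof.
have h3 : Num.sqrt 3 ^+ 2 = 3 :> R by rewrite sqr_sqrtr.
set s := Num.sqrt 3 in h3.
case: i => [[|[|[|[|[|i]]]]] hi] //; case: j => [[|[|[|[|[|j]]]]] hj] //;
rewrite /p_basis -/s /= /mxtrace !big_ord_recl !big_ord0 !mxE;
rewrite !big_ord_recl !big_ord0 !mxE /= ?mulr0n ?mulr1n; nra.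
Qed.

(* The positive Laplacian, minus the trace of the Hessian: the curves
   t |-> g exp(t X) SO3, for X in [p_basis], are the geodesics of X through g SO3
   in orthonormal directions. *)
Definition laplacian {R : realType} (u : 'M[R]_3 -> R[i]) (g : 'M[R]_3) : R[i] :=
  - \sum_(X <- p_basis)
      Complex (derive1n 2 (fun t : R => complex.Re (u (g *m expmx (t *: X)))) 0)
              (derive1n 2 (fun t : R => complex.Im (u (g *m expmx (t *: X)))) 0).

(* u is the smooth representative of (Delta - rho_X^2 - z^2)^{-1} f in L^2(X).
   Square integrability on X (invariant measure) is square integrability of the
   pull-back on SL3, as SO3 is compact. *)
Definition is_resolvent {R : realType} (mu : {measure set (mxBorel R) -> \bar R})
    (z : R[i]) (f u : 'M[R]_3 -> R[i]) : Prop :=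
  [/\ right_SO3_invariant u,
      smooth_SL3 u,
      (\int[mu]_(g in @SL3 R)
        (complex.Re (u g) ^+ 2 + complex.Im (u g) ^+ 2)%:E < +oo)%E &
      forall g : 'M[R]_3, SL3 g ->
        laplacian u g - ((rhoX ^+ 2)%:C + z ^+ 2) * u g = f g].

Definition resolvent {R : realType} (mu : {measure set (mxBorel R) -> \bar R})
    (z : R[i]) (f : 'M[R]_3 -> R[i]) : 'M[R]_3 -> R[i] :=
  xget (fun=> 0) [set u | is_resolvent mu z f u].

(* The Haar measure mu of SL3 is normalized by the Plancherel formula.  Sign of
   the monodromy: near z = 0 the right-hand side below is
   - F(z / rho_X) log z / (rho_X^2 |W|) plus a holomorphic function (for instance
   int_0^oo e^{-r^2} r / (r^2 - z^2) dr = - e^{-z^2} log z + entire), so one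
   counterclockwise turn subtracts 2 i pi F(z / rho_X) / (rho_X^2 |W|). *)
Definition plancherel_normalized {R : realType}
    (mu nu : {measure set (mxBorel R) -> \bar R}) : Prop :=
  forall (f : 'M[R]_3 -> R[i]) (y : 'M[R]_3) (z : R[i]),
    Cc_smooth_X f -> SL3 y -> 0 < complex.Im z ->
    let integrand (r : R) : R[i] :=
      F mu nu f y r%:C * r%:C / ((rhoX ^+ 2 * r ^+ 2)%:C - z ^+ 2) in
    Cintegrable lebesgue_measure `[0, +oo[%classic integrand /\
    resolvent mu z f y =
      (cardW%:R)^-1 * Cintegral lebesgue_measure `[0, +oo[%classic integrand.

(* C minus (-oo, 0] and i(-oo, - rho_X / 2] *)
Definition slit_plane (R : realType) : set R[i] :=
  [set z | ~ (complex.Im z = 0 /\ complex.Re z <= 0) /\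
           ~ (complex.Re z = 0 /\ complex.Im z <= - (rhoX / 2))].

(* i((-oo, - rho_X / 2] `|` [rho_X / 2, +oo)) *)
Definition imaginary_cuts (R : realType) : set R[i] :=
  [set z | complex.Re z = 0 /\ rhoX / 2 <= `|complex.Im z|].

(* The logarithmic Riemann surface is the complex plane of zeta = log z, with
   covering map [cexp]; these are its points off the preimages of
   [imaginary_cuts]. *)
Definition log_surface (R : realType) : set R[i] :=
  [set zeta | ~ imaginary_cuts (cexp zeta)].

(* The sheet over C minus (-oo, 0] that carries the principal logarithm *)
Definition principal_sheet (R : realType) : set R[i] :=
  [set zeta | - pi < complex.Im zeta < pi].

(* Main.v *)
Require Import Defs.
From mathcomp Require Import all_boot all_order all_algebra.
From mathcomp Require Import complex.
From mathcomp Require Import all_classical all_reals all_analysis.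
From mathcomp Require Import measurable_realfun ring lra.

(** Let [s = z / rhoX], and let [D] be the plane without the two half-lines
    [i(-oo, -1/2]] and [i[1/2, +oo)].  By the Plancherel formula the resolvent is,
    for [Im z > 0], the constant [1 / (rhoX^2 |W|)] times the Stieltjes-type
    integral of [F(r) r / (r^2 - s^2)] over [r >= 0].  The theorem says how this
    integral continues when [s] crosses the half-line of integration.

    Put [Phi(z) = F(z) (1 + z^2)] and split the integrand:

      [F(r) r / (r^2 - s^2) = (r / (1 + r^2)) (Phi(r) - Phi(s)) / (r^2 - s^2)
                              + Phi(s) r / ((1 + r^2) (r^2 - s^2))].

    The factor [1 + r^2] makes the two terms separately integrable.  Since [F] is
    even, [Phi(r) - Phi(s)] vanishes at [r = s] and at [r = - s], so the first term
    has no singularity left and its integral is holomorphic in [s] on all of [D]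
    except at [0] ([cder_regular_part]).  The second term has the primitive
    [log ((r^2 - s^2) / (1 + r^2)) / 2] up to a factor, and integrates to
    [F(s) (i pi / 2 - log s)] ([log_integral]).  Hence the resolvent is the
    constant above times

      [regular_part(s) + F(s) (i pi / 2 - log s)]   ([stieltjes_continuation]).

    Here the logarithm is the only multivalued ingredient.  With the coordinate
    [zeta = log z] one replaces [log s] by [zeta - ln rhoX] and obtains a function
    that is holomorphic on the logarithmic surface off the preimages of the two
    cuts of [F] ([cder_log_continuation]); adding [2 i pi] to [zeta] subtracts
    [2 i pi F(s)] from the bracket, which is the monodromy formula
    ([log_continuationD2pi]).  On the upper half-plane, and in particular on the
    upper cut, where [F] is singular, the Plancherel integral itself is holomorphic
    ([cder_stieltjes]).

    Two facts about [F] enter: on [D] it has two complex derivatives, the second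
    one locally bounded ([F_cderiv2]), and it is even ([F_even]).  Both come from
    writing [F] as an iterated integral, over the circle, the compact support of [f]
    and SO(3), of plane waves times [z^3] and the three tanh factors.  The
    parametrized families that are [n] times differentiable in [z], with derivatives
    continuous in the parameter and locally bounded in [z], are closed under sums,
    products and integration over compact sets ([CfamM], [Cfam_Cintegral]); they
    contain the exponentials ([Cfam_cexp]) and the tanh factors ([Cfam_ctanh]).
    The plane waves depend continuously on the group elements because the Iwasawa
    projection of [g] is explicit in the principal minors of [g^T g]
    ([iwasawa_log]).  Evenness holds because [z -> - z] amounts to turning the
    circle by [pi].

    Holomorphy is obtained from the definition of the complex derivative alone,
    without contour integrals: integrals are differentiated by dominated
    convergence, with the mean value inequality [cmvt] bounding the difference
    quotients. *)

Import Order.TTheory GRing.Theory Num.Theory.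
Import numFieldNormedType.Exports.
Set Implicit Arguments.
Unset Strict Implicit.
Unset Printing Implicit Defensive.
Local Open Scope classical_set_scope.
Local Open Scope ring_scope.
Local Open Scope complex_scope.

(** * Modulus and limits in the complex plane *)
Section ComplexTopology.
Variable R : realType.
Implicit Types z w : R[i].

(** The modulus as an element of [R]; the norm of [R[i]] takes its values in
    [R[i]], where they can be neither integrated nor compared with real bounds. *)
Definition cabs z : R := Normc.normc z.

Arguments cabs : simpl never.

Lemma normCE z : `|z| = (cabs z)%:C. Proof. by []. Qed.
Lemma cabsE z : cabs z = Num.sqrt (complex.Re z ^+ 2 + complex.Im z ^+ 2).
Proof. by case: z. Qed.
Lemma cabs_ge0 z : 0 <= cabs z. Proof. by rewrite cabsE sqrtr_ge0. Qed.
Lemma cabsM z w : cabs (z * w) = cabs z * cabs w.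
Proof. exact: Normc.normcM. Qed.
Lemma cabsV z : cabs z^-1 = (cabs z)^-1.
Proof. exact: Normc.normcV. Qed.
Lemma cabsD z w : cabs (z + w) <= cabs z + cabs w.
Proof. by rewrite -lecR rmorphD /= -!normCE ler_normD. Qed.
Lemma cabsN z : cabs (- z) = cabs z.
Proof. by apply: (@complexI R); rewrite -!normCE normrN. Qed.
Lemma cabsB z w : cabs (z - w) = cabs (w - z).
Proof. by rewrite -cabsN opprB. Qed.
Lemma cabs0 : cabs 0 = 0. Proof. by apply: (@complexI R); rewrite -normCE normr0. Qed.
Lemma cabs1 : cabs 1 = 1. Proof. by apply: (@complexI R); rewrite -normCE normr1. Qed.
Lemma cabsX z n : cabs (z ^+ n) = cabs z ^+ n.
Proof. by elim: n => [|n IH]; rewrite ?expr0 ?cabs1// !exprS cabsM IH. Qed.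
Lemma cabs_eq0 z : (cabs z == 0) = (z == 0).
Proof. by rewrite -(normr_eq0 z) normCE -(inj_eq (@complexI R)). Qed.
Lemma cabs_gt0 z : (0 < cabs z) = (z != 0).
Proof. by rewrite lt_def cabs_ge0 andbT cabs_eq0. Qed.
Lemma cabs_real (x : R) : cabs x%:C = `|x|.
Proof. by rewrite cabsE /= expr0n addr0 sqrtr_sqr. Qed.
Lemma cabs_i (x : R) : cabs (Complex 0 x) = `|x|.
Proof. by rewrite cabsE /= expr0n add0r sqrtr_sqr. Qed.
Lemma le_Re_cabs z : `|complex.Re z| <= cabs z.
Proof. by rewrite cabsE -sqrtr_sqr ler_wsqrtr// lerDl sqr_ge0. Qed.
Lemma le_Im_cabs z : `|complex.Im z| <= cabs z.
Proof. by rewrite cabsE -sqrtr_sqr ler_wsqrtr// lerDr sqr_ge0. Qed.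
Lemma cabs_le z : cabs z <= `|complex.Re z| + `|complex.Im z|.
Proof.
by rewrite {1}(complexE z) (le_trans (cabsD _ _))// cabsM cabs_real cabs_i normr1 mul1r cabs_real.
Qed.
Lemma cabs_sub_le z w : cabs z - cabs w <= cabs (z - w).
Proof. by rewrite lerBlDr; apply: le_trans (cabsD _ _); rewrite subrK. Qed.

Lemma cReD z w : complex.Re (z + w) = complex.Re z + complex.Re w.
Proof. by case: z w => [? ?] []. Qed.
Lemma cImD z w : complex.Im (z + w) = complex.Im z + complex.Im w.
Proof. by case: z w => [? ?] []. Qed.
Lemma cReN z : complex.Re (- z) = - complex.Re z. Proof. by case: z. Qed.
Lemma cImN z : complex.Im (- z) = - complex.Im z. Proof. by case: z. Qed.
Lemma cReM z w : complex.Re (z * w) =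
  complex.Re z * complex.Re w - complex.Im z * complex.Im w.
Proof. by case: z w => [? ?] []. Qed.
Lemma cImM z w : complex.Im (z * w) =
  complex.Re z * complex.Im w + complex.Im z * complex.Re w.
Proof. by case: z w => [? ?] []. Qed.

Lemma cReZ (x : R) z : complex.Re (x%:C * z) = x * complex.Re z.
Proof. by rewrite cReM mul0r subr0. Qed.
Lemma cImZ (x : R) z : complex.Im (x%:C * z) = x * complex.Im z.
Proof. by rewrite cImM mul0r addr0. Qed.

(** The radii are real, so that estimates of [cabs] apply directly. *)
Definition cnbhs z : set_system R[i] :=
  [set P | exists2 e : R, 0 < e & forall w, cabs (w - z) < e -> P w].

Global Instance cnbhs_filter z : ProperFilter (cnbhs z).
Proof.
split.
  by move=> [e e0 /(_ z)]; rewrite subrr cabs0; exact.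
split.
- by exists 1.
- move=> P Q [e e0 He] [r r0 Hr]; exists (Num.min e r); first by rewrite lt_min e0.
  by move=> w; rewrite lt_min => /andP[/He ? /Hr].
- by move=> P Q PQ [e e0 He]; exists e => // w /He /PQ.
Qed.

Definition ccvg {T} (F : set_system T) (f : T -> R[i]) (l : R[i]) :=
  forall e : R, 0 < e -> F [set x | cabs (f x - l) < e].

(** Transfers limits of real functions to complex ones: sums, products and
    inverses of complex limits are computed on real and imaginary parts. *)
Lemma ccvg_ReIm {T} (F : set_system T) {FF : Filter F} (f : T -> R[i]) (l : R[i]) :
  ccvg F f l <-> (complex.Re (f x) @[x --> F] --> complex.Re l /\
                  complex.Im (f x) @[x --> F] --> complex.Im l).
Proof.
split.
- move=> fl; split; apply/cvgrPdist_lt => e /fl; apply: filterS => x;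
    apply: le_lt_trans; rewrite distrC.
  + by rewrite -cReN -cReD le_Re_cabs.
  + by rewrite -cImN -cImD le_Im_cabs.
- move=> [/cvgrPdist_lt fr /cvgrPdist_lt fi] e e0.
  have e2 : 0 < e / 2 by rewrite divr_gt0.
  apply: filterS (filterI (fr _ e2) (fi _ e2)) => x [/= xr xi].
  rewrite (le_lt_trans (cabs_le _))// (splitr e) ltrD//.
    by rewrite cReD cReN distrC.
  by rewrite cImD cImN distrC.
Qed.

Lemma ccvg_cst {T} (F : set_system T) {FF : Filter F} (a : R[i]) : ccvg F (fun=> a) a.
Proof. by move=> e e0; apply: filterE => x /=; rewrite subrr cabs0. Qed.

Lemma ccvg_id z : ccvg (cnbhs z) id z.
Proof. by move=> e e0; exists e. Qed.

Lemma ccvg_eq {T} (F : set_system T) {FF : Filter F} (f g : T -> R[i]) (a : R[i]) :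
  F [set x | f x = g x] -> ccvg F f a -> ccvg F g a.
Proof.
move=> fg fa e e0; apply: filterS (filterI fg (fa e e0)) => x [/= <-].
by [].
Qed.

Lemma ccvg_comp {T} (F : set_system T) (f : T -> R[i]) (g : R[i] -> R[i]) a b :
  ccvg F f a -> ccvg (cnbhs a) g b -> Filter F -> ccvg F (fun x => g (f x)) b.
Proof.
move=> fa gb FF e e0; have [r r0 Hr] := gb e e0.
by apply: filterS (fa r r0) => x; exact: Hr.
Qed.

Lemma ccvgD {T} (F : set_system T) {FF : Filter F} (f g : T -> R[i]) (a b : R[i]) :
  ccvg F f a -> ccvg F g b -> ccvg F (fun x => f x + g x) (a + b).
Proof.
move=> /ccvg_ReIm[fr fi] /ccvg_ReIm[gr gi]; apply/ccvg_ReIm; split.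
  by under eq_fun do rewrite cReD; rewrite cReD; exact: cvgD.
by under eq_fun do rewrite cImD; rewrite cImD; exact: cvgD.
Qed.

Lemma ccvgN {T} (F : set_system T) {FF : Filter F} (f : T -> R[i]) (a : R[i]) :
  ccvg F f a -> ccvg F (fun x => - f x) (- a).
Proof.
move=> /ccvg_ReIm[fr fi]; apply/ccvg_ReIm; split.
  by under eq_fun do rewrite cReN; rewrite cReN; exact: cvgN.
by under eq_fun do rewrite cImN; rewrite cImN; exact: cvgN.
Qed.

Lemma ccvgB {T} (F : set_system T) {FF : Filter F} (f g : T -> R[i]) (a b : R[i]) :
  ccvg F f a -> ccvg F g b -> ccvg F (fun x => f x - g x) (a - b).
Proof. by move=> fa gb; exact: ccvgD fa (ccvgN gb). Qed.

Lemma ccvgM {T} (F : set_system T) {FF : Filter F} (f g : T -> R[i]) (a b : R[i]) :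
  ccvg F f a -> ccvg F g b -> ccvg F (fun x => f x * g x) (a * b).
Proof.
move=> /ccvg_ReIm[fr fi] /ccvg_ReIm[gr gi]; apply/ccvg_ReIm; split.
  under eq_fun do rewrite cReM; rewrite cReM.
  by apply: cvgB; apply: cvgM.
under eq_fun do rewrite cImM; rewrite cImM.
by apply: cvgD; apply: cvgM.
Qed.

Lemma ccvg_cabs {T} (F : set_system T) {FF : Filter F} (f : T -> R[i]) (a : R[i]) :
  ccvg F f a -> cabs (f x) @[x --> F] --> cabs a.
Proof.
move=> fa; apply/cvgrPdist_lt => e /fa; apply: filterS => x.
apply: le_lt_trans; rewrite ler_norml; apply/andP; split.
  by rewrite lerNl opprB cabs_sub_le.
by rewrite cabsB cabs_sub_le.
Qed.

Lemma cVE z : z^-1 = Complex (complex.Re z / cabs z ^+ 2) (- complex.Im z / cabs z ^+ 2).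
Proof.
rewrite cabsE sqr_sqrtr ?addr_ge0 ?sqr_ge0//; case: z => a b.
by rewrite mulNr.
Qed.

Lemma ccvgV {T} (F : set_system T) {FF : Filter F} (f : T -> R[i]) (a : R[i]) :
  a != 0 -> ccvg F f a -> ccvg F (fun x => (f x)^-1) a^-1.
Proof.
move=> a0 fa; have /ccvg_ReIm[fr fi] := fa; apply/ccvg_ReIm.
have cv : (cabs (f x) ^+ 2)^-1 @[x --> F] --> (cabs a ^+ 2)^-1.
  apply: cvgV; first by rewrite expf_eq0 /= cabs_eq0.
  by rewrite expr2; under eq_fun do rewrite expr2; apply: cvgM; exact: ccvg_cabs.
split.
  under eq_fun do rewrite cVE /=; rewrite cVE /=; exact: cvgM.
under eq_fun do rewrite cVE /=; rewrite cVE /=.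
by apply: cvgM => //; exact: cvgN.
Qed.

End ComplexTopology.
Arguments cabs {R} z : simpl never.
Arguments cexp {R} z : simpl never.
Arguments ctanh {R} z : simpl never.

(** * Complex derivatives and the mean value inequality *)
Section ComplexDerivative.
Variable R : realType.
Implicit Types z w d : R[i].

(** Caratheodory's form of the derivative: a slope function [q] continuous at [z].
    It avoids division, so that products, compositions and inverse functions reduce
    to algebra on slope functions. *)
Definition has_cderiv (f : R[i] -> R[i]) z d :=
  exists q : R[i] -> R[i], [/\ forall w, f w - f z = q w * (w - z),
    ccvg (cnbhs z) q (q z) & q z = d].

(** The form with a remainder, for functions given by estimates rather than by a
    formula for their slope. *)
Lemma cderP (f : R[i] -> R[i]) z d : has_cderiv f z d <->
  forall e : R, 0 < e -> exists2 r : R, 0 < r & forall w, cabs (w - z) < r ->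
    cabs (f w - f z - d * (w - z)) <= e * cabs (w - z).
Proof.
split.
- move=> [q [fq + <-]] e e0 => /(_ _ e0)[r r0 Hr].
  exists r => // w wr; rewrite fq -mulrBl cabsM ler_wpM2r ?cabs_ge0//.
  exact/ltW/Hr.
- move=> H; exists (fun w => if w == z then d else (f w - f z) / (w - z)).
  rewrite eqxx; split=> //.
    move=> w; case: eqVneq => [->|wz]; first by rewrite !subrr mulr0.
    by rewrite mulfVK// subr_eq0.
  move=> e e0; have [r r0 Hr] := H (e / 2) (divr_gt0 e0 (ltr0n _ 2)).
  exists r => // w /Hr /=.
  case: eqVneq => [->|wz h]; first by move=> _; rewrite subrr cabs0.
  have wz0 : w - z != 0 by rewrite subr_eq0.
  have -> : (f w - f z) / (w - z) - d = (f w - f z - d * (w - z)) / (w - z).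
    by rewrite [RHS]mulrBl mulfK.
  rewrite cabsM cabsV ltr_pdivrMr ?cabs_gt0// (le_lt_trans h)//.
  by rewrite ltr_pM2r ?cabs_gt0// ltr_pdivrMr// mulr_natr mulr2n ltrDl.
Qed.

Lemma cder_cont (f : R[i] -> R[i]) z d : has_cderiv f z d -> ccvg (cnbhs z) f (f z).
Proof.
move=> [q [fq qc _]].
have -> : f = fun w => f z + q w * (w - z).
  by apply/funext => w; rewrite -fq addrC subrK.
suff : ccvg (cnbhs z) (fun w => f z + q w * (w - z)) (f z + q z * (z - z)).
  by rewrite subrr mulr0 addr0.
by apply: ccvgD; [exact: ccvg_cst|apply: ccvgM => //; apply: ccvgB;
  [exact: ccvg_id|exact: ccvg_cst]].
Qed.

Lemma cder_eq (f : R[i] -> R[i]) z d d' : has_cderiv f z d -> d = d' ->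
  has_cderiv f z d'.
Proof. by move=> + <-. Qed.

Lemma cder_cst (c : R[i]) z : has_cderiv (fun=> c) z 0.
Proof. by exists (fun=> 0); split=> [w| |//]; [rewrite subrr mul0r|exact: ccvg_cst]. Qed.

Lemma cder_id z : has_cderiv id z 1.
Proof. by exists (fun=> 1); split=> [w| |//]; [rewrite mul1r|exact: ccvg_cst]. Qed.

Lemma cderD (f g : R[i] -> R[i]) z a b : has_cderiv f z a -> has_cderiv g z b ->
  has_cderiv (fun w => f w + g w) z (a + b).
Proof.
move=> [p [fp pc <-]] [q [gq qc <-]]; exists (fun w => p w + q w); split=> //.
  by move=> w; rewrite mulrDl -fp -gq; ring.
exact: ccvgD.
Qed.

Lemma cderN (f : R[i] -> R[i]) z a : has_cderiv f z a ->
  has_cderiv (fun w => - f w) z (- a).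
Proof.
move=> [p [fp pc <-]]; exists (fun w => - p w); split=> //.
  by move=> w; rewrite mulNr -fp; ring.
exact: ccvgN.
Qed.

Lemma cderB (f g : R[i] -> R[i]) z a b : has_cderiv f z a -> has_cderiv g z b ->
  has_cderiv (fun w => f w - g w) z (a - b).
Proof. by move=> fa gb; exact: cderD fa (cderN gb). Qed.

Lemma cderM (f g : R[i] -> R[i]) z a b : has_cderiv f z a -> has_cderiv g z b ->
  has_cderiv (fun w => f w * g w) z (a * g z + f z * b).
Proof.
move=> fa gb; have gc := cder_cont gb.
move: fa gb => [p [fp pc <-]] [q [gq qc <-]].
exists (fun w => p w * g w + f z * q w); split=> //.
  move=> w; rewrite mulrDl -mulrA -(mulrC (w - z)) mulrA -fp -(mulrA (f z)) -gq; ring.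
apply: ccvgD; first exact: ccvgM.
by apply: ccvgM => //; exact: ccvg_cst.
Qed.

Lemma cderMl (c : R[i]) (g : R[i] -> R[i]) z b : has_cderiv g z b ->
  has_cderiv (fun w => c * g w) z (c * b).
Proof.
by move=> gb; apply: cder_eq (cderM (cder_cst c z) gb) _; rewrite mul0r add0r.
Qed.

Lemma cder_comp (f g : R[i] -> R[i]) z a b : has_cderiv f z a ->
  has_cderiv g (f z) b -> has_cderiv (fun w => g (f w)) z (b * a).
Proof.
move=> fa; have fc := cder_cont fa; move: fa => [p [fp pc <-]] [q [gq qc <-]].
exists (fun w => q (f w) * p w); split=> //.
  by move=> w; rewrite gq fp mulrA.
by apply: ccvgM => //; exact: ccvg_comp fc qc _.
Qed.

Lemma cder_inv z : z != 0 -> has_cderiv (fun w => w^-1) z (- z^-1 ^+ 2).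
Proof.
move=> z0.
exists (fun w => if w == 0 then z^-1 ^+ 2 else - (w^-1 * z^-1)); split.
- move=> w; case: eqVneq => [->|w0].
    by rewrite invr0 !sub0r mulrN expr2 -mulrA mulVf// mulr1.
  by field; rewrite w0 z0.
- rewrite (negbTE z0).
  apply: (@ccvg_eq _ _ _ _ (fun w => - (w^-1 * z^-1))).
    exists (cabs z); first by rewrite cabs_gt0.
    by move=> w /=; case: eqVneq => // ->; rewrite sub0r cabsN ltxx.
  by apply: ccvgN; apply: ccvgM; [apply: ccvgV => //; exact: ccvg_id|exact: ccvg_cst].
- by rewrite (negbTE z0) expr2.
Qed.

Lemma cderV (f : R[i] -> R[i]) z a : f z != 0 -> has_cderiv f z a ->
  has_cderiv (fun w => (f w)^-1) z (- (f z)^-1 ^+ 2 * a).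
Proof. by move=> f0 fa; exact: cder_comp fa (cder_inv f0). Qed.

Lemma cder_near (f g : R[i] -> R[i]) z d : cnbhs z [set w | f w = g w] ->
  has_cderiv f z d -> has_cderiv g z d.
Proof.
move=> [e e0 He] /cderP fd; apply/cderP => e1 /fd[r r0 Hr].
exists (Num.min r e); first by rewrite lt_min r0.
move=> w; rewrite lt_min => /andP[wr we].
by rewrite -!He ?Hr// subrr cabs0.
Qed.

(** The slope at [z + h] is the difference quotient, so continuity of the slope
    function is convergence of the quotients. *)
Lemma cder_derivable (f : R[i] -> R[i]) z d : has_cderiv f z d ->
  derivable (f : R[i]^o -> R[i]^o) z 1.
Proof.
move=> [q [fq qc _]]; apply/cvg_ex; exists (q z : R[i]^o).
apply/cvgrPdist_lt => e e0.
have ei : (complex.Re e)%:C = e by exact: RRe_real (gtr0_real e0).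
have er : 0 < complex.Re e by rewrite -ltcR ei.
have [r r0 Hr] := qc _ er.
apply/nbhs_ballP; exists r%:C; first by rewrite /= ltcR.
move=> h /=; rewrite -ball_normE /ball_ /= sub0r normrN normCE ltcR => hr h0.
rewrite fq addrK /GRing.scale /= mulr1 (mulrC (q _)) mulrA mulVf ?mul1r//.
by rewrite distrC normCE -ei ltcR; apply: Hr; rewrite addrK.
Qed.
End ComplexDerivative.

Section RealPaths.
Variable R : realType.
Implicit Types z w d : R[i].

Lemma is_derive1P (g : R -> R) (t v : R) : is_derive t 1 g v <->
  forall e : R, 0 < e -> exists2 r : R, 0 < r & forall u, `|u - t| < r ->
    `|g u - g t - v * (u - t)| <= e * `|u - t|.
Proof.
split.
- move=> [/cvg_ex[l /= gl] gv] e e0.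
  have lv : l = v by rewrite -gv; apply/esym/cvg_lim.
  move: gl; rewrite lv => /cvgrPdist_lt/(_ _ e0)/nbhs_ballP[r /= r0 Hr].
  exists r => // u ur.
  have [->|ut] := eqVneq u t; first by rewrite !subrr mulr0 subrr normr0 mulr0.
  have ut0 : u - t != 0 by rewrite subr_eq0.
  have := Hr (u - t); rewrite /ball /= sub0r normrN => /(_ ur ut0).
  rewrite /GRing.scale /= mulr1 subrK => /ltW h.
  have -> : g u - g t - v * (u - t) = - ((v - (u - t)^-1 * (g u - g t)) * (u - t)).
    by field.
  by rewrite normrN normrM ler_wpM2r.
- move=> H; have gl : (fun h : R => h^-1 *: ((g \o shift t) (h *: 1) - g t)) @ 0^' --> v.
    apply/cvgrPdist_le => e e0; have [r r0 Hr] := H e e0.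
    apply/nbhs_ballP; exists r => // h; rewrite /ball /= sub0r normrN => hr h0.
    have := Hr (h + t); rewrite addrK => /(_ hr).
    rewrite /GRing.scale /= mulr1 => hh.
    rewrite distrC -(ler_pM2r (_ : 0 < `|h|)) ?normr_gt0// -normrM mulrBl.
    by rewrite -(mulrC h) mulrA divff// mul1r.
  by split; [apply/cvg_ex; exists v|exact: cvg_lim].
Qed.

(** Restricting to a line turns a complex derivative into two real ones, to which
    real calculus applies. *)
Lemma cder_path (f : R[i] -> R[i]) (a b d : R[i]) (t : R) :
  has_cderiv f (a + t%:C * b) d ->
  is_derive t 1 (fun u : R => complex.Re (f (a + u%:C * b))) (complex.Re (d * b)) /\
  is_derive t 1 (fun u : R => complex.Im (f (a + u%:C * b))) (complex.Im (d * b)).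
Proof.
move=> fd.
have H : forall e : R, 0 < e -> exists2 r : R, 0 < r & forall u : R, `|u - t| < r ->
    cabs (f (a + u%:C * b) - f (a + t%:C * b) - (u - t)%:C * (d * b)) <= e * `|u - t|.
  move=> e e0; have b1 : 0 < cabs b + 1 by rewrite ltr_wpDl ?cabs_ge0.
  have [r r0 Hr] := (cderP _ _ _).1 fd _ (divr_gt0 e0 b1).
  exists (r / (cabs b + 1)); first by rewrite divr_gt0.
  move=> u ut.
  have E : a + u%:C * b - (a + t%:C * b) = (u - t)%:C * b.
    by rewrite rmorphB mulrBl; ring.
  have E2 : cabs ((u - t)%:C * b) <= `|u - t| * (cabs b + 1).
    by rewrite cabsM cabs_real ler_wpM2l// lerDl.
  have := Hr (a + u%:C * b); rewrite E => /(_ _).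
  rewrite (_ : d * ((u - t)%:C * b) = (u - t)%:C * (d * b)); last by ring.
  move=> /(_ _)/le_trans; apply.
    by rewrite (le_lt_trans E2)// -ltr_pdivlMr.
  rewrite (le_trans (ler_wpM2l (ltW (divr_gt0 e0 b1)) E2))//.
  by rewrite mulrCA divfK ?lt0r_neq0// mulrC.
split; apply/is_derive1P => e /H[r r0 Hr]; exists r => // u /Hr; apply: le_trans.
  by apply: le_trans (le_Re_cabs _); rewrite !cReD !cReN cReZ (mulrC (u - t)).
by apply: le_trans (le_Im_cabs _); rewrite !cImD !cImN cImZ (mulrC (u - t)).
Qed.

(** The real mean value theorem holds for [Re (conj (f w - f z) f)] along the
    segment, whose total increment is [cabs (f w - f z) ^+ 2]; dividing by
    [cabs (f w - f z)] loses no constant. *)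
Lemma cmvt (f : R[i] -> R[i]) z w (M : R) :
  (forall t : R, 0 <= t <= 1 -> exists2 d, has_cderiv f (z + t%:C * (w - z)) d & cabs d <= M) ->
  cabs (f w - f z) <= M * cabs (w - z).
Proof.
move=> H; set c := f w - f z.
have [c0|c0] := eqVneq (cabs c) 0.
  have [d _ dM] : exists2 d, has_cderiv f (z + 0%:C * (w - z)) d & cabs d <= M.
    by apply: H; rewrite lexx ler01.
  by rewrite c0 mulr_ge0 ?cabs_ge0// (le_trans (cabs_ge0 _) dM).
pose h (u : R) := complex.Re (c^*%C * f (z + u%:C * (w - z))).
have hd (t : R) : 0 <= t <= 1 -> exists2 d : R, is_derive t 1 h d & d <= cabs c * (M * cabs (w - z)).
  move=> /H[d fd dM]; exists (complex.Re (c^*%C * d * (w - z))).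
    exact: (cder_path (cderMl c^*%C fd)).1.
  rewrite (le_trans (ler_norm _))// (le_trans (le_Re_cabs _))// !cabsM -mulrA.
  have -> : cabs c^*%C = cabs c by case: (c) => a b; rewrite !cabsE /= sqrrN.
  by rewrite ler_wpM2l ?cabs_ge0// ler_wpM2r ?cabs_ge0.
have [t t01] : exists2 t, t \in `]0, 1[%R & h 1 - h 0 = 'D_1 h t * (1 - 0).
  apply: MVT => //.
    move=> t; rewrite in_itv /= => /andP[t0 t1].
    by have [|d [? ?] _] := hd t; [rewrite !ltW|apply/derivableP].
  apply: derivable_within_continuous => t; rewrite in_itv /=.
  by move=> /hd[d [? ?] _].
rewrite subr0 mulr1.
have -> : h 1 - h 0 = cabs c * cabs c.
  rewrite /h !mul0r !mul1r addr0 (_ : z + _ = w); last by ring.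
  rewrite -cReN -cReD -mulrN -mulrDr -/c -expr2 cabsE sqr_sqrtr ?addr_ge0 ?sqr_ge0//.
  by case: (c) => a b /=; ring.
have [|d [_ <-] dM] := hd t.
  by move: t01; rewrite in_itv /= => /andP[? ?]; rewrite !ltW.
move=> E; move: dM; rewrite -E ler_pM2l//.
by rewrite lt_def c0 cabs_ge0.
Qed.

End RealPaths.

(** * The complex exponential *)
Section ComplexExponential.
Variable R : realType.
Implicit Types z w : R[i].

Lemma cexpD z w : cexp (z + w) = cexp z * cexp w.
Proof.
case: z w => [a b] [c d]; rewrite /cexp /= expRD cosD sinD.
by apply/eqP; rewrite eq_complex /=; apply/andP; split; apply/eqP; ring.
Qed.

Lemma cexp0 : cexp 0 = 1 :> R[i].
Proof. by rewrite /cexp /= expR0 cos0 sin0 mulr1 mulr0. Qed.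

Lemma cexp_neq0 z : cexp z != 0.
Proof.
apply/eqP => z0; have : cexp (z - z) = 0 by rewrite cexpD z0 mul0r.
by rewrite subrr cexp0 => /eqP; rewrite oner_eq0.
Qed.

Lemma cexpN z : cexp (- z) = (cexp z)^-1.
Proof.
by apply: (mulfI (cexp_neq0 z)); rewrite -cexpD subrr cexp0 divff ?cexp_neq0.
Qed.

Lemma cabs_cexp z : cabs (cexp z) = expR (complex.Re z).
Proof.
by rewrite cabsE /= !exprMn -mulrDr cos2Dsin2 mulr1 sqrtr_sqr ger0_norm ?expR_ge0.
Qed.

(** Follows from the real derivatives of exp, sin and cos at [0], without
    Cauchy-Riemann equations: the products of two small terms are absorbed by
    taking the radius small. *)
Lemma cder_cexp0 : has_cderiv (@cexp R) 0 1.
Proof.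
apply/cderP => e e0.
(* six error terms below are each at most [k * cabs z] *)
pose k := Num.min (e / 6) 1.
have k0 : 0 < k by rewrite lt_min divr_gt0 ?ltr01.
have k1 : k <= 1 by rewrite ge_min lexx orbT.
have ke : 6 * k <= e by rewrite mulrC -ler_pdivlMr// ge_min lexx.
have [r1 r10 H1] := (is_derive1P _ _ _).1 (is_derive_expR (0 : R)) k k0.
have [r2 r20 H2] := (is_derive1P _ _ _).1 (is_derive_sin (0 : R)) k k0.
have [r3 r30 H3] := (is_derive1P _ _ _).1 (is_derive_cos (0 : R)) k k0.
exists (Num.min (Num.min r1 r2) (Num.min r3 (k / 2))).
  by rewrite !lt_min r10 r20 r30 divr_gt0.
move=> z; rewrite subr0 !lt_min => /andP[/andP[z1 z2] /andP[z3 z4]].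
set a := complex.Re z; set b := complex.Im z.
have az : `|a| <= cabs z := le_Re_cabs z.
have bz : `|b| <= cabs z := le_Im_cabs z.
have := H1 a; rewrite subr0 expR0 mul1r => /(_ (le_lt_trans az z1)) {}H1.
have := H2 b; rewrite subr0 sin0 cos0 mul1r subr0 => /(_ (le_lt_trans bz z2)) {}H2.
have := H3 b; rewrite subr0 sin0 cos0 oppr0 mul0r subr0 => /(_ (le_lt_trans bz z3)) {}H3.
rewrite cexp0 mul1r (le_trans (cabs_le _))// !cReD !cImD !cReN !cImN /= -/a -/b subr0.
have ca := cos_max b; have sa := sin_max b.
set x := cabs z in z4 az bz *.
set p := expR a - 1 - a in H1; set q := sin b - b in H2.
have Ep : expR a = 1 + a + p by rewrite /p; ring.
have Eq : sin b = b + q by rewrite /q; ring.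
have Er : cos b = 1 + (cos b - 1) by ring.
have x0 : 0 <= x := cabs_ge0 z.
have Hp : `|p| <= k * x by rewrite (le_trans H1)// ler_wpM2l// ltW.
have Hq : `|q| <= k * x by rewrite (le_trans H2)// ler_wpM2l// ltW.
have Hr : `|cos b - 1| <= k * x by rewrite (le_trans H3)// ler_wpM2l// ltW.
have xk : x <= k / 2 by exact: ltW.
have kx : k * x <= x by rewrite ler_piMl.
have Hea : `|expR a| <= 2.
  rewrite Ep (le_trans (ler_normD _ _))// (le_trans (lerD (ler_normD _ _) (lexx _)))//.
  by rewrite normr1; lra.
have Hea1 : `|expR a - 1| <= k.
  rewrite (_ : _ - 1 = a + p); last by rewrite Ep; ring.
  by rewrite (le_trans (ler_normD _ _))//; lra.
have Hsb : `|sin b| <= 2 * x.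
  by rewrite Eq (le_trans (ler_normD _ _))//; lra.
have T1 : `|expR a * cos b - 1 - a| <= 3 * (k * x).
  rewrite (_ : _ - a = expR a * (cos b - 1) + p); last by rewrite /p; ring.
  rewrite (le_trans (ler_normD _ _))// normrM.
  have := ler_pM (normr_ge0 _) (normr_ge0 _) Hea Hr; lra.
have T2 : `|expR a * sin b - b| <= 3 * (k * x).
  rewrite (_ : _ - b = (expR a - 1) * sin b + q); last by rewrite /q; ring.
  rewrite (le_trans (ler_normD _ _))// normrM.
  have := ler_pM (normr_ge0 _) (normr_ge0 _) Hea1 Hsb; lra.
rewrite (le_trans (lerD T1 T2))// (_ : _ + _ = 6 * k * x); last by ring.
by rewrite ler_wpM2r.
Qed.

Lemma cder_cexp z : has_cderiv (@cexp R) z (cexp z).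
Proof.
have H : has_cderiv (fun w => cexp (w - z)) z (1 * 1).
  apply: (@cder_comp _ (fun w => w - z) (@cexp R)).
    by apply: cder_eq (cderB (cder_id z) (cder_cst z z)) _; rewrite subr0.
  by rewrite subrr; exact: cder_cexp0.
have := cderMl (cexp z) H; rewrite !mulr1; apply: cder_near.
by apply: filterE => w /=; rewrite -cexpD addrC subrK.
Qed.

End ComplexExponential.

(** * Complex-valued integrals and their dependence on a parameter *)
Section CountablyBased.
Variable R : realType.

(** Dominated convergence is about sequences; limits along a filter with a
    countable base are detected by sequences. *)
Definition countably_based {P} (F : set_system P) :=
  exists U : nat -> set P, (forall n, F (U n)) /\
    forall V, F V -> exists N, forall n, (N <= n)%N -> U n `<=` V.

(** Otherwise some [e] fails on every set of the base, and choosing a bad point in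
    each of them gives a sequence that contradicts the hypothesis. *)
Lemma seq_ccvg {P} (F : set_system P) {FF : ProperFilter F} (V : set P)
    (f : P -> R[i]) l : countably_based F -> F V ->
  (forall u : nat -> P, (forall n, V (u n)) ->
    (forall W, F W -> \forall n \near \oo, W (u n)) ->
    ccvg (nbhs \oo) (fun n => f (u n)) l) -> ccvg F f l.
Proof.
move=> [U [FU HU]] FV H; apply: contrapT => nfl.
have [e [e0 He]] : exists e : R, 0 < e /\ ~ F [set x | cabs (f x - l) < e].
  apply: contrapT => nex; apply: nfl => e e0; apply: contrapT => nF.
  by apply: nex; exists e.
have Hp n : exists p, [/\ U n p, V p & e <= cabs (f p - l)].
  apply: contrapT => nex; apply: He; apply: filterS (filterI (FU n) FV) => p [Up Vp].
  by rewrite /= ltNge; apply/negP => ep; apply: nex; exists p.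
have [u Hu] := choice Hp.
have /(_ e e0) : ccvg (nbhs \oo) (fun n => f (u n)) l.
  apply: H => [n|W /HU[N HN]]; first by have [] := Hu n.
  by exists N => // n /= Nn; apply: (HN n) => //; have [] := Hu n.
move=> [N _ /(_ N (leqnn N))] /=; have [_ _] := Hu N.
by move=> h1 h2; have := le_lt_trans h1 h2; rewrite ltxx.
Qed.

Lemma countably_based_cnbhs (z : R[i]) : countably_based (cnbhs z).
Proof.
exists (fun n => [set w | cabs (w - z) < n.+1%:R^-1]); split.
  by move=> n; exists n.+1%:R^-1 => //; rewrite invr_gt0.
move=> V [e e0 He]; have [N _ HN] := near_infty_natSinv_lt (PosNum e0).
by exists N => n Nn w /= wn; apply: He; rewrite (lt_trans wn)//; exact: HN.
Qed.

Lemma countably_based_nbhs {X : pseudoMetricType R} (E : set X) (x : X) :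
  countably_based (within E (nbhs x)).
Proof.
exists (fun n => E `&` ball x n.+1%:R^-1); split.
  move=> n; rewrite /within /=.
  have : nbhs x (ball x n.+1%:R^-1) by exact: nbhsx_ballx.
  by apply: filterS.
move=> V /nbhs_ballP[e /= e0 He]; have [N _ HN] := near_infty_natSinv_lt (PosNum e0).
exists N => n Nn y [Ey xy]; apply: He Ey.
by apply: le_ball xy; apply/ltW; exact: HN.
Qed.

Lemma within_nbhs_properP {X : topologicalType} (E : set X) (x : X) :
  E x -> ProperFilter (within E (nbhs x)).
Proof.
by move=> Ex; split; [move=> /nbhs_singleton; exact|exact: within_filter].
Qed.

End CountablyBased.

Section ComplexIntegral.
Context d (T : measurableType d) (R : realType) (mu : {measure set T -> \bar R}).
Variable D : set T.
Hypothesis mD : measurable D.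
Implicit Types h : T -> R[i].

Definition Cmeas h := measurable_fun D (fun t => complex.Re (h t)) /\
  measurable_fun D (fun t => complex.Im (h t)).

Lemma CmeasM h1 h2 : Cmeas h1 -> Cmeas h2 -> Cmeas (fun t => h1 t * h2 t).
Proof.
move=> [a b] [c e]; split.
  by under eq_fun do rewrite cReM; apply: measurable_funB; exact: measurable_funM.
by under eq_fun do rewrite cImM; apply: measurable_funD; exact: measurable_funM.
Qed.

Lemma Cintegrable_dom h (g : T -> R) : Cmeas h -> mu.-integrable D (EFin \o g) ->
  (forall t, D t -> cabs (h t) <= g t) -> Cintegrable mu D h.
Proof.
move=> [mr mi] ig hg; split; apply: le_integrable ig => //.
- exact/measurable_EFinP.
- move=> t Dt /=; rewrite lee_fin (le_trans (le_Re_cabs _))// (le_trans (hg _ Dt))//.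
  exact: ler_norm.
- exact/measurable_EFinP.
- move=> t Dt /=; rewrite lee_fin (le_trans (le_Im_cabs _))// (le_trans (hg _ Dt))//.
  exact: ler_norm.
Qed.

Lemma eq_Cintegral h1 h2 : (forall t, D t -> h1 t = h2 t) ->
  Cintegral mu D h1 = Cintegral mu D h2.
Proof.
by move=> E; congr Complex; apply: eq_Rintegral => t; rewrite inE => /E ->.
Qed.

Lemma eq_Cintegrable h1 h2 : (forall t, D t -> h1 t = h2 t) ->
  Cintegrable mu D h1 -> Cintegrable mu D h2.
Proof.
move=> E [a b]; split.
  by apply: eq_integrable a => // t; rewrite inE => /E ->.
by apply: eq_integrable b => // t; rewrite inE => /E ->.
Qed.

Lemma CintegralD h1 h2 : Cintegrable mu D h1 -> Cintegrable mu D h2 ->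
  Cintegral mu D (fun t => h1 t + h2 t) = Cintegral mu D h1 + Cintegral mu D h2.
Proof.
move=> [a b] [c e]; apply/eqP; rewrite eq_complex /=; apply/andP; split; apply/eqP.
  by under eq_Rintegral do rewrite cReD; exact: RintegralD.
by under eq_Rintegral do rewrite cImD; exact: RintegralD.
Qed.

Lemma CintegrableD h1 h2 : Cintegrable mu D h1 -> Cintegrable mu D h2 ->
  Cintegrable mu D (fun t => h1 t + h2 t).
Proof.
move=> [a b] [c e]; split.
  by under eq_fun do rewrite cReD EFinD; exact: integrableD.
by under eq_fun do rewrite cImD EFinD; exact: integrableD.
Qed.

Lemma CintegrableZ (c : R[i]) h : Cintegrable mu D h -> Cintegrable mu D (fun t => c * h t).
Proof.
move=> [a b]; split.
  under eq_fun do rewrite cReM EFinB !EFinM.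
  by apply: integrableB => //; exact: integrableZl.
under eq_fun do rewrite cImM EFinD !EFinM.
by apply: integrableD => //; exact: integrableZl.
Qed.

Lemma CintegralZ (c : R[i]) h : Cintegrable mu D h ->
  Cintegral mu D (fun t => c * h t) = c * Cintegral mu D h.
Proof.
move=> [a b]; have iZ (r : R) (f : T -> R) : mu.-integrable D (EFin \o f) ->
    mu.-integrable D (EFin \o (fun t => r * f t)).
  move=> fi; rewrite (_ : _ \o _ = (fun t => r%:E * (f t)%:E)%E); last exact/funext.
  exact: integrableZl.
apply/eqP; rewrite eq_complex cReM cImM /=; apply/andP; split; apply/eqP.
  under eq_Rintegral do rewrite cReM.
  by rewrite RintegralB ?RintegralZl//; exact: iZ.
under eq_Rintegral do rewrite cImM.
by rewrite RintegralD ?RintegralZl//; exact: iZ.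
Qed.

Lemma CintegrableB h1 h2 : Cintegrable mu D h1 -> Cintegrable mu D h2 ->
  Cintegrable mu D (fun t => h1 t - h2 t).
Proof.
move=> i1 i2; have /(CintegrableD i1) := CintegrableZ (-1) i2.
by apply: eq_Cintegrable => t _; rewrite mulN1r.
Qed.

Lemma CintegralB h1 h2 : Cintegrable mu D h1 -> Cintegrable mu D h2 ->
  Cintegral mu D (fun t => h1 t - h2 t) = Cintegral mu D h1 - Cintegral mu D h2.
Proof.
move=> i1 i2; rewrite -[in RHS]mulN1r -CintegralZ// -CintegralD//.
  by apply: eq_Cintegral => t _; rewrite mulN1r.
exact: CintegrableZ.
Qed.

(** The factor [2] comes from bounding real and imaginary part separately. *)
Lemma cabs_Cintegral_le h (g : T -> R) : Cmeas h -> mu.-integrable D (EFin \o g) ->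
  (forall t, D t -> cabs (h t) <= g t) ->
  cabs (Cintegral mu D h) <= 2 * Rintegral mu D g.
Proof.
move=> mh ig hg; have [ir ii] := Cintegrable_dom mh ig hg.
rewrite (le_trans (cabs_le _))// /= mulr_natl mulr2n lerD//.
  rewrite (le_trans (le_normr_Rintegral _ _))// le_Rintegral//.
    exact: integrable_norm.
  by move=> t Dt; rewrite (le_trans (le_Re_cabs _))// hg.
rewrite (le_trans (le_normr_Rintegral _ _))// le_Rintegral//.
  exact: integrable_norm.
by move=> t Dt; rewrite (le_trans (le_Im_cabs _))// hg.
Qed.

Lemma dominated_Rintegral (f_ : nat -> T -> R) (f g : T -> R) :
  (forall n, measurable_fun D (f_ n)) -> (forall t, D t -> f_ n t @[n --> \oo] --> f t) ->
  mu.-integrable D (EFin \o g) -> (forall n t, D t -> `|f_ n t| <= g t) ->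
  measurable_fun D f /\
  Rintegral mu D (f_ n) @[n --> \oo] --> Rintegral mu D f.
Proof.
move=> mf_ ff ig fg.
have mf : measurable_fun D f by exact: measurable_fun_cvg ff.
split => //.
have ff' t : D t -> (f_ n t)%:E @[n --> \oo] --> (f t)%:E.
  by move=> Dt; apply: cvg_EFin; [exact: nearW|exact: ff].
have [i1 _ i3] := @dominated_convergence _ T R mu D mD (fun n => EFin \o f_ n) (EFin \o f)
  (EFin \o g) (fun n => (measurable_EFinP _ _).2 (mf_ n)) ((measurable_EFinP _ _).2 mf)
  (aeW _ ff') ig
  (aeW _ (fun t n Dt => fg n t Dt)).
apply: fine_cvg; rewrite fineK//.
exact: integrable_fin_num.
Qed.

(** The limit function is measurable because it is the limit of a sequence taken
    from the filter. *)
Lemma dominated_ccvg {P} (F : set_system P) {FF : ProperFilter F} (V : set P)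
    (h : P -> T -> R[i]) (h0 : T -> R[i]) (g : T -> R) :
  countably_based F -> F V -> (forall p, V p -> Cmeas (h p)) ->
  (forall t, D t -> ccvg F (h^~ t) (h0 t)) ->
  mu.-integrable D (EFin \o g) ->
  (forall p, V p -> forall t, D t -> cabs (h p t) <= g t) ->
  Cintegrable mu D h0 /\
  ccvg F (fun p => Cintegral mu D (h p)) (Cintegral mu D h0).
Proof.
move=> cF FV mh hh ig hg.
have S (u : nat -> P) : (forall n, V (u n)) ->
    (forall W, F W -> \forall n \near \oo, W (u n)) ->
    Cmeas h0 /\ ccvg (nbhs \oo) (fun n => Cintegral mu D (h (u n))) (Cintegral mu D h0).
  move=> Vu Fu.
  have hu t : D t -> ccvg (nbhs \oo) (fun n => h (u n) t) (h0 t).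
    by move=> Dt e e0; exact: Fu (hh t Dt e e0).
  have [mr cr] := @dominated_Rintegral (fun n t => complex.Re (h (u n) t))
    (fun t => complex.Re (h0 t)) g (fun n => (mh _ (Vu n)).1)
    (fun t Dt => ((ccvg_ReIm _ _).1 (hu t Dt)).1) ig
    (fun n t Dt => le_trans (le_Re_cabs _) (hg _ (Vu n) t Dt)).
  have [mi ci] := @dominated_Rintegral (fun n t => complex.Im (h (u n) t))
    (fun t => complex.Im (h0 t)) g (fun n => (mh _ (Vu n)).2)
    (fun t Dt => ((ccvg_ReIm _ _).1 (hu t Dt)).2) ig
    (fun n t Dt => le_trans (le_Im_cabs _) (hg _ (Vu n) t Dt)).
  by split; [split|apply/ccvg_ReIm].
split; last by apply: (seq_ccvg cF FV) => u Vu Fu; have [] := S u Vu Fu.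
have [U [FU HU]] := cF.
have /choice[u Hu] n : exists p, U n p /\ V p.
  exact: filter_ex (filterI (FU n) FV).
have [|W FW|mh0 _] := S u.
- by move=> n; have [] := Hu n.
- have [N HN] := HU W FW.
  by exists N => // n /= Nn; apply: (HN n) => //; have [] := Hu n.
apply: (Cintegrable_dom mh0 ig) => t Dt; apply/ler_addgt0Pr => e e0.
have [p [/= hp Vp]] := filter_ex (filterI (hh t Dt e e0) FV).
rewrite -(subrK (h p t) (h0 t)) (le_trans (cabsD _ _))// addrC lerD//.
  exact: hg.
by rewrite cabsB ltW.
Qed.

End ComplexIntegral.

Lemma Cintegral_restrict {d} {T : measurableType d} {R : realType}
    (mu : {measure set T -> \bar R}) (S C : set T) (h : T -> R[i]) :
  C `<=` S -> (forall t, S t -> ~ C t -> h t = 0) ->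
  Cintegral mu S h = Cintegral mu C h.
Proof.
move=> CS h0.
have E (u : R[i] -> R) : u 0 = 0 ->
    Rintegral mu S (fun t => u (h t)) = Rintegral mu C (fun t => u (h t)).
  move=> u0; rewrite Rintegral_mkcond [RHS]Rintegral_mkcond.
  apply: eq_Rintegral => t _; rewrite !patchE.
  case: ifPn => [|/negP]; rewrite inE => St; case: ifPn => [|/negP]; rewrite inE => Ct //.
    by rewrite h0.
  by case: St; exact: CS.
by rewrite /Cintegral (E (@complex.Re R))// (E (@complex.Im R)).
Qed.

Section ParametricDerivative.
Context d (T : measurableType d) (R : realType) (mu : {measure set T -> \bar R}).
Variable D : set T.
Hypothesis mD : measurable D.

Lemma segment_cball (z w : R[i]) (r t : R) : cabs (w - z) < r -> 0 <= t <= 1 ->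
  cabs (z + t%:C * (w - z) - z) < r.
Proof.
move=> wr /andP[t0 t1]; rewrite addrC addKr cabsM cabs_real ger0_norm//.
by apply: le_lt_trans wr; rewrite ler_piMl ?cabs_ge0.
Qed.

(** By [cmvt] the difference quotients are dominated by [g] on the disc, and they
    converge pointwise to [h']; dominated convergence applies along the punctured
    neighbourhoods of [z]. *)
Lemma cder_Cintegral (h h' : T -> R[i] -> R[i]) (z : R[i]) (r : R) (g : T -> R) :
  0 < r -> mu.-integrable D (EFin \o g) ->
  (forall w, cabs (w - z) < r -> Cintegrable mu D (h^~ w)) ->
  (forall t w, D t -> cabs (w - z) < r ->
     has_cderiv (h t) w (h' t w) /\ cabs (h' t w) <= g t) ->
  has_cderiv (fun w => Cintegral mu D (h^~ w)) z (Cintegral mu D (h'^~ z)).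
Proof.
move=> r0 ig ih dh.
pose F := within [set w | w != z] (cnbhs z).
have FF : ProperFilter F.
  split; last exact: within_filter.
  move=> [e e0 /(_ (z + (e / 2)%:C))]; apply.
    rewrite addrC addKr cabs_real ger0_norm ?divr_ge0 ?ltW//.
    by rewrite ltr_pdivrMr// mulr_natr mulr2n ltrDl.
  rewrite /= -subr_eq0 addrC addKr -cabs_eq0 cabs_real normr_eq0.
  by rewrite gt_eqF// divr_gt0.
have cF : countably_based F.
  have [U [FU HU]] := countably_based_cnbhs z.
  exists (fun n => [set w | w != z] `&` U n); split.
    by move=> n; apply: filterS (FU n).
  move=> V /HU[N HN]; exists N => n Nn w [wz Uw].
  exact: HN Nn _ Uw wz.
pose V := [set w | cabs (w - z) < r /\ w != z].
have FV : F V by exists r.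
pose q (w : R[i]) (t : T) := (w - z)^-1 * (h t w - h t z).
have iq w : V w -> Cintegrable mu D (q w).
  move=> [wr wz]; apply: CintegrableZ => //; apply: CintegrableB => //; apply: ih => //.
  by rewrite subrr cabs0.
have [_ qcvg] : Cintegrable mu D (h'^~ z) /\
    ccvg F (fun w => Cintegral mu D (q w)) (Cintegral mu D (h'^~ z)).
  apply: (@dominated_ccvg _ T R mu D mD _ F FF V q (h'^~ z) g) => //.
  - move=> w /iq[qr qi].
    by split; apply/measurable_EFinP; [exact: measurable_int qr|exact: measurable_int qi].
  - move=> t Dt; have [|/cderP hd _] := dh t z Dt; first by rewrite subrr cabs0.
    move=> e e0; have [s s0 Hs] := hd (e / 2) (divr_gt0 e0 (ltr0n _ 2)).
    exists s => // w ws wz /=; have wz0 : w - z != 0 by rewrite subr_eq0.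
    have -> : q w t - h' t z = (h t w - h t z - h' t z * (w - z)) / (w - z).
      by rewrite /q [RHS]mulrBl mulfK// (mulrC (w - z)^-1).
    rewrite cabsM cabsV ltr_pdivrMr ?cabs_gt0// (le_lt_trans (Hs _ ws))//.
    by rewrite ltr_pM2r ?cabs_gt0// ltr_pdivrMr// mulr_natr mulr2n ltrDl.
  - move=> w [wr wz] t Dt; have wz0 : w - z != 0 by rewrite subr_eq0.
    rewrite /q cabsM cabsV mulrC ler_pdivrMr ?cabs_gt0//.
    apply: cmvt => s s01; have [hd hg] := dh t _ Dt (segment_cball wr s01).
    by exists (h' t (z + s%:C * (w - z))).
apply/cderP => e e0; have [s s0 Hs] := qcvg e e0.
exists (Num.min r s); first by rewrite lt_min r0.
move=> w; rewrite lt_min => /andP[wr ws].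
have [->|wz] := eqVneq w z; first by rewrite !subrr mulr0 subrr cabs0 mulr0.
have wz0 : w - z != 0 by rewrite subr_eq0.
have iz : Cintegrable mu D (h^~ z) by apply: ih; rewrite subrr cabs0.
have Eq : Cintegral mu D (q w) =
    (w - z)^-1 * (Cintegral mu D (h^~ w) - Cintegral mu D (h^~ z)).
  rewrite -(CintegralB mD (ih _ wr) iz).
  exact: CintegralZ mD _ _ (CintegrableB mD (ih _ wr) iz).
have : cabs (Cintegral mu D (q w) - Cintegral mu D (h'^~ z)) < e := Hs w ws wz.
rewrite Eq.
set a := Cintegral mu D (h^~ w); set b := Cintegral mu D (h^~ z).
set c := Cintegral mu D (h'^~ z) => /ltW ab.
have -> : a - b - c * (w - z) = ((w - z)^-1 * (a - b) - c) * (w - z).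
  by rewrite mulrBl mulrAC mulVf// mul1r.
by rewrite cabsM ler_wpM2r ?cabs_ge0.
Qed.
End ParametricDerivative.

(** * Differentiable families with a continuous parameter *)
Section Families.
Variable R : realType.

Definition copen (D : set R[i]) := forall z, D z -> cnbhs z D.

Definition ccontinuous_on {X : topologicalType} (E : set X) (f : X -> R[i]) :=
  forall x, E x -> ccvg (within E (nbhs x)) f (f x).

Definition loc_bounded {X : Type} (E : set X) (D : set R[i]) (k : X -> R[i] -> R[i]) :=
  forall z, D z -> exists M : R,
    cnbhs z [set w | forall x, E x -> cabs (k x w) <= M].

(** [n] complex derivatives in [z], each continuous in the parameter and locally
    bounded uniformly in it.  These are the hypotheses that dominated convergence
    needs, and they pass to integrals over part of the parameters. *)
Fixpoint Cfam {X : topologicalType} n (E : set X) (D : set R[i])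
    (k : X -> R[i] -> R[i]) : Prop :=
  [/\ forall z, D z -> ccontinuous_on E (k^~ z), loc_bounded E D k &
      if n is m.+1 then exists k', (forall x z, E x -> D z ->
        has_cderiv (k x) z (k' x z)) /\ Cfam m E D k' else True].

Lemma ccontinuous_onD {X : topologicalType} (E : set X) (f g : X -> R[i]) :
  ccontinuous_on E f -> ccontinuous_on E g -> ccontinuous_on E (fun x => f x + g x).
Proof. by move=> fc gc x Ex; exact: ccvgD (fc x Ex) (gc x Ex). Qed.

Lemma ccontinuous_onM {X : topologicalType} (E : set X) (f g : X -> R[i]) :
  ccontinuous_on E f -> ccontinuous_on E g -> ccontinuous_on E (fun x => f x * g x).
Proof. by move=> fc gc x Ex; exact: ccvgM (fc x Ex) (gc x Ex). Qed.

Lemma ccontinuous_on_cst {X : topologicalType} (E : set X) (c : R[i]) :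
  ccontinuous_on E (fun=> c).
Proof. by move=> x Ex; exact: ccvg_cst. Qed.

Lemma ccontinuous_on_real {X : topologicalType} (E : set X) (r : X -> R) :
  (forall x, E x -> r t @[t --> x] --> r x) -> ccontinuous_on E (fun x => (r x)%:C).
Proof.
move=> rc x Ex; apply/ccvg_ReIm; split => /=; last exact: cvg_cst.
exact: cvg_within_filter (rc x Ex).
Qed.

Context {X : topologicalType}.
Implicit Types (E : set X) (D : set R[i]) (k : X -> R[i] -> R[i]).

Lemma Cfam_pred n E D k : Cfam n.+1 E D k -> Cfam n E D k.
Proof.
elim: n k => [|n IH] k; first by case.
by move=> [c b [k' [dk /IH Hk']]]; split=> //; exists k'.
Qed.

Lemma loc_boundedD E D k1 k2 : loc_bounded E D k1 -> loc_bounded E D k2 ->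
  loc_bounded E D (fun x z => k1 x z + k2 x z).
Proof.
move=> b1 b2 z Dz; have [M1 H1] := b1 z Dz; have [M2 H2] := b2 z Dz.
exists (M1 + M2); apply: filterS (filterI H1 H2) => w [h1 h2] x Ex.
by rewrite (le_trans (cabsD _ _))// lerD ?h1 ?h2.
Qed.

Lemma loc_boundedM E D k1 k2 : loc_bounded E D k1 -> loc_bounded E D k2 ->
  loc_bounded E D (fun x z => k1 x z * k2 x z).
Proof.
move=> b1 b2 z Dz; have [M1 H1] := b1 z Dz; have [M2 H2] := b2 z Dz.
exists (M1 * M2); apply: filterS (filterI H1 H2) => w [h1 h2] x Ex.
by rewrite cabsM ler_pM ?cabs_ge0 ?h1 ?h2.
Qed.

Lemma CfamD n E D k1 k2 : Cfam n E D k1 -> Cfam n E D k2 ->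
  Cfam n E D (fun x z => k1 x z + k2 x z).
Proof.
elim: n k1 k2 => [|n IH] k1 k2 [c1 b1 H1] [c2 b2 H2].
  by split=> //; [move=> z Dz; exact: ccontinuous_onD (c1 z Dz) (c2 z Dz)|exact: loc_boundedD].
split; [by move=> z Dz; exact: ccontinuous_onD (c1 z Dz) (c2 z Dz)|exact: loc_boundedD|].
move: H1 H2 => [k1' [d1 H1]] [k2' [d2 H2]].
exists (fun x z => k1' x z + k2' x z); split; last exact: IH.
by move=> x z Ex Dz; exact: cderD (d1 x z Ex Dz) (d2 x z Ex Dz).
Qed.

(** Leibniz rule: the derivative is a sum of two products of families of one order
    less, so the induction runs over all pairs of families at once. *)
Lemma CfamM n E D k1 k2 : Cfam n E D k1 -> Cfam n E D k2 ->
  Cfam n E D (fun x z => k1 x z * k2 x z).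
Proof.
elim: n k1 k2 => [|n IH] k1 k2 F1 F2.
  move: F1 F2 => [c1 b1 H1] [c2 b2 H2].
  by split=> //; [move=> z Dz; exact: ccontinuous_onM (c1 z Dz) (c2 z Dz)|exact: loc_boundedM].
have G1 := Cfam_pred F1; have G2 := Cfam_pred F2.
move: F1 F2 => [c1 b1 H1] [c2 b2 H2].
split; [by move=> z Dz; exact: ccontinuous_onM (c1 z Dz) (c2 z Dz)|exact: loc_boundedM|].
move: H1 H2 => [k1' [d1 H1]] [k2' [d2 H2]].
exists (fun x z => k1' x z * k2 x z + k1 x z * k2' x z); split.
  by move=> x z Ex Dz; exact: cderM (d1 x z Ex Dz) (d2 x z Ex Dz).
by apply: CfamD; exact: IH.
Qed.

Lemma Cfam_cst n E D (c : X -> R[i]) (M : R) : ccontinuous_on E c ->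
  (forall x, E x -> cabs (c x) <= M) -> Cfam n E D (fun x _ => c x).
Proof.
have Z m : Cfam m E D (fun _ _ => 0).
  elim: m => [|m IH]; split=> //.
  - by move=> z Dz; exact: ccontinuous_on_cst.
  - by move=> z Dz; exists 0; exists 1 => // w _ x _; rewrite cabs0.
  - by move=> z Dz; exact: ccontinuous_on_cst.
  - by move=> z Dz; exists 0; exists 1 => // w _ x _; rewrite cabs0.
  - by exists (fun _ _ => 0); split=> // x z _ _; exact: cder_cst.
move=> cc cM.
have B : loc_bounded E D (fun x _ => c x).
  by move=> z Dz; exists M; exists 1 => // w _ x; exact: cM.
case: n => [|n]; split=> //.
by exists (fun _ _ => 0); split=> // x z _ _; exact: cder_cst.
Qed.

Lemma Cfam_id n E D : Cfam n E D (fun _ z => z).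
Proof.
have B : loc_bounded E D (fun _ z => z).
  move=> z Dz; exists (cabs z + 1); exists 1 => // w wz x _.
  by rewrite -(subrK z w) (le_trans (cabsD _ _))// addrC lerD// ltW.
case: n => [|n]; split=> //; try (by move=> z _; exact: ccontinuous_on_cst).
exists (fun _ _ => 1); split; first by move=> x z _ _; exact: cder_id.
apply: (@Cfam_cst _ _ _ (fun=> 1) 1); first exact: ccontinuous_on_cst.
by move=> x _; rewrite cabs1.
Qed.

Lemma Cfam_dom n E D D' k :
  D' `<=` D -> Cfam n E D k -> Cfam n E D' k.
Proof.
move=> DD; elim: n k => [|n IH] k [c b H]; split=> //.
- by move=> z /DD; exact: c.
- by move=> z /DD; exact: b.
- by move=> z /DD; exact: c.
- by move=> z /DD; exact: b.
- move: H => [k' [dk /IH Hk']]; exists k'; split=> // x z Ex /DD; exact: dk.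
Qed.

Lemma Cfam_comp (Y : topologicalType) n (E : set X) (E' : set Y) D k (p : Y -> X) :
  (forall y, E' y -> E (p y)) -> (forall y, E' y -> p y' @[y' --> within E' (nbhs y)] --> p y) ->
  Cfam n E D k -> Cfam n E' D (fun y z => k (p y) z).
Proof.
move=> EE pc; elim: n k => [|n IH] k [c b H]; split=> //.
1,3: move=> z Dz y Ey e e0; have := c z Dz _ (EE y Ey) e e0 => /(pc y Ey) /=;
  by apply: (@filterS _ (nbhs y)) => y' h Ey'; exact: h Ey' (EE _ Ey').
1,2: by move=> z Dz; have [M HM] := b z Dz; exists M; apply: filterS HM => w + y /EE; exact.
move: H => [k' [dk Hk']]; exists (fun y z => k' (p y) z); split; last exact: IH.
by move=> y z /EE; exact: dk.
Qed.

End Families.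

Section FamilyIntegral.
Variable R : realType.
(** The measurable type [T] and the topological type [Y] have the same carrier in
    each use; [toY] is then the identity and [borel] says that continuous functions
    are measurable. *)
Context {X Y : pseudoMetricType R} d (T : measurableType d)
  (mu : {measure set T -> \bar R}) (toY : T -> Y) (K : set Y).
Let TK : set T := toY @^-1` K.
Hypothesis mTK : measurable TK.
Hypothesis fTK : (mu TK < +oo)%E.
Hypothesis borel : forall h : Y -> R[i], ccontinuous_on K h ->
  Cmeas TK (fun t => h (toY t)).

Lemma integrable_const (M : R) : mu.-integrable TK (EFin \o (fun=> M)).
Proof.
apply: measurable_bounded_integrable => //.
exists `|M|; split; first exact: num_real.
by move=> x Mx t _ /=; exact: ltW.
Qed.

Lemma ccontinuous_on_slice1 (E : set X) (h : X * Y -> R[i]) (y : Y) :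
  K y -> ccontinuous_on (E `*` K) h -> ccontinuous_on E (fun x => h (x, y)).
Proof.
move=> Ky hc x Ex e e0.
have := hc (x, y) (conj Ex Ky) e e0; rewrite /within /= => H.
have : (fun x' => (x', y)) @ nbhs x --> (x, y).
  by apply: cvg_pair; [exact: cvg_id|exact: cvg_cst].
move=> /(_ _ H); apply: (@filterS _ (nbhs x)) => x' h' Ex'.
by apply: h'; split.
Qed.

Lemma ccontinuous_on_slice2 (E : set X) (h : X * Y -> R[i]) (x : X) :
  E x -> ccontinuous_on (E `*` K) h -> ccontinuous_on K (fun y => h (x, y)).
Proof.
move=> Ex hc y Ky e e0.
have := hc (x, y) (conj Ex Ky) e e0; rewrite /within /= => H.
have : (fun y' => (x, y')) @ nbhs y --> (x, y).
  by apply: cvg_pair; [exact: cvg_cst|exact: cvg_id].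
move=> /(_ _ H); apply: (@filterS _ (nbhs y)) => y' h' Ky'.
by apply: h'; split.
Qed.

(** Continuity in [x] is dominated convergence, and differentiability in [z] is
    [cder_Cintegral]; the derivative is the integral of a family of one order less. *)
Lemma Cfam_Cintegral n (E : set X) (D : set R[i]) (k : X * Y -> R[i] -> R[i]) :
  copen D -> Cfam n (E `*` K) D k ->
  Cfam n E D (fun x z => Cintegral mu TK (fun t => k (x, toY t) z)).
Proof.
move=> oD.
have meas (k0 : X * Y -> R[i] -> R[i]) x z : E x -> D z ->
    (forall z, D z -> ccontinuous_on (E `*` K) (k0^~ z)) ->
    Cmeas TK (fun t => k0 (x, toY t) z).
  move=> Ex Dz c; apply: (borel (h := fun y => k0 (x, y) z)).
  exact: (ccontinuous_on_slice2 Ex (c z Dz)).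
have base (k0 : X * Y -> R[i] -> R[i]) :
    (forall z, D z -> ccontinuous_on (E `*` K) (k0^~ z)) ->
    loc_bounded (E `*` K) D k0 ->
    (forall z, D z -> ccontinuous_on E (fun x => Cintegral mu TK (fun t => k0 (x, toY t) z))) /\
    loc_bounded E D (fun x z => Cintegral mu TK (fun t => k0 (x, toY t) z)).
  move=> c b; split.
    move=> z Dz x Ex; have [M [r r0 HM]] := b z Dz.
    have := within_nbhs_properP Ex => FF.
    apply: (dominated_ccvg mTK (V := E) (g := fun=> M) _ _ _ _ _ _).2 => //.
    + exact: countably_based_nbhs.
    + exact: withinT.
    + by move=> p Ep; exact: meas.
    + by move=> t Kt; exact: (ccontinuous_on_slice1 Kt (c z Dz)).
    + exact: integrable_const.
    + by move=> p Ep t Kt; apply: HM; rewrite ?subrr ?cabs0.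
  move=> z Dz; have [M HM] := b z Dz; exists (2 * Rintegral mu TK (fun=> M)).
  apply: filterS (filterI HM (oD z Dz)) => w [hM Dw] x Ex.
  apply: cabs_Cintegral_le => //; first exact: meas.
    exact: integrable_const.
  by move=> t Kt; exact: hM.
elim: n k => [|n IH] k [c b H].
  by have [c' b'] := base k c b.
have [c' b'] := base k c b; split=> //.
move: H => [k' [dk Hk']].
exists (fun x z => Cintegral mu TK (fun t => k' (x, toY t) z)); split; last exact: IH.
move=> x z Ex Dz.
have [ck' bk'] : (forall z, D z -> ccontinuous_on (E `*` K) (k'^~ z)) /\
   loc_bounded (E `*` K) D k' by case: (n) Hk' => [|m] [].
have [M [r r0 HM]] := bk' z Dz.
have [s s0 Hs] := oD z Dz.
apply: (@cder_Cintegral _ T R mu TK mTK (fun t z => k (x, toY t) z)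
  (fun t z => k' (x, toY t) z) z (Num.min r s) (fun=> M)) => //.
- by rewrite lt_min r0.
- exact: integrable_const.
- move=> w; rewrite lt_min => /andP[_ /Hs Dw].
  have [M' [r' r'0 HM']] := b w Dw.
  apply: (Cintegrable_dom mTK (g := fun=> M')) => //; first exact: meas.
    exact: integrable_const.
  by move=> t Kt; apply: HM'; rewrite ?subrr ?cabs0.
- move=> t w Kt; rewrite lt_min => /andP[/HM wr /Hs Dw]; split; first exact: dk.
  exact: wr.
Qed.

End FamilyIntegral.

Section ExponentialFamily.
Variable R : realType.
Context {X : topologicalType}.
Implicit Types (E : set X) (c : X -> R[i]).

(** Differentiation multiplies by [c x], which is a bounded constant family. *)
Lemma Cfam_cexp n E (c : X -> R[i]) (L : R) : ccontinuous_on E c ->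
  (forall x, E x -> cabs (c x) <= L) -> Cfam n E setT (fun x z => cexp (c x * z)).
Proof.
move=> cc cL.
have C z : setT z -> ccontinuous_on E (fun x => cexp (c x * z)).
  move=> _ x Ex; apply: (@ccvg_comp _ _ _ (fun x => c x * z)) (cder_cont (cder_cexp _)) _.
  exact: ccvgM (cc x Ex) (ccvg_cst z).
have B : loc_bounded E setT (fun x z => cexp (c x * z)).
  move=> z _; exists (expR (L * (cabs z + 1))); exists 1 => // w wz x Ex.
  have L0 : 0 <= L by apply: le_trans (cL x Ex); exact: cabs_ge0.
  rewrite cabs_cexp ler_expR (le_trans (ler_norm _))// (le_trans (le_Re_cabs _))//.
  rewrite cabsM ler_pM ?cabs_ge0 ?cL//.
  by rewrite -(subrK z w) (le_trans (cabsD _ _))// addrC lerD// ltW.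
elim: n => [|n IH]; split=> //.
exists (fun x z => c x * cexp (c x * z)); split.
  move=> x z Ex _; apply: cder_eq (cder_comp (cderMl (c x) (cder_id z)) (cder_cexp _)) _.
  by rewrite mulr1 mulrC.
by apply: CfamM => //; exact: Cfam_cst cc cL.
Qed.
End ExponentialFamily.

(** * The factors tanh (pi z c) *)
Section TanhFamily.
Variable R : realType.

(** The domain of [F]: the poles of [tanh (pi z c)], for real [c] with [|c| <= 1], lie
    on the two imaginary half-lines that start at [i / 2] and [- i / 2]. *)
Definition strip_dom : set R[i] :=
  [set z | ~ (complex.Re z = 0 /\ 2^-1 <= `|complex.Im z|)].

(** Twice cosh and sinh, so that [ctanh] is [csh / cch] by definition. *)
Definition cch (w : R[i]) : R[i] := cexp w + cexp (- w).
Definition csh (w : R[i]) : R[i] := cexp w - cexp (- w).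

Arguments cch : simpl never.
Arguments csh : simpl never.

Lemma cder_cexpN (w : R[i]) : has_cderiv (fun u => cexp (- u)) w (- cexp (- w)).
Proof.
by apply: cder_eq (cder_comp (cderN (cder_id w)) (cder_cexp _)) _; rewrite mulrN1.
Qed.

Lemma cder_cch w : has_cderiv cch w (csh w).
Proof. exact: cderD (cder_cexp w) (cder_cexpN w). Qed.

Lemma cder_csh w : has_cderiv csh w (cch w).
Proof.
by apply: cder_eq (cderB (cder_cexp w) (cder_cexpN w)) _; rewrite opprK.
Qed.

Lemma cder_ctanh w : cch w != 0 -> has_cderiv (@ctanh R) w (1 - ctanh w * ctanh w).
Proof.
move=> c0; apply: cder_eq (cderM (cder_csh w) (cderV c0 (cder_cch w))) _.
rewrite /ctanh -/(cch w) -/(csh w).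
by rewrite mulfV// expr2; ring.
Qed.

(** [Re (2 cosh (a + i b))] is [(exp a + exp (- a)) cos b]. *)
Lemma cch_ge_cos w : `|cos (complex.Im w)| <= cabs (cch w).
Proof.
rewrite (le_trans _ (le_Re_cabs _))//.
case: w => a b; rewrite /cch /cexp /= cosN -mulrDl normrM ler_peMl//.
rewrite ger0_norm ?addr_ge0 ?expR_ge0//.
case: (leP 0 a) => a0.
  by rewrite ler_wpDr ?expR_ge0// -expR0 ler_expR.
by rewrite ler_wpDl ?expR_ge0// -expR0 ler_expR oppr_ge0 ltW.
Qed.

(** [|exp w| - |exp (- w)|] is at least [(1 + a) - 1] when [a = Re w >= 0]. *)
Lemma cch_ge_Re w : `|complex.Re w| <= cabs (cch w).
Proof.
have h (u : R[i]) : 0 <= complex.Re u -> complex.Re u <= cabs (cch u).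
  move=> u0; rewrite /cch -[cexp (- u)]opprK.
  rewrite (le_trans _ (cabs_sub_le _ _))// cabsN !cabs_cexp cReN.
  have h1 : 1 + complex.Re u <= expR (complex.Re u) := expR_ge1Dx _.
  have h2 : expR (- complex.Re u) <= 1 by rewrite -expR0 ler_expR oppr_le0.
  lra.
case: (leP 0 (complex.Re w)) => w0; first by rewrite ger0_norm// h.
rewrite ltr0_norm//; have := h (- w); rewrite cReN oppr_ge0 => /(_ (ltW w0)).
by rewrite /cch opprK addrC.
Qed.

Lemma strip_dom_open : copen strip_dom.
Proof.
move=> z Dz; have [r0|r0] := eqVneq (complex.Re z) 0.
- have i0 : `|complex.Im z| < 2^-1.
    by rewrite ltNge; apply/negP => h; apply: Dz.
  exists (2^-1 - `|complex.Im z|); first by rewrite subr_gt0.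
  move=> w wz [_]; rewrite leNgt => /negP; apply.
  have := le_Im_cabs (w - z); rewrite cImD cImN => h.
  rewrite -(subrK (complex.Im z) (complex.Im w)).
  rewrite (le_lt_trans (ler_normD _ _))//; lra.
- exists `|complex.Re z|; first by rewrite normr_gt0.
  move=> w wz [wr _]; have := le_Re_cabs (w - z); rewrite cReD cReN wr sub0r normrN.
  by move=> /le_lt_trans/(_ wz); rewrite ltxx.
Qed.

(** The bound is uniform in [c] because [pi z c] stays away from the poles.  If
    [Re z = 0] then [|Im (pi w c)|] stays below a constant less than [pi / 2].  If
    [Re z != 0], then either [c] is so small that [|Im (pi w c)| <= pi / 3], or it is
    bounded below and so is [|Re (pi w c)|]. *)
Lemma cch_lower_bound z : strip_dom z -> exists2 m : R, 0 < m &
  cnbhs z [set w | forall c : R, `|c| <= 1 -> m <= cabs (cch (pi%:C * w * c%:C))].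
Proof.
have cosm (b be : R) : `|b| <= be -> be < pi / 2 -> cos be <= `|cos b|.
  move=> bbe bpi; rewrite -(cos_norm b) (le_trans _ (ler_norm _))//.
  move: bbe; rewrite le_eqVlt => /orP[/eqP <-//|bbe].
  have p0 := pi_gt0 R.
  have b0 := normr_ge0 b.
  by rewrite ltW// ltr_cos// in_itv /=; apply/andP; split; lra.
have E (w : R[i]) (c : R) : complex.Re (pi%:C * w * c%:C) = pi * c * complex.Re w /\
    complex.Im (pi%:C * w * c%:C) = pi * c * complex.Im w.
  have -> : pi%:C * w * c%:C = (pi * c)%:C * w by rewrite rmorphM; ring.
  by rewrite cReZ cImZ.
have p2 : 2 <= pi :> R by exact: pi_ge2.
move=> Dz; have [r0|r0] := eqVneq (complex.Re z) 0.
- have i0 : `|complex.Im z| < 2^-1.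
    by rewrite ltNge; apply/negP => h; apply: Dz.
  set y1 := (`|complex.Im z| + 2^-1) / 2.
  have y10 : 0 < y1 by rewrite /y1 divr_gt0// ltr_wpDl// invr_gt0.
  have y1h : y1 < 2^-1 by rewrite /y1; lra.
  have bh : pi * y1 < pi / 2 by rewrite ltr_pM2l// pi_gt0.
  exists (cos (pi * y1)).
    apply: cos_gt0_pihalf; rewrite bh andbT.
    by rewrite (lt_trans _ (mulr_gt0 (pi_gt0 R) y10))// oppr_lt0 divr_gt0// pi_gt0.
  exists (y1 - `|complex.Im z|); first by rewrite /y1; lra.
  move=> w wz c c1; apply: le_trans (cch_ge_cos _); rewrite (E w c).2.
  apply: cosm => //; rewrite !normrM ger0_norm ?pi_ge0// -mulrA ler_wpM2l ?pi_ge0//.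
  apply: (@le_trans _ _ `|complex.Im w|); first by rewrite ler_piMl.
  have := le_Im_cabs (w - z); rewrite cImD cImN => h.
  rewrite -(subrK (complex.Im z) (complex.Im w)).
  rewrite (le_trans (ler_normD _ _))//; lra.
- set x0 := `|complex.Re z| / 2.
  have x00 : 0 < x0 by rewrite divr_gt0// normr_gt0.
  set y1 := `|complex.Im z| + 1.
  have y10 : 0 < y1 by rewrite ltr_wpDl.
  have p3 : 0 < cos (pi / 3) :> R.
    apply: cos_gt0_pihalf; have p0 := pi_gt0 R; apply/andP; split; lra.
  exists (Num.min (cos (pi / 3)) (x0 / (3 * y1))).
    by rewrite lt_min p3 divr_gt0// mulr_gt0.
  exists (Num.min 1 x0); first by rewrite lt_min ltr01.
  move=> w; rewrite lt_min => /andP[w1 w2] c c1.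
  have hi : `|complex.Im w| <= y1.
    have := le_Im_cabs (w - z); rewrite cImD cImN => h.
    rewrite -(subrK (complex.Im z) (complex.Im w)).
    by rewrite (le_trans (ler_normD _ _))// /y1; lra.
  have hr : x0 <= `|complex.Re w|.
    have := le_Re_cabs (w - z); rewrite cReD cReN => h.
    have : `|complex.Re z| <= `|complex.Re w| + `|complex.Re w - complex.Re z|.
      rewrite -{1}(subrK (complex.Re w) (complex.Re z)) addrC.
      by rewrite (le_trans (ler_normD _ _))// (distrC (complex.Re z)).
    rewrite /x0 in w2 *; lra.
  rewrite ge_min; case: (leP (`|c| * (3 * y1)) 1) => cy.
  + apply/orP; left; apply: le_trans (cch_ge_cos _); rewrite (E w c).2.
    apply: cosm; last by have p0 := pi_gt0 R; lra.
    rewrite !normrM ger0_norm ?pi_ge0// -mulrA ler_wpM2l ?pi_ge0//.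
    have := ler_wpM2l (normr_ge0 c) hi; lra.
  + apply/orP; right; apply: le_trans (cch_ge_Re _); rewrite (E w c).1.
    rewrite ler_pdivrMr ?mulr_gt0// !normrM ger0_norm ?pi_ge0//.
    have h1 : 1 <= pi * (`|c| * (3 * y1)).
      have := ler_pM ler01 ler01 (le_trans (ler1n R 2) p2) (ltW cy); lra.
    have := ler_pM ler01 (ltW x00) h1 hr; lra.
Qed.

Context {X : topologicalType}.

(** The derivative [pi c (1 - tanh^2)] is a polynomial in the family itself, so
    continuity and boundedness at order [0] give all orders by induction. *)
Lemma Cfam_ctanh n (E : set X) (c : X -> R) :
  ccontinuous_on E (fun x => (c x)%:C) -> (forall x, E x -> `|c x| <= 1) ->
  Cfam n E strip_dom (fun x z => ctanh (pi%:C * z * (c x)%:C)).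
Proof.
move=> cc c1.
have ch0 z x : strip_dom z -> E x -> cch (pi%:C * z * (c x)%:C) != 0.
  move=> Dz Ex; have [m m0 [r r0 Hm]] := cch_lower_bound Dz.
  rewrite -cabs_gt0 (lt_le_trans m0)//; apply: Hm; last exact: c1.
  by rewrite subrr cabs0.
have C z : strip_dom z -> ccontinuous_on E (fun x => ctanh (pi%:C * z * (c x)%:C)).
  move=> Dz x Ex.
  apply: (@ccvg_comp _ _ _ (fun x => pi%:C * z * (c x)%:C)) (cder_cont (cder_ctanh _)) _.
    exact: ccvgM (ccvg_cst _) (cc x Ex).
  exact: ch0.
have B : loc_bounded E strip_dom (fun x z => ctanh (pi%:C * z * (c x)%:C)).
  move=> z Dz; have [m m0 Hm] := cch_lower_bound Dz.
  exists (2 * expR (pi * (cabs z + 1)) / m).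
  have : cnbhs z [set w | cabs (w - z) < 1] by exists 1.
  move=> H1; apply: filterS (filterI H1 Hm) => w [/= wz wm] x Ex /=.
  have hx := c1 x Ex; have := wm _ hx.
  set u := pi%:C * w * (c x)%:C => um.
  have m0' : 0 < cabs (cch u) by exact: lt_le_trans um.
  rewrite /ctanh -/(cch u) cabsM cabsV ler_pM ?cabs_ge0 ?invr_ge0 ?cabs_ge0//; last first.
    by rewrite lef_pV2.
  have ub : cabs u <= pi * (cabs z + 1).
    rewrite /u !cabsM !cabs_real ger0_norm ?pi_ge0// -mulrA ler_wpM2l ?pi_ge0//.
    rewrite (le_trans (_ : _ <= cabs w * 1))// ?ler_wpM2l ?cabs_ge0// mulr1.
    by rewrite -(subrK z w) (le_trans (cabsD _ _))// addrC lerD// ltW.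
  have eb (v : R[i]) : cabs v = cabs u -> cabs (cexp v) <= expR (pi * (cabs z + 1)).
    move=> vu; rewrite cabs_cexp ler_expR (le_trans (ler_norm _))//.
    by rewrite (le_trans (le_Re_cabs _))// vu.
  rewrite (le_trans (cabsD _ _))// mulr_natl mulr2n lerD ?eb// cabsN.
  by rewrite eb// cabsN.
elim: n => [|n IH]; split=> //.
exists (fun x z => (1 + (-1) * (ctanh (pi%:C * z * (c x)%:C) * ctanh (pi%:C * z * (c x)%:C))) *
  (pi%:C * (c x)%:C)); split.
  move=> x z Ex Dz.
  have H : has_cderiv (fun z => pi%:C * z * (c x)%:C) z (pi%:C * (c x)%:C).
    apply: cder_eq (cderM (cderMl pi%:C (cder_id z)) (cder_cst (c x)%:C z)) _.
    by rewrite mulr0 addr0 mulr1.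
  by apply: cder_eq (cder_comp H (cder_ctanh (ch0 z x Dz Ex))) _; rewrite mulN1r.
have K (a : R[i]) : Cfam n E strip_dom (fun _ _ => a).
  by apply: (@Cfam_cst _ _ _ _ _ (fun=> a) (cabs a)) => //; exact: ccontinuous_on_cst.
apply: CfamM; last first.
  apply: CfamM => //; apply: (@Cfam_cst _ _ _ _ _ (fun x => (c x)%:C) 1) => //.
  by move=> x Ex; rewrite cabs_real c1.
by apply: CfamD => //; apply: CfamM => //; apply: CfamM.
Qed.

End TanhFamily.

(** * The Iwasawa projection through Gram determinants *)
Section Iwasawa.
Variable R : realType.
Implicit Types g a k n A B : 'M[R]_3.

Lemma sum_ord3 (V : nmodType) (F : 'I_3 -> V) : \sum_i F i = F 0 + F 1 + F 2%:R.
Proof.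
rewrite !big_ord_recl big_ord0 addr0 addrA.
by congr (_ + F _ + F _); apply/val_inj.
Qed.

Lemma forall_ord3 (P : 'I_3 -> Prop) : P 0 -> P 1 -> P 2%:R -> forall i, P i.
Proof.
move=> p0 p1 p2 [[|[|[|i]]] hi] //.
- by rewrite (_ : Ordinal hi = 0)//; apply/val_inj.
- by rewrite (_ : Ordinal hi = 1)//; apply/val_inj.
- by rewrite (_ : Ordinal hi = 2%:R)//; apply/val_inj.
Qed.

Lemma det_mx22 (A : 'M[R]_2) : \det A = A 0 0 * A 1 1 - A 0 1 * A 1 0.
Proof.
rewrite (expand_det_row _ 0) !big_ord_recl big_ord0 addr0 /cofactor !det_mx11 !mxE /=.
have -> : lift (0 : 'I_2) 0 = 1 by exact/val_inj.
have -> : lift (1 : 'I_2) 0 = 0 by exact/val_inj.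
by rewrite expr0 expr1 mul1r mulN1r mulrN.
Qed.

Lemma det_mx33 A : \det A =
  A 0 0 * (A 1 1 * A 2%:R 2%:R - A 1 2%:R * A 2%:R 1)
  - A 0 1 * (A 1 0 * A 2%:R 2%:R - A 1 2%:R * A 2%:R 0)
  + A 0 2%:R * (A 1 0 * A 2%:R 1 - A 1 1 * A 2%:R 0).
Proof.
rewrite (expand_det_row _ 0) sum_ord3 /cofactor !det_mx22 !mxE /=.
have E (i j : 'I_3) : (i = j :> nat) -> i = j by apply: val_inj.
have -> : lift (0 : 'I_3) 0 = 1 by exact: E.
have -> : lift (0 : 'I_3) 1 = 2%:R by exact: E.
have -> : lift (1 : 'I_3) 0 = 0 by exact: E.
have -> : lift (1 : 'I_3) 1 = 2%:R by exact: E.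
have -> : lift (2%:R : 'I_3) 0 = 0 by exact: E.
have -> : lift (2%:R : 'I_3) 1 = 1 by exact: E.
by rewrite /= expr0 expr1 expr2; ring.
Qed.

(** The leading principal minors of [g^T g], of orders [1] and [2]. *)
Definition gram1 g : R := (g^T *m g) 0 0.
Definition gram2 g : R := (g^T *m g) 0 0 * (g^T *m g) 1 1 - (g^T *m g) 0 1 ^+ 2.

Lemma gramE g i j : (g^T *m g) i j = g 0 i * g 0 j + g 1 i * g 1 j + g 2%:R i * g 2%:R j.
Proof. by rewrite mxE sum_ord3 !mxE. Qed.

Lemma gram1_gt0 g : \det g = 1 -> 0 < gram1 g.
Proof.
move=> dg; rewrite /gram1 gramE -!expr2 lt_def !addr_ge0 ?sqr_ge0// andbT.
apply/eqP => h; move: dg; rewrite det_mx33.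
have [-> -> ->] : [/\ g 0 0 = 0, g 1 0 = 0 & g 2%:R 0 = 0].
  by split; apply/eqP; rewrite -sqrf_eq0; apply/eqP;
    have := sqr_ge0 (g 0 0); have := sqr_ge0 (g 1 0); have := sqr_ge0 (g 2%:R 0); lra.
by move=> H; have /eqP : 1 = 0 :> R by [rewrite -H; ring]; rewrite oner_eq0.
Qed.

(** By Lagrange's identity this is the sum of the squares of the minors of the first
    two columns, which cannot all vanish. *)
Lemma gram2_gt0 g : \det g = 1 -> 0 < gram2 g.
Proof.
move=> dg.
pose u := g 0 0 * g 1 1 - g 1 0 * g 0 1.
pose v := g 0 0 * g 2%:R 1 - g 2%:R 0 * g 0 1.
pose w := g 1 0 * g 2%:R 1 - g 2%:R 0 * g 1 1.
have E : gram2 g = u ^+ 2 + v ^+ 2 + w ^+ 2.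
  by rewrite /gram2 !gramE /u /v /w; ring.
rewrite E lt_def !addr_ge0 ?sqr_ge0// andbT; apply/eqP => h.
have [u0 v0 w0] : [/\ u = 0, v = 0 & w = 0].
  by split; apply/eqP; rewrite -sqrf_eq0; apply/eqP;
    have := sqr_ge0 u; have := sqr_ge0 v; have := sqr_ge0 w; lra.
have : \det g = g 2%:R 2%:R * u - g 1 2%:R * v + g 0 2%:R * w.
  by rewrite det_mx33 /u /v /w; ring.
rewrite dg u0 v0 w0 !mulr0 subrr addr0 => /eqP.
by rewrite oner_eq0.
Qed.

(** If [g = k a n], then [g^T g = n^T a^2 n], and the unipotent factors do not change
    leading principal minors. *)
Lemma iwasawa_unique g a : A3 a ->
  (exists k n, [/\ SO3 k, N3 n & g = k *m a *m n]) ->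
  [/\ a 0 0 ^+ 2 = gram1 g, (a 0 0 * a 1 1) ^+ 2 = gram2 g &
      a 0 0 * a 1 1 * a 2%:R 2%:R = 1].
Proof.
move=> [/is_diag_mxP ad apos deta] [k [n [[kk _] [n1 n0] ->]]].
have E : (k *m a *m n)^T *m (k *m a *m n) = n^T *m (a^T *m a) *m n.
  rewrite !trmx_mul -!mulmxA; congr (_ *m (_ *m _)).
  by rewrite !mulmxA kk mul1mx.
have a01 : a 0 1 = 0 by apply: ad.
have a10 : a 1 0 = 0 by apply: ad.
have a02 : a 0 2%:R = 0 by apply: ad.
have a20 : a 2%:R 0 = 0 by apply: ad.
have a12 : a 1 2%:R = 0 by apply: ad.
have a21 : a 2%:R 1 = 0 by apply: ad.
have n10 : n 1 0 = 0 by apply: n0.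
have n20 : n 2%:R 0 = 0 by apply: n0.
have n21 : n 2%:R 1 = 0 by apply: n0.
rewrite /gram1 /gram2 E !mxE !sum_ord3 !mxE !sum_ord3 !mxE !sum_ord3 !mxE.
rewrite a01 a10 a02 a20 a12 a21 n10 n20 n21 !n1.
split; try ring.
by move: deta; rewrite det_mx33 a01 a10 a02 a20 a12 a21 => <-; ring.
Qed.

(** Gaussian elimination on the positive matrix [g^T g] writes it as [n^T a^2 n]; then
    [k = g (a n)^-1] is orthogonal. *)
Lemma iwasawa_exists g : \det g = 1 -> exists a, A3 a /\
  (exists k n, [/\ SO3 k, N3 n & g = k *m a *m n]).
Proof.
move=> dg; have p0 := gram1_gt0 dg; have m0 := gram2_gt0 dg.
set p := gram1 g in p0; set m := gram2 g in m0.
pose G := g^T *m g.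
pose a0 := Num.sqrt p; pose a1 := Num.sqrt (m / p); pose a2 := Num.sqrt m^-1.
have a00 : 0 < a0 by rewrite sqrtr_gt0.
have a10 : 0 < a1 by rewrite sqrtr_gt0 divr_gt0.
have a20 : 0 < a2 by rewrite sqrtr_gt0 invr_gt0.
have a0E : a0 ^+ 2 = p by rewrite sqr_sqrtr// ltW.
have a1E : a1 ^+ 2 = m / p by rewrite sqr_sqrtr// ltW// divr_gt0.
have a2E : a2 ^+ 2 = m^-1 by rewrite sqr_sqrtr// ltW// invr_gt0.
pose n01 := G 0 1 / p; pose n02 := G 0 2%:R / p.
pose n12 := (p * G 1 2%:R - G 0 1 * G 0 2%:R) / m.
pose a : 'M[R]_3 := diag_mx (\row_i nth 0 [:: a0; a1; a2] i).
pose n : 'M[R]_3 := \matrix_(i, j) nth 0 (nth [::] [:: [:: 1; n01; n02]; [:: 0; 1; n12]; [:: 0; 0; 1]] i) j.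
have aE : (forall i j : 'I_3, i != j -> a i j = 0) /\ [/\ a 0 0 = a0, a 1 1 = a1 & a 2%:R 2%:R = a2].
  split; first by move=> i j ij; rewrite !mxE (negbTE ij).
  by rewrite !mxE /= !mulr1n.
have nE : [/\ [/\ n 0 0 = 1, n 0 1 = n01 & n 0 2%:R = n02], [/\ n 1 0 = 0, n 1 1 = 1 & n 1 2%:R = n12] &
  [/\ n 2%:R 0 = 0, n 2%:R 1 = 0 & n 2%:R 2%:R = 1]] by rewrite !mxE.
have deta : \det a = 1.
  have [a_d [a_0 a_1 a_2]] := aE.
  have -> : \det a = a0 * a1 * a2.
    rewrite det_mx33 (a_d 0 1)// (a_d 0 2%:R)// (a_d 1 0)// (a_d 1 2%:R)//.
    by rewrite (a_d 2%:R 0)// (a_d 2%:R 1)// a_0 a_1 a_2; ring.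
  apply/eqP; rewrite -(@eqrXn2 _ 2)//; last by rewrite !mulr_ge0// ltW.
  rewrite !exprMn a0E a1E a2E expr1n; apply/eqP; field.
  by rewrite !gt_eqF.
have detn : \det n = 1.
  have [[n_00 n_01 n_02] [n_10 n_11 n_12] [n_20 n_21 n_22]] := nE.
  by rewrite det_mx33 n_00 n_01 n_02 n_10 n_11 n_12 n_20 n_21 n_22; ring.
have detG : \det G = 1 by rewrite det_mulmx det_tr dg mulr1.
have Gs i j : G i j = G j i by rewrite /G !gramE; ring.
(* entrywise; the last diagonal entry is determined by [\det G = 1] *)
have GE : G = (a *m n)^T *m (a *m n).
  have [a_d [a_0 a_1 a_2]] := aE.
  have [[n_00 n_01 n_02] [n_10 n_11 n_12] [n_20 n_21 n_22]] := nE.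
  have pE : G 0 0 = p by [].
  have mE : m = p * G 1 1 - G 0 1 ^+ 2 by [].
  have an i j : (a *m n) i j = a i i * n i j.
    rewrite mxE (bigD1 i)//= big1 ?addr0// => l li.
    by rewrite (a_d i l) ?mul0r// eq_sym.
  have pn : p != 0 by rewrite gt_eqF.
  have mn : m != 0 by rewrite gt_eqF.
  have H (i j : 'I_3) : ((a *m n)^T *m (a *m n)) i j =
     a0 ^+ 2 * n 0 i * n 0 j + a1 ^+ 2 * n 1 i * n 1 j + a2 ^+ 2 * n 2%:R i * n 2%:R j.
    by rewrite gramE !an a_0 a_1 a_2; ring.
  have G11 : G 1 1 = (m + G 0 1 ^+ 2) / p by rewrite mE; field.
  have G22 : G 2%:R 2%:R = (1 + p * G 1 2%:R ^+ 2 - 2 * G 0 1 * G 0 2%:R * G 1 2%:R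
      + G 1 1 * G 0 2%:R ^+ 2) / m.
    apply: (mulIf mn); rewrite divfK//.
    by rewrite -[X in _ = X + _ - _ + _]detG det_mx33 pE mE (Gs 1 0) (Gs 2%:R 0) (Gs 2%:R 1); ring.
  apply/matrixP => i j; rewrite H a0E a1E a2E; move: i j.
  do 2![apply: forall_ord3];
    rewrite ?n_00 ?n_01 ?n_02 ?n_10 ?n_11 ?n_12 ?n_20 ?n_21 ?n_22 ?G22 ?G11
      ?(Gs 1 0) ?(Gs 2%:R 0) ?(Gs 2%:R 1) ?pE /n01 /n02 /n12; field; by rewrite ?pn ?mn.
have ub : a *m n \in unitmx by rewrite unitmxE det_mulmx deta detn mulr1 unitr1.
exists a; split.
  split; [exact: diag_mx_is_diag| |exact: deta].
  have [_ [a_0 a_1 a_2]] := aE.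
  by apply: forall_ord3; rewrite ?a_0 ?a_1 ?a_2.
exists (g *m invmx (a *m n)), n; split.
- split.
    rewrite trmx_mul -mulmxA (mulmxA g^T) -/G GE -mulmxA mulmxV// mulmx1.
    by rewrite -trmx_mul mulmxV// trmx1.
  by rewrite det_mulmx det_inv det_mulmx deta detn dg !mulr1 invr1 mulr1.
- have [[n_00 n_01 n_02] [n_10 n_11 n_12] [n_20 n_21 n_22]] := nE.
  split; first by apply: forall_ord3.
  by do 2![apply: forall_ord3].
- by rewrite -mulmxA mulmxKV.
Qed.

(** Makes the Iwasawa projection a continuous, indeed explicit, function of [g]; these are
    the linear forms from which [lambda] and [rho] are built. *)
Lemma iwasawa_log g : SL3 g ->
  [/\ e1 (log_A (iwasawa_a g)) = ln (gram1 g) - ln (gram2 g) / 2,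
      alpha 1 2 (log_A (iwasawa_a g)) = ln (gram2 g) - ln (gram1 g) / 2 &
      rho (log_A (iwasawa_a g)) = (ln (gram1 g) + ln (gram2 g)) / 2].
Proof.
move=> dg; rewrite /iwasawa_a; case: xgetP => [a _ [Aa Ha]|]; last first.
  by have [a Ha] := iwasawa_exists dg => /(_ a).
have [E1 E2 E3] := iwasawa_unique Aa Ha.
have [_ apos _] := Aa.
have E (i : 'I_3) : log_A a i i = ln (a i i) by rewrite !mxE eqxx mulr1n.
have l2 (x : R) : 0 < x -> ln (x ^+ 2) = 2 * ln x.
  by move=> x0; rewrite lnXn// mulr_natl.
rewrite -E1 -E2 !l2 ?mulr_gt0// lnM ?posrE//.
have : ln (a 0 0) + ln (a 1 1) + ln (a 2%:R 2%:R) = 0.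
  by rewrite -!lnM ?posrE ?mulr_gt0// E3 ln1.
rewrite /rho /e1 /alpha !E.
by move=> h; split; lra.
Qed.
End Iwasawa.

(** * Topology and Borel functions on the matrix groups *)
Section MatrixTopology.
Variable R : realType.
Let M := 'M[R]_3.

Definition mcont {X : topologicalType} (u : X -> M) (x : X) :=
  forall i j, u t i j @[t --> x] --> u x i j.

Lemma mcont_entries (g : M) : mcont id g.
Proof. by move=> i j; exact: coord_continuous. Qed.

Lemma mcont_cst {X : topologicalType} (A : M) (x : X) : mcont (fun=> A) x.
Proof. by move=> i j; exact: cvg_cst. Qed.

Lemma mcontM {X : topologicalType} (u v : X -> M) (x : X) :
  mcont u x -> mcont v x -> mcont (fun t => u t *m v t) x.
Proof.
move=> uc vc i j; rewrite mxE sum_ord3.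
under eq_fun do rewrite mxE sum_ord3.
by apply: cvgD; [apply: cvgD|]; apply: cvgM; auto.
Qed.

Lemma mcont_tr {X : topologicalType} (u : X -> M) (x : X) :
  mcont u x -> mcont (fun t => (u t)^T) x.
Proof.
by move=> uc i j; rewrite mxE; under eq_fun do rewrite mxE; exact: uc.
Qed.

Lemma cvg_gram1 {X : topologicalType} (u : X -> M) (x : X) :
  mcont u x -> gram1 (u t) @[t --> x] --> gram1 (u x).
Proof. by move=> uc; exact: (mcontM (mcont_tr uc) uc). Qed.

Lemma cvg_gram2 {X : topologicalType} (u : X -> M) (x : X) :
  mcont u x -> gram2 (u t) @[t --> x] --> gram2 (u x).
Proof.
move=> uc; have H := mcontM (mcont_tr uc) uc; rewrite /gram2.
by under eq_fun do rewrite expr2; rewrite expr2; apply: cvgB; apply: cvgM; exact: H.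
Qed.

Lemma cvg_det {X : topologicalType} (u : X -> M) (x : X) :
  mcont u x -> \det (u t) @[t --> x] --> \det (u x).
Proof.
move=> uc; under eq_fun do rewrite det_mx33; rewrite det_mx33.
by apply: cvgD; [apply: cvgB|]; (apply: cvgM; [exact: uc|apply: cvgB; apply: cvgM; exact: uc]).
Qed.

Lemma closed_SL3 : closed (@SL3 R).
Proof.
apply: (@preimage_closed _ _ (fun g : M => \det g) [set x | x = 1]).
  by move=> g _; apply: cvg_det; exact: mcont_entries.
exact: closed_eq.
Qed.

Lemma closed_SO3 : closed (@SO3 R).
Proof.
have -> : @SO3 R = (\bigcap_(p in [set: 'I_3 * 'I_3])
   ((fun k : M => (k^T *m k) p.1 p.2) @^-1` [set x | x = (p.1 == p.2)%:R])) `&` @SL3 R.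
  apply/seteqP; split => k.
    by move=> [kk dk]; split => // -[i j] _ /=; rewrite kk mxE.
  move=> [kk dk]; split => //; apply/matrixP => i j.
  by rewrite (kk (i, j) I) mxE.
apply: closedI; last exact: closed_SL3.
apply: closed_bigI => p _; apply: preimage_closed; last exact: closed_eq.
move=> k _; have H : mcont id k by exact: mcont_entries.
exact: (mcontM (mcont_tr H) H).
Qed.

(** The columns are unit vectors, so the entries lie in [[-1, 1]]. *)
Lemma compact_SO3 : compact (@SO3 R).
Proof.
have H := @rV_compact R (3 * 3)%N (fun=> `[(-1), 1]%classic)
  (fun=> @segment_compact R _ _).
have vc : continuous (vec_mx : 'rV[R]_(3 * 3)%N -> M).
  move=> v A /nbhs_ballP[e /= e0 He]; apply/nbhs_ballP; exists e => // w [_ vw].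
  by apply: He; split=> // i j; rewrite !mxE; exact: vw.
have := continuous_compact (continuous_subspaceT vc) H.
move=> cI; apply: (subclosed_compact closed_SO3 cI).
move=> k [kk _]; exists (mxvec k); last exact: mxvecK.
move=> i; case/mxvec_indexP: i => i j; rewrite mxvecE /= in_itv /= -ler_norml.
rewrite -sqrtr_sqr -sqrtr1 ler_wsqrtr//.
have : (k^T *m k) j j = 1 by rewrite kk mxE eqxx.
rewrite gramE -!expr2 => H1.
have := sqr_ge0 (k 0 j); have := sqr_ge0 (k 1 j); have := sqr_ge0 (k 2%:R j).
by move: i; apply: forall_ord3; lra.
Qed.

Lemma mxBorel_closed (K : set M) : closed K -> measurable (K : set (mxBorel R)).
Proof.
move=> /closed_openC oK; rewrite -(setCK K); apply: measurableC.
exact: sub_sigma_algebra.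
Qed.

Lemma ccontinuous_on_ReIm {X : topologicalType} (E : set X) (h : X -> R[i]) :
  ccontinuous_on E h <-> ({within E, continuous (fun x => complex.Re (h x))} /\
                         {within E, continuous (fun x => complex.Im (h x))}).
Proof.
split.
  move=> hc; split; apply/subspace_continuousP => x Ex;
  by have /ccvg_ReIm[] := hc x Ex.
move=> [/subspace_continuousP h1 /subspace_continuousP h2] x Ex.
by apply/ccvg_ReIm; split; [exact: h1|exact: h2].
Qed.

Lemma ccontinuous_on_bounded {X : topologicalType} (E : set X) (h : X -> R[i]) :
  compact E -> ccontinuous_on E h -> exists L : R, forall x, E x -> cabs (h x) <= L.
Proof.
move=> cE hc; have [E0|/set0P E0] := eqVneq E set0.
  by exists 0 => x; rewrite E0.
have [c _ Hc] : exists2 c, c \in E & forall x, x \in E -> cabs (h x) <= cabs (h c).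
  apply: compact_EVT_max => //; apply/subspace_continuousP => x Ex.
  exact: ccvg_cabs (hc x Ex).
by exists (cabs (h c)) => x Ex; apply: Hc; rewrite inE.
Qed.

(** The preimage in [K] of an open interval is the trace on [K] of an open set, hence
    Borel. *)
Lemma mxBorel_Cmeas (K : set M) (h : M -> R[i]) : closed K -> ccontinuous_on K h ->
  Cmeas (K : set (mxBorel R)) (h : mxBorel R -> R[i]).
Proof.
move=> cK /ccontinuous_on_ReIm[hr hi].
have mK := mxBorel_closed cK.
have H (u : M -> R) : {within K, continuous u} ->
    measurable_fun (K : set (mxBorel R)) (u : mxBorel R -> R).
  move=> /continuousP uc; apply: (measurability _ (RGenOpens.measurableE R)).
  move=> _ [_ [a [b ->] <-]].
  have oab : open `]a, b[%classic by exact: interval_open.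
  have /open_subspaceP[V oV VD] := uc _ oab.
  rewrite setIC -VD; apply: measurableI => //; exact: sub_sigma_algebra.
by split; exact: H.
Qed.

Lemma itv_Cmeas (a b : itv_bound R) (h : R -> R[i]) :
  ccontinuous_on [set` Interval a b] h -> Cmeas [set` Interval a b] h.
Proof.
move=> /ccontinuous_on_ReIm[hr hi].
by split; apply: subspace_continuous_measurable_fun.
Qed.

End MatrixTopology.

(** * Plane waves and convolution with spherical functions *)
Section SphericalTransform.
Variable R : realType.
Let M := 'M[R]_3.
Variable y : M.
Hypothesis hy : SL3 y.

Definition lgram1 (x : M * M) : R := ln (gram1 (invmx y *m x.1 *m x.2)).
Definition lgram2 (x : M * M) : R := ln (gram2 (invmx y *m x.1 *m x.2)).
(** For [x = ((t, g), k)], the value of [cos t e_1 + sin t e_2] on the logarithm of the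
    Iwasawa projection of [y^-1 g k], written out with [iwasawa_log]. *)
Definition phase (x : (R * M) * M) : R :=
  let u := (x.1.2, x.2) in
  cos x.1.1 * (lgram1 u - lgram2 u / 2) +
  sin x.1.1 * (2 / Num.sqrt 3 * ((lgram2 u - lgram1 u / 2) +
                                  2^-1 * (lgram1 u - lgram2 u / 2))).
(** The value of [rho] at the same point. *)
Definition half_density (x : (R * M) * M) : R :=
  let u := (x.1.2, x.2) in (lgram1 u + lgram2 u) / 2.

Definition plane_wave (x : (R * M) * M) (z : R[i]) : R[i] :=
  cexp (Complex 0 (- phase x) * z) * cexp (- (half_density x)%:C).

Lemma cexp_i (t : R) : cexp (Complex 0 t) = Complex (cos t) (sin t).
Proof. by rewrite /cexp /= expR0 !mul1r. Qed.

Lemma cc_circle (t : R) : cc (cexp (Complex 0 t)) = (cos t)%:C.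
Proof.
rewrite /cc -cexpN cexp_i (_ : - Complex 0 t = Complex 0 (- t)); last first.
  by apply/eqP; rewrite eq_complex /= oppr0 !eqxx.
rewrite cexp_i cosN sinN (_ : Complex _ _ + _ = (cos t)%:C * 2) ?mulfK ?pnatr_eq0//.
by rewrite mulr_natr mulr2n; apply/eqP; rewrite eq_complex /= subrr addr0 !eqxx.
Qed.

Lemma ss_circle (t : R) : ss (cexp (Complex 0 t)) = Complex 0 (sin t).
Proof.
rewrite /ss -cexpN cexp_i (_ : - Complex 0 t = Complex 0 (- t)); last first.
  by apply/eqP; rewrite eq_complex /= oppr0 !eqxx.
rewrite cexp_i cosN sinN (_ : Complex _ _ - _ = Complex 0 (sin t) * 2) ?mulfK ?pnatr_eq0//.
by rewrite mulr_natr mulr2n; apply/eqP; rewrite eq_complex /= subrr addr0 opprK !eqxx.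
Qed.

Lemma SL3_translate (g k : M) : SL3 g -> SO3 k -> SL3 (invmx y *m g *m k).
Proof.
by move=> hg [_ dk]; rewrite /SL3 /= !det_mulmx det_inv hy hg dk invr1 !mulr1.
Qed.

(** At [w = exp (i t)] the functions [cc] and [ss] are [cos t] and [i sin t], hence
    [lambda(z, w) = z (cos t e_1 + sin t e_2)]. *)
Lemma A_power_plane_wave (t : R) (z : R[i]) (g k : M) : SL3 g -> SO3 k ->
  A_power (iwasawa_a (invmx (invmx g *m y) *m k))
    (fun H => - (Complex 0 1 * lambda z (cexp (Complex 0 t)) H) - (rho H)%:C) =
  plane_wave ((t, g), k) z.
Proof.
move=> hg hk.
have gu : g \in unitmx by rewrite unitmxE hg unitr1.
have yu : y \in unitmx by rewrite unitmxE hy unitr1.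
have -> : invmx (invmx g *m y) = invmx y *m g.
  have AB : invmx g *m y *m (invmx y *m g) = 1%:M.
    by rewrite mulmxA mulmxK// mulVmx.
  by rewrite -[LHS]mulmx1 -AB mulKmx// unitmx_mul unitmx_inv gu.
have [E1 E2 E3] := iwasawa_log (SL3_translate hg hk).
rewrite /A_power /plane_wave -cexpD; congr cexp.
rewrite /lambda /e2 E1 E2 E3 cc_circle ss_circle /half_density /phase /=.
rewrite -/(lgram1 (g, k)) -/(lgram2 (g, k)).
set a := lgram1 (g, k) - _; set b := (2 / _ * _); set c := _ / 2.
case: z => z1 z2; apply/eqP; rewrite eq_complex.
rewrite !(cReD, cImD, cReN, cImN, cReM, cImM) /=.
by apply/andP; split; apply/eqP; ring.
Qed.
End SphericalTransform.

Section ConvolutionFamily.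
Variable R : realType.
Let M := 'M[R]_3.
Variables (mu nu : {measure set (mxBorel R) -> \bar R}).
Variables (f : M -> R[i]) (y : M) (C : set M).
Hypothesis nu_fin : (nu (@SO3 R) < +oo)%E.
Hypothesis hy : SL3 y.
Hypothesis f_smooth : smooth_SL3 f.
Hypothesis mu_fin : (mu C < +oo)%E.
Hypothesis cC : compact C.
Hypothesis C_SL3 : C `<=` @SL3 R.
Hypothesis f_supp : forall g, SL3 g -> ~ C g -> f g = 0.

Lemma lgram_cvg (u : M * M) : SL3 u.1 -> SO3 u.2 ->
  (lgram1 y t @[t --> u] --> lgram1 y u) /\ (lgram2 y t @[t --> u] --> lgram2 y u).
Proof.
move=> h1 h2.
have H : mcont (fun t : M * M => invmx y *m t.1 *m t.2) u.
  apply: mcontM; first apply: mcontM; first exact: mcont_cst.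
    move=> i j; apply: (@cvg_comp _ _ _ fst (fun A : M => A i j)); first exact: cvg_fst.
    exact: coord_continuous.
  move=> i j; apply: (@cvg_comp _ _ _ snd (fun A : M => A i j)); first exact: cvg_snd.
  exact: coord_continuous.
have d1 := SL3_translate hy h1 h2.
split.
  exact: cvg_comp (cvg_gram1 H) (continuous_ln (gram1_gt0 d1)).
exact: cvg_comp (cvg_gram2 H) (continuous_ln (gram2_gt0 d1)).
Qed.

Lemma lgram_bounded : exists L : R, forall u, (C `*` @SO3 R) u ->
  `|lgram1 y u| <= L /\ `|lgram2 y u| <= L.
Proof.
have cE : compact (C `*` @SO3 R) by apply: compact_setX => //; exact: compact_SO3.
have [L1 H1] : exists L : R, forall u, (C `*` @SO3 R) u -> cabs (lgram1 y u)%:C <= L.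
  apply: ccontinuous_on_bounded cE _; apply: ccontinuous_on_real => u [/C_SL3 ? ?].
  by have [] := @lgram_cvg u.
have [L2 H2] : exists L : R, forall u, (C `*` @SO3 R) u -> cabs (lgram2 y u)%:C <= L.
  apply: ccontinuous_on_bounded cE _; apply: ccontinuous_on_real => u [/C_SL3 ? ?].
  by have [] := @lgram_cvg u.
exists (Num.max L1 L2) => u uE; rewrite !le_max.
by have := H1 u uE; have := H2 u uE; rewrite !cabs_real => -> ->; rewrite orbT.
Qed.

(** The parameters: angle on the circle, point of the support of [f], rotation. *)
Let E3 : set ((R * M) * M) := (setT `*` C) `*` @SO3 R.

Lemma lgram_cvg3 (x : (R * M) * M) : E3 x ->
  (lgram1 y (t.1.2, t.2) @[t --> x] --> lgram1 y (x.1.2, x.2)) /\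
  (lgram2 y (t.1.2, t.2) @[t --> x] --> lgram2 y (x.1.2, x.2)).
Proof.
move=> [[_ /C_SL3 h1] h2].
have P : (t.1.2, t.2) @[t --> x] --> (x.1.2, x.2).
  apply: (@cvg_pair _ _ _ (nbhs x) (nbhs x.1.2) (nbhs x.2) _ _ _
    (fun t => t.1.2) (fun t => t.2)); last exact: cvg_snd.
  apply: (@cvg_comp _ _ _ fst snd); [exact: cvg_fst|exact: cvg_snd].
have [c1 c2] := @lgram_cvg (x.1.2, x.2) h1 h2.
by split; [exact: cvg_comp P c1|exact: cvg_comp P c2].
Qed.

Lemma half_density_cvg x : E3 x -> half_density y t @[t --> x] --> half_density y x.
Proof.
move=> /lgram_cvg3[]; have : Filter (nbhs x) by exact: nbhs_filter.
move: (nbhs x) => F FF c1 c2; apply: cvgM; last exact: cvg_cst.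
exact: cvgD.
Qed.

Lemma phase_cvg x : E3 x -> phase y t @[t --> x] --> phase y x.
Proof.
move=> /lgram_cvg3[].
have : t.1.1 @[t --> x] --> x.1.1.
  by apply: (@cvg_comp _ _ _ fst fst); exact: cvg_fst.
have : Filter (nbhs x) by exact: nbhs_filter.
move: (nbhs x) => F FF T c1 c2.
have Tc : cos t.1.1 @[t --> F] --> cos x.1.1 by exact: cvg_comp T (@continuous_cos R _).
have Ts : sin t.1.1 @[t --> F] --> sin x.1.1 by exact: cvg_comp T (@continuous_sin R _).
have d1 : lgram1 y (t.1.2, t.2) - lgram2 y (t.1.2, t.2) / 2 @[t --> F] -->
    lgram1 y (x.1.2, x.2) - lgram2 y (x.1.2, x.2) / 2.
  by apply: cvgB => //; apply: cvgM => //; exact: cvg_cst.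
have d2 : lgram2 y (t.1.2, t.2) - lgram1 y (t.1.2, t.2) / 2 @[t --> F] -->
    lgram2 y (x.1.2, x.2) - lgram1 y (x.1.2, x.2) / 2.
  by apply: cvgB => //; apply: cvgM => //; exact: cvg_cst.
apply: cvgD; first exact: cvgM.
apply: cvgM => //; apply: cvgM; first exact: cvg_cst.
by apply: cvgD => //; apply: cvgM => //; exact: cvg_cst.
Qed.

Lemma plane_wave_fam n : Cfam n E3 setT (plane_wave y).
Proof.
have [L HL] := lgram_bounded.
apply: CfamM.
- apply: (@Cfam_cexp _ _ _ _ (fun x => Complex 0 (- phase y x))
    (2 * L + 2 / Num.sqrt 3 * (2 * L + 2 * L))).
  + move=> x Ex; apply/ccvg_ReIm; split => /=; first exact: cvg_cst.
    by apply: cvgN; exact: cvg_within_filter (phase_cvg Ex).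
  + move=> [[t g] k] [[_ Cg] Kk]; rewrite cabs_i normrN /phase /=.
    have [l1 l2] := HL (g, k) (conj Cg Kk).
    have L0 : 0 <= L by apply: le_trans l1.
    have l3 : `|lgram1 y (g, k) - lgram2 y (g, k) / 2| <= 2 * L.
      rewrite (le_trans (ler_normB _ _))// normrM (ger0_norm (_ : 0 <= 2^-1)) ?invr_ge0//; lra.
    have l4 : `|lgram2 y (g, k) - lgram1 y (g, k) / 2| <= 2 * L.
      rewrite (le_trans (ler_normB _ _))// normrM (ger0_norm (_ : 0 <= 2^-1)) ?invr_ge0//; lra.
    have s3 : 0 <= 2 / Num.sqrt 3 :> R by rewrite divr_ge0// sqrtr_ge0.
    rewrite (le_trans (ler_normD _ _))// lerD// normrM.
      rewrite -[leRHS]mul1r ler_pM//; exact: cos_max.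
    rewrite -[leRHS]mul1r ler_pM//; first exact: sin_max.
    rewrite normrM (ger0_norm s3) ler_wpM2l// (le_trans (ler_normD _ _))// lerD//.
    rewrite normrM (ger0_norm (_ : 0 <= 2^-1)) ?invr_ge0//; lra.
- apply: (@Cfam_cst _ _ _ _ _ (fun x => cexp (- (half_density y x)%:C)) (expR L)).
  + move=> x Ex; apply: (@ccvg_comp _ _ _ (fun x => - (half_density y x)%:C))
      (cder_cont (cder_cexp _)) _.
    apply: ccvgN; exact: (ccontinuous_on_real half_density_cvg Ex).
  + move=> [[t g] k] [[_ Cg] Kk]; rewrite cabs_cexp ler_expR.
    have [l1 l2] := HL (g, k) (conj Cg Kk).
    rewrite cReN /= /half_density /=.
    move: l1 l2; rewrite !ler_norml => /andP[a _] /andP[b _]; lra.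
Qed.

(** Smoothness on SL(3) is local extendability, which includes continuity of the
    extensions. *)
Lemma f_continuous : ccontinuous_on C f.
Proof.
move=> g Cg; have [U [h1 [h2 [oU Ug s1 s2 fE]]]] := f_smooth (C_SL3 Cg).
have [c1 _] := s1 [::] g Ug; have [c2 _] := s2 [::] g Ug.
have nU : within C (nbhs g) U.
  have : nbhs g U by exact: open_nbhs_nbhs.
  by apply: filterS => x Ux _.
apply: (@ccvg_eq _ _ _ _ (fun x => Complex (h1 x) (h2 x))).
  apply: filterS (filterI nU (withinT C _)) => x [Ux Cx] /=.
  by rewrite fE//; exact: C_SL3.
rewrite fE//; last exact: C_SL3.
by apply/ccvg_ReIm; split => /=; [exact: cvg_within_filter c1|exact: cvg_within_filter c2].
Qed.

(** The convolution of [f] with the spherical function, for [w = exp (i t)], as an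
    iterated integral over compact sets; see [conv_sphericalE]. *)
Definition conv_family (t : R) (z : R[i]) : R[i] :=
  Cintegral mu (C : set (mxBorel R)) (fun g => f g *
    Cintegral nu (@SO3 R : set (mxBorel R)) (fun k => plane_wave y ((t, g), k) z)).

Lemma conv_family_fam n : Cfam n setT setT conv_family.
Proof.
have oT : copen [set: R[i]] by move=> z _; exists 1.
have clC : closed C by apply: compact_closed cC; exact: norm_hausdorff.
have I1 : Cfam n (setT `*` C) setT (fun (x : R * M) z =>
    Cintegral nu (@SO3 R : set (mxBorel R)) (fun k => plane_wave y (x, k) z)).
  apply: (@Cfam_Cintegral R (R * M)%type M _ (mxBorel R) nu id (@SO3 R)) => //.
  - exact: mxBorel_closed (@closed_SO3 R).
  - by move=> h hc; exact: mxBorel_Cmeas (@closed_SO3 R) hc.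
  - exact: plane_wave_fam.
have [B HB] := ccontinuous_on_bounded cC f_continuous.
apply: (@Cfam_Cintegral R R M _ (mxBorel R) mu id C _ _ _ n setT setT
  (fun (x : R * M) z => f x.2 * Cintegral nu (@SO3 R : set (mxBorel R))
     (fun k => plane_wave y (x, k) z))) => //.
- exact: mxBorel_closed.
- by move=> h hc; exact: mxBorel_Cmeas.
- apply: CfamM => //; apply: (@Cfam_cst _ _ _ _ _ (fun x => f x.2) B).
    move=> x [_ Cx] e e0.
    have H : nbhs x.2 [set g | C g -> cabs (f g - f x.2) < e] by exact: f_continuous Cx _ e0.
    have /(_ _ H) : snd @ nbhs x --> nbhs x.2 by exact: cvg_snd.
    by apply: (@filterS _ (nbhs x)) => x' h' [_ ?]; exact: h'.
  by move=> x [_ Cx]; exact: HB.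
Qed.

Lemma conv_sphericalE (t : R) (z : R[i]) :
  conv_spherical mu nu f (fun H => Complex 0 1 * lambda z (cexp (Complex 0 t)) H) y =
  conv_family t z.
Proof.
have h0 (g : mxBorel R) : @SL3 R g -> ~ C g ->
    f g * spherical nu (fun H => Complex 0 1 * lambda z (cexp (Complex 0 t)) H)
      (invmx g *m y) = 0.
  by move=> hg Cg; rewrite (f_supp hg Cg) mul0r.
transitivity (Cintegral mu (C : set (mxBorel R)) (fun g => f g *
    spherical nu (fun H => Complex 0 1 * lambda z (cexp (Complex 0 t)) H) (invmx g *m y))).
  exact: (@Cintegral_restrict _ (mxBorel R) R mu (@SL3 R) C _ C_SL3 h0).
apply: eq_Cintegral => g /C_SL3 hg; congr (_ * _).
by apply: eq_Cintegral => k hk; exact: A_power_plane_wave.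
Qed.

End ConvolutionFamily.

(** * Regularity and evenness of the spectral density *)
Section Shift.
Variable R : realType.
Notation mu := (@lebesgue_measure R).

Lemma Rintegral_shift (h : R -> R) (a b c : R) : a <= b -> continuous h ->
  Rintegral mu `[a + c, b + c]%classic h = Rintegral mu `[a, b]%classic (fun x => h (x + c)).
Proof.
move=> ab hc; rewrite /Rintegral; congr fine.
have dE x : derivable (fun x : R => x + c) x 1 by apply: derivableD.
have d1 : (fun x : R => x + c)^`()%classic = cst 1.
  by apply/funext => x; rewrite derive1E deriveD// derive_id derive_cst addr0.
have cE : continuous (fun x : R => x + c).
  by move=> x; apply: cvgD; [exact: cvg_id|exact: cvg_cst].
rewrite (@integration_by_substitution_increasing R (fun x => x + c) h a b ab).
- by apply: eq_integral => x _; rewrite d1 /= /GRing.mul /= mulr1.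
- by move=> x x' _ _ xx; rewrite ltrD2r.
- by rewrite d1 => x _; exact: cvg_cst.
- by rewrite d1; exact: is_cvg_cst.
- by rewrite d1; exact: is_cvg_cst.
- split; first by move=> x _; exact: dE.
  + by apply: cvg_at_right_filter; exact: cE.
  + by apply: cvg_at_left_filter; exact: cE.
- exact: continuous_subspaceT.
Qed.

(** The integral over a full period is unchanged by a translation; the
    shift by half a period exchanges the two halves. *)
Lemma Rintegral_half_period (h : R -> R) (p : R) : 0 < p -> continuous h ->
  (forall x, h (x + p + p) = h x) ->
  Rintegral mu `[0, 2 * p]%classic (fun x => h (x + p)) = Rintegral mu `[0, 2 * p]%classic h.
Proof.
move=> p0 hc hp.
have ci (u : R -> R) a b : continuous u -> mu.-integrable `[a, b]%classic (EFin \o u).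
  move=> uc; apply: continuous_compact_integrable; first exact: segment_compact.
  exact: continuous_subspaceT.
have sp (u : R -> R) : continuous u -> Rintegral mu `[0, 2 * p]%classic u =
    Rintegral mu `[0, p]%classic u + Rintegral mu `[0 + p, p + p]%classic u.
  move=> uc; have E : 2 * p = p + p by rewrite mulr_natl mulr2n.
  rewrite add0r -(@Rintegral_itv_obnd_cbnd _ p); last first.
    by apply: integrableS (ci u p (p + p) uc) => //; exact: subset_itv_oc_cc.
  rewrite -(@Rintegral_itvB R u (BLeft 0) (BRight (p + p)) p) ?bnd_simp.
  - by rewrite E addrCA subrr addr0.
  - exact: ci.
  - exact: ltW.
  - by rewrite lerDl ltW.
have hpc : continuous (fun x => h (x + p)).
  move=> x; apply: (@cvg_comp _ _ _ (fun u : R => u + p) h); last exact: hc.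
  by apply: cvgD; [exact: cvg_id|exact: cvg_cst].
rewrite sp// (sp h hc) (Rintegral_shift p (ltW p0) hpc) addrC; congr (_ + _).
  by apply: eq_Rintegral => x _; rewrite hp.
exact/esym/(Rintegral_shift p (ltW p0) hc).
Qed.
End Shift.

Section SpectralDensity.
Variable R : realType.
Let M := 'M[R]_3.
Variables (mu nu : {measure set (mxBorel R) -> \bar R}).
Variables (f : M -> R[i]) (y : M) (C : set M).
Hypothesis nu_fin : (nu (@SO3 R) < +oo)%E.
Hypothesis hy : SL3 y.
Hypothesis f_smooth : smooth_SL3 f.
Hypothesis mu_fin : (mu C < +oo)%E.
Hypothesis cC : compact C.
Hypothesis C_SL3 : C `<=` @SL3 R.
Hypothesis f_supp : forall g, SL3 g -> ~ C g -> f g = 0.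

(** The factor of the density for [u = exp (i a)], where [cc (u w) = cos (t + a)]. *)
Definition tanh_factor (a t : R) (z : R[i]) : R[i] :=
  (cos (t + a))%:C * ctanh (pi%:C * z * (cos (t + a))%:C).

Definition density_integrand (t : R) (z : R[i]) : R[i] :=
  conv_family mu nu f y C t z * (z * (z * z)) *
  (tanh_factor 0 t z * (tanh_factor (pi / 3) t z * tanh_factor (2 * (pi / 3)) t z)).

Lemma tanh_factor_fam n a : Cfam n setT (@strip_dom R) (tanh_factor a).
Proof.
have c (t : R) : [set: R] t -> cos (u + a) @[u --> t] --> cos (t + a).
  move=> _; apply: (@cvg_comp _ _ _ (fun u : R => u + a) cos); last exact: continuous_cos.
  by apply: cvgD; [exact: cvg_id|exact: cvg_cst].
apply: CfamM.
  apply: (@Cfam_cst _ _ _ _ _ (fun t : R => (cos (t + a))%:C) 1).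
    exact: (@ccontinuous_on_real R R setT (fun t => cos (t + a))).
  by move=> t _; rewrite cabs_real cos_max.
apply: (@Cfam_ctanh R R n setT (fun t : R => cos (t + a))).
  exact: (@ccontinuous_on_real R R setT (fun t => cos (t + a))).
by move=> t _; rewrite cos_max.
Qed.

Lemma density_integrand_fam n : Cfam n setT (@strip_dom R) density_integrand.
Proof.
apply: CfamM; last first.
  by apply: CfamM; [|apply: CfamM]; exact: tanh_factor_fam.
apply: CfamM.
  apply: (Cfam_dom (D := setT)) => //; exact: conv_family_fam.
by apply: CfamM; [|apply: CfamM]; exact: Cfam_id.
Qed.

Lemma F_integralE (z : R[i]) : F mu nu f y z =
  ((2 * pi)^-1)%:C * Cintegral lebesgue_measure `[0, 2 * pi]%classic
     (density_integrand^~ z).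
Proof.
rewrite /F /circle_integral; congr (_ * _); apply: eq_Cintegral => t _.
set w := cexp (Complex 0 t).
have w0 : w != 0 := cexp_neq0 _.
have i0 : Complex 0 1 != 0 :> R[i] by rewrite eq_complex /= oner_eq0 andbF.
rewrite (conv_sphericalE mu nu hy C_SL3 f_supp).
rewrite mulrAC -mulrA divff ?mulf_neq0// mulr1 /density_integrand.
have r (a : R) : cc (cexp (Complex 0 a) * w) = (cos (t + a))%:C.
  by rewrite /w -cexpD (_ : Complex 0 a + Complex 0 t = Complex 0 (t + a)) ?cc_circle//;
    apply/eqP; rewrite eq_complex /= addr0 addrC !eqxx.
have c1 : cc (1 * w) = (cos (t + 0))%:C by rewrite -r -[Complex 0 0]/(0 : R[i]) cexp0.
have cxi : cc (xi * w) = (cos (t + pi / 3))%:C by rewrite -r.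
have cxi2 : cc (xi ^+ 2 * w) = (cos (t + 2 * (pi / 3)))%:C.
  rewrite -r /xi expr2 -cexpD; congr (cc (cexp _ * _)).
  by apply/eqP; rewrite eq_complex /= addr0 mulr_natl mulr2n !eqxx.
by rewrite !big_cons big_nil c1 cxi cxi2 /tanh_factor !exprS expr0 !mulr1.
Qed.

(** [F] depends on no parameter; the dummy one in [R] lets [Cfam_Cintegral] apply. *)
Lemma F_fam n : Cfam n [set: R] (@strip_dom R) (fun (_ : R) z => F mu nu f y z).
Proof.
have fin : (lebesgue_measure (`[0%R, (2 * pi)%R]%classic : set R) < +oo)%E.
  by rewrite lebesgue_measure_itv /=; case: ifP => _; rewrite -?EFinB ltry.
have -> : (fun (_ : R) z => F mu nu f y z) = (fun (_ : R) z => ((2 * pi)^-1)%:C *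
    Cintegral lebesgue_measure `[0, 2 * pi]%classic (density_integrand^~ z)).
  by apply/funext => x; apply/funext => z; rewrite F_integralE.
apply: CfamM.
  by apply: (@Cfam_cst _ _ _ _ _ (fun=> ((2 * pi)^-1)%:C) (cabs ((2 * pi)^-1)%:C)) => //;
    exact: ccontinuous_on_cst.
apply: (@Cfam_Cintegral R R R _ (measurableTypeR R) lebesgue_measure id
  `[0, 2 * pi]%classic _ _ _ n setT (@strip_dom R)
  (fun (x : R * R) z => density_integrand x.2 z)).
- exact: measurable_itv.
- exact: fin.
- by move=> h hc; exact: itv_Cmeas.
- exact: strip_dom_open.
- apply: (Cfam_comp (E := setT) (p := snd)) => //.
  + move=> x _; apply: cvg_within_filter; exact: cvg_snd.
  + exact: density_integrand_fam.
Qed.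

Lemma F_cderiv2 : exists F1 F2 : R[i] -> R[i],
  [/\ forall z, strip_dom z -> has_cderiv (F mu nu f y) z (F1 z),
      forall z, strip_dom z -> has_cderiv F1 z (F2 z) &
      forall z, strip_dom z -> exists B : R, cnbhs z [set w | cabs (F2 w) <= B]].
Proof.
have [_ _ [F1 [d1 [_ _ [F2 [d2 [_ b _]]]]]]] := F_fam 2.
exists (F1 0), (F2 0); split.
- by move=> z Dz; exact: d1.
- by move=> z Dz; exact: d2.
- by move=> z /b[B HB]; exists B; apply: filterS HB => w; exact.
Qed.

Lemma ctanhN (z : R[i]) : ctanh (- z) = - ctanh z.
Proof. by rewrite /ctanh opprK -mulNr opprB [X in _ / X]addrC. Qed.

(** Turning the circle by [pi] changes the sign of [cos t] and [sin t], hence of the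
    phase. *)
Lemma conv_familyN t z : conv_family mu nu f y C t (- z) = conv_family mu nu f y C (t + pi) z.
Proof.
apply: eq_Cintegral => g _; congr (_ * _); apply: eq_Cintegral => k _.
rewrite /plane_wave; congr (cexp _ * _).
rewrite mulrN -mulNr; congr (_ * _); rewrite /phase /= cosDpi sinDpi.
by apply/eqP; rewrite eq_complex /= oppr0 eqxx; apply/eqP; ring.
Qed.

Lemma tanh_factorN a t z : tanh_factor a t (- z) = - tanh_factor a t z.
Proof. by rewrite /tanh_factor mulrN mulNr ctanhN mulrN. Qed.

Lemma tanh_factorDpi a t z : tanh_factor a (t + pi) z = tanh_factor a t z.
Proof.
by rewrite /tanh_factor addrAC cosDpi rmorphN /= mulrN ctanhN mulrNN.
Qed.

(** [z^3] and the three tanh factors are odd in [z], so their signs cancel, and the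
    factors do not change when [t] is shifted by [pi]. *)
Lemma density_integrandN t z : density_integrand t (- z) = density_integrand (t + pi) z.
Proof. by rewrite /density_integrand conv_familyN !tanh_factorN !tanh_factorDpi; ring. Qed.

Lemma density_integrandD2pi t z : density_integrand (t + pi + pi) z = density_integrand t z.
Proof. by rewrite -!density_integrandN opprK. Qed.

Lemma F_even z : strip_dom z -> F mu nu f y (- z) = F mu nu f y z.
Proof.
move=> Dz; rewrite !F_integralE; congr (_ * _).
have [c _ _] := density_integrand_fam 0.
have [cr ci] : continuous (fun t => complex.Re (density_integrand t z)) /\
    continuous (fun t => complex.Im (density_integrand t z)).
  have W (u : R -> R) (t l : R) : u @ within setT (nbhs t) --> l -> u x @[x --> t] --> l.
    move=> H A /H; apply: (@filterS _ (nbhs t) (nbhs_filter t)) => x; exact.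
  have [/subspace_continuousP h1 /subspace_continuousP h2] := (ccontinuous_on_ReIm _ _).1 (c z Dz).
  by split=> t; apply: W; [exact: h1|exact: h2].
transitivity (Cintegral lebesgue_measure `[0, 2 * pi]%classic
    (fun t => density_integrand (t + pi) z)).
  by apply: eq_Cintegral => t _; rewrite density_integrandN.
have H (u : R[i] -> R) := @Rintegral_half_period R (fun t => u (density_integrand t z)) pi (pi_gt0 R).
by rewrite /Cintegral (H (@complex.Re R))// ?(H (@complex.Im R))// => t; rewrite density_integrandD2pi.
Qed.

End SpectralDensity.

(** * The principal logarithm *)
Section ComplexLogarithm.
Variable R : realType.
Implicit Types z w : R[i].

Definition log_dom : set R[i] :=
  [set z | ~ (complex.Im z = 0 /\ complex.Re z <= 0)].

(** The argument is twice [atan (y / (|z| + x))] by the half-angle formula, a single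
    expression that is continuous on the whole slit plane. *)
Definition clog z : R[i] :=
  Complex (ln (cabs z)) (2 * atan (complex.Im z / (cabs z + complex.Re z))).

Lemma log_dom_neq0 z : log_dom z -> z != 0.
Proof. by move=> h; apply/eqP => z0; apply: h; rewrite z0. Qed.

Lemma cabs_Re_gt0 z : log_dom z -> 0 < cabs z + complex.Re z.
Proof.
move=> h; have [r0|r0] := ltP 0 (complex.Re z).
  by rewrite ltr_wpDl// cabs_ge0.
have i0 : complex.Im z != 0 by apply/eqP => i0; apply: h.
rewrite -(opprK (complex.Re z)) subr_gt0 cabsE -(ger0_norm (_ : 0 <= - complex.Re z)) ?oppr_ge0//.
by rewrite -sqrtr_sqr sqrrN ltr_sqrt ?ltrDl ?exprn_even_gt0//;
  rewrite ltr_wpDl ?sqr_ge0// exprn_even_gt0.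
Qed.

Lemma cexp_clog z : log_dom z -> cexp (clog z) = z.
Proof.
move=> hz; have h := cabs_Re_gt0 hz; have z0 : 0 < cabs z by rewrite cabs_gt0 log_dom_neq0.
rewrite /cexp /clog [complex.Re _]/= [complex.Im _]/= lnK ?posrE//.
set a := cabs z in h z0 *; set u := complex.Im z / _.
have ha : a ^+ 2 = complex.Re z ^+ 2 + complex.Im z ^+ 2.
  by rewrite /a cabsE sqr_sqrtr// addr_ge0// sqr_ge0.
have h0 : a + complex.Re z != 0 by rewrite gt_eqF.
have a0 : a != 0 by rewrite gt_eqF.
have ct : cos (atan u) ^+ 2 = (a + complex.Re z) / (2 * a).
  rewrite cos_atan exprVn sqr_sqrtr ?addr_ge0 ?sqr_ge0//.
  have -> : 1 + u ^+ 2 = 2 * a / (a + complex.Re z).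
    rewrite /u expr_div_n; have -> : complex.Im z ^+ 2 = (a - complex.Re z) * (a + complex.Re z).
      by rewrite -subr_sqr ha; ring.
    by field.
  by rewrite invf_div.
have st : sin (atan u) = u * cos (atan u).
  by rewrite -{2}(atanK u) /tan divfK// cos_atan invr_eq0 sqrtr_eq0 -ltNge ltr_pwDl// sqr_ge0.
rewrite mulr_natl cos_mulr2n sin_mulr2n ct st mulrCA -expr2 ct /u.
case: z {hz} a @u ha h h0 a0 z0 ct st => x y a u /= ha h h0 a0 z0 _ _.
by apply/eqP; rewrite eq_complex /=; apply/andP; split; apply/eqP; field; rewrite ?h0 ?a0.
Qed.

Lemma clog_Im z : - pi < complex.Im (clog z) < pi.
Proof.
have := atan_gtNpi2 (complex.Im z / (cabs z + complex.Re z)).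
have := atan_ltpi2 (complex.Im z / (cabs z + complex.Re z)).
by rewrite /clog /=; set t := atan _; move=> h1 h2; apply/andP; split; lra.
Qed.

Lemma clog_Im_gt0 z : 0 < complex.Im z -> 0 < complex.Im (clog z).
Proof.
move=> iz; have hz : log_dom z by move=> [h _]; rewrite h ltxx in iz.
by rewrite /clog /= mulr_gt0// -atan0 lt_atan// divr_gt0// cabs_Re_gt0.
Qed.

Lemma cexp_inj z w : - pi < complex.Im z < pi -> - pi < complex.Im w < pi ->
  cexp z = cexp w -> z = w.
Proof.
case: z w => [a b] [c d] /= /andP[b1 b2] /andP[d1 d2] E.
have ac : a = c by apply: expR_inj; have := cabs_cexp (Complex a b); rewrite E cabs_cexp /= => ->.
move: E; rewrite /cexp /= ac => -[/(mulfI (lt0r_neq0 (expR_gt0 c))) cbd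
  /(mulfI (lt0r_neq0 (expR_gt0 c))) sbd].
have S : sin ((b - d) / 2) = 0.
  have : cos (((b - d) / 2) *+ 2) = 1.
    rewrite -mulr_natr divfK ?pnatr_eq0// cosB cbd sbd -!expr2 cos2Dsin2//.
  by rewrite cos_mulr2n cos2sin2 => h; apply/eqP; rewrite -sqrf_eq0; apply/eqP; lra.
congr Complex => //; apply/eqP; rewrite -subr_eq0; apply/eqP.
have [bd|bd|//] := ltgtP (b - d) 0.
- have : 0 < sin (- ((b - d) / 2)) by apply: sin_gt0_pi; apply/andP; split; lra.
  by rewrite sinN S oppr0 ltxx.
- have : 0 < sin ((b - d) / 2) by apply: sin_gt0_pi; apply/andP; split; lra.
  by rewrite S ltxx.
Qed.

Lemma cexpK z : - pi < complex.Im z < pi -> log_dom (cexp z) -> clog (cexp z) = z.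
Proof.
by move=> hz hl; apply: cexp_inj => //; [exact: clog_Im|exact: cexp_clog].
Qed.

Lemma log_dom_open z : log_dom z -> cnbhs z log_dom.
Proof.
move=> hz; have h := cabs_Re_gt0 hz.
exists ((cabs z + complex.Re z) / 2); first by rewrite divr_gt0.
move=> w wz [wi wr].
have h1 : cabs z - cabs w <= cabs (w - z) by rewrite cabsB cabs_sub_le.
have h2 := le_Re_cabs (w - z); rewrite cReD cReN ler_norml in h2.
have h3 : cabs w = - complex.Re w.
  by rewrite cabsE wi expr0n addr0 sqrtr_sqr ler0_norm.
move/andP: h2 => [h2 h2']; lra.
Qed.

Lemma clog_cont z : log_dom z -> ccvg (cnbhs z) clog (clog z).
Proof.
move=> hz; have h := cabs_Re_gt0 hz.
have := ccvg_id z; move: (cnbhs_filter z) => FF Hid.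
have [/= hr hi] := (ccvg_ReIm _ _).1 Hid.
have ha : cabs x @[x --> cnbhs z] --> cabs z by exact: ccvg_cabs Hid.
apply/ccvg_ReIm; split => /=.
  apply: (@cvg_comp _ _ _ (fun w => cabs w) (@ln R)); first exact: ha.
  by apply: continuous_ln; rewrite cabs_gt0 log_dom_neq0.
apply: cvgM; first exact: cvg_cst.
apply: (@cvg_comp _ _ _ (fun w => complex.Im w / (cabs w + complex.Re w)) atan); last first.
  exact: continuous_atan.
apply: cvgM => //; apply: cvgV; first by rewrite gt_eqF.
exact: (cvgD ha hr).
Qed.

(** The slope of an inverse function is the inverse of the slope of [cexp]. *)
Lemma cder_clog z : log_dom z -> has_cderiv clog z z^-1.
Proof.
move=> hz; have z0 := log_dom_neq0 hz.
have [q [qE qc qz]] := cder_cexp (clog z).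
rewrite cexp_clog// in qE qz.
have qlc : ccvg (cnbhs z) (fun w => (q (clog w))^-1) z^-1.
  have -> : z^-1 = (q (clog z))^-1 by rewrite qz.
  apply: ccvgV; first by rewrite qz.
  exact: ccvg_comp (clog_cont hz) qc _.
apply/cderP => e e0; have [r r0 Hr] := filterI (qlc e e0) (log_dom_open hz).
exists r => // w /Hr[/= qw hw].
have [->|wz] := eqVneq w z; first by rewrite !subrr mulr0 subr0 cabs0 mulr0.
have E := qE (clog w); rewrite cexp_clog// in E.
have q0 : q (clog w) != 0.
  by apply/eqP => q0; move/eqP: E; rewrite q0 mul0r subr_eq0; apply/negP.
have -> : clog w - clog z = (q (clog w))^-1 * (w - z) by rewrite E mulKf.
by rewrite -mulrBl cabsM ler_wpM2r ?cabs_ge0// ltW.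
Qed.

End ComplexLogarithm.

(** * Integrals over the half-line and the Stieltjes kernel *)
Section HalfLine.
Variable R : realType.
Notation mu := (@lebesgue_measure R).
Notation J := (`[0%R, +oo[%classic : set R).

Lemma measurable_halfline : measurable J. Proof. exact: measurable_itv. Qed.

Lemma oneDsqrV_integrable : mu.-integrable J (EFin \o (fun r => (1 + r ^+ 2)^-1)).
Proof.
have c : {within J, continuous (fun r : R => (1 + r ^+ 2)^-1)}.
  by apply: continuous_subspaceT => x; exact: continuous_oneDsqrV.
apply/integrableP; split.
  by apply/measurable_EFinP; apply: subspace_continuous_measurable_fun.
have v0 (r : R) : 0 <= (1 + r ^+ 2)^-1 by rewrite invr_ge0 addr_ge0// sqr_ge0.
under eq_integral do rewrite /= ger0_norm//.
rewrite (@ge0_continuous_FTC2y R (fun r => (1 + r ^+ 2)^-1) (@atan R) 0 (pi / 2)) ?ltry//.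
- exact: cvgy_atan.
- by apply: cvg_at_right_filter; exact: continuous_atan.
- by move=> x _; rewrite derive1_atan.
Qed.

(** The integral over [[0, n]] converges to the integral by dominated convergence,
    whatever the sign of [u]. *)
Lemma Rintegral_FTC2y (u U : R -> R) (l : R) :
  continuous u -> mu.-integrable J (EFin \o u) ->
  (forall r : R, is_derive r 1 U (u r)) -> U n%:R @[n --> \oo] --> l ->
  Rintegral mu J u = l - U 0.
Proof.
move=> uc ui dU Ul.
have mJ := measurable_halfline.
have H1 n : Rintegral mu J (u \_ `[0, n.+1%:R]%classic) = U n.+1%:R - U 0.
  rewrite -Rintegral_mkcondr.
  have -> : J `&` `[0, n.+1%:R]%classic = `[0, n.+1%:R]%classic.
    by apply/seteqP; split => x /=; [case|rewrite !in_itv/= => /andP[-> ->]].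
  rewrite /Rintegral (@continuous_FTC2 R u U 0 n.+1%:R)//.
  - exact: continuous_subspaceT.
  - have dc : continuous U.
      move=> x; apply/differentiable_continuous/derivable1_diffP.
      by have [] := dU x.
    split; first by move=> x _; have [] := dU x.
      by apply: cvg_at_right_filter; exact: dc.
    by apply: cvg_at_left_filter; exact: dc.
  - by move=> x _; rewrite derive1E; have [_ ->] := dU x.
have um : measurable_fun J u by apply/measurable_EFinP; exact: measurable_int ui.
have [] := @dominated_Rintegral _ (measurableTypeR R) R mu J mJ (fun n => u \_ `[0, n.+1%:R]%classic) u
  (fun r => `|u r|).
- move=> n; rewrite patch_indic; apply: measurable_funM => //.
- move=> t; rewrite /= in_itv /= andbT => t0.
  have [N tN] : exists N : nat, t <= N%:R.
    by exists (Num.bound t); apply/ltW; exact: archi_boundP.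
  apply: (@cvg_trans _ ((fun=> u t) @ \oo)); last exact: cvg_cst.
  apply: near_eq_cvg; exists N => // n /= Nn; rewrite patchE ifT//.
  by rewrite inE /= in_itv /= t0 (le_trans tN)// ler_nat ltnW.
- exact: integrable_norm.
- by move=> n t _; rewrite patchE; case: ifP => // _; rewrite normr0.
move=> _; under eq_fun do rewrite H1.
move=> /cvg_lim <-//; apply: cvg_lim => //.
apply: cvgB; last exact: cvg_cst.
by rewrite (cvg_shiftS (fun n => U n%:R)).
Qed.

Lemma ccontinuous_T_meas (h : R -> R[i]) : ccontinuous_on setT h -> Cmeas J h.
Proof.
move=> hc; apply: itv_Cmeas => x Jx e e0.
by apply: (@filterS _ (nbhs x)) (hc x I e e0) => t + _; exact.
Qed.

Lemma Cintegral_FTC2y (h H : R -> R[i]) (l : R[i]) :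
  ccontinuous_on setT h -> Cintegrable mu J h ->
  (forall r : R, is_derive r 1 (fun t => complex.Re (H t)) (complex.Re (h r)) /\
             is_derive r 1 (fun t => complex.Im (H t)) (complex.Im (h r))) ->
  ccvg (nbhs \oo) (fun n => H n%:R) l ->
  Cintegral mu J h = l - H 0.
Proof.
move=> /ccontinuous_on_ReIm[cr ci] [ir ii] dH /ccvg_ReIm[lr li].
have W (u : R -> R) : {within setT, continuous u} -> continuous u.
  move=> /subspace_continuousP H0 t A /(H0 t I); apply: (@filterS _ (nbhs t)) => x; exact.
rewrite /Cintegral (Rintegral_FTC2y (W _ cr) ir (fun r => (dH r).1) lr).
rewrite (Rintegral_FTC2y (W _ ci) ii (fun r => (dH r).2) li).
by apply/eqP; rewrite eq_complex cReD cImD cReN cImN !eqxx.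
Qed.

(** A majorant of [cabs] whose integrability is that of the real and imaginary
    parts. *)
Definition norm_ReIm (z : R[i]) : R := `|complex.Re z| + `|complex.Im z|.

Lemma norm_ReIm_integrable (h : R -> R[i]) : Cintegrable mu J h ->
  mu.-integrable J (EFin \o (fun r => norm_ReIm (h r))).
Proof.
move=> [ir ii]; have mJ := measurable_halfline.
rewrite (_ : _ \o _ = (fun r => (`|complex.Re (h r)|)%:E + (`|complex.Im (h r)|)%:E)%E)//.
by apply: integrableD => //; exact: integrable_norm.
Qed.

Lemma integrable_lincomb (a b : R) (g1 g2 : R -> R) :
  mu.-integrable J (EFin \o g1) -> mu.-integrable J (EFin \o g2) ->
  mu.-integrable J (EFin \o (fun r => a * g1 r + b * g2 r)).
Proof.
move=> i1 i2; have mJ := measurable_halfline.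
rewrite (_ : _ \o _ = (fun r => (a%:E * (g1 r)%:E) + (b%:E * (g2 r)%:E))%E)//.
by apply: integrableD => //; exact: integrableZl.
Qed.

End HalfLine.

Section StieltjesKernel.
Variable R : realType.
Notation mu := (@lebesgue_measure R).
Notation J := (`[0%R, +oo[%classic : set R).

(** For [r <= 2 A] the distance [e] is enough, and for [r > 2 A] the distance to [r]
    is at least [r - A >= r / 2]. *)
Lemma dist_real_lower (s : R[i]) (A e r : R) : 1 <= A -> 0 < e -> cabs s <= A ->
  0 <= r -> e <= cabs (r%:C - s) ->
  Num.min (e / (1 + 2 * A)) 4^-1 * (1 + r) <= cabs (r%:C - s).
Proof.
move=> A1 e0 sA r0 er.
have [rA|rA] := leP r (2 * A).
  apply: le_trans er; rewrite (le_trans (_ : _ <= e / (1 + 2 * A) * (1 + r)))//.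
    by rewrite ler_wpM2r ?addr_ge0// ge_min lexx.
  rewrite mulrAC ler_pdivrMr; last by lra.
  by rewrite ler_wpM2l ?(ltW e0)// lerD2l.
rewrite (le_trans (_ : _ <= 4^-1 * (1 + r)))//.
  by rewrite ler_wpM2r ?addr_ge0// ge_min lexx orbT.
have := cabs_sub_le r%:C s; rewrite cabs_real ger0_norm//; lra.
Qed.

(** [r^2 - s^2] is the product of the distances of [r] to [s] and [- s], each of which
    is at least a multiple of [1 + r]. *)
Lemma sqr_kernel_lower (s0 : R[i]) : complex.Im s0 != 0 ->
  exists c e : R, [/\ 0 < c, 0 < e & forall s r, cabs (s - s0) < e -> 0 <= r ->
    complex.Im s != 0 /\ c * (1 + r ^+ 2) <= cabs ((r ^+ 2)%:C - s ^+ 2)].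
Proof.
move=> i0; set e := `|complex.Im s0| / 2.
have e0 : 0 < e by rewrite divr_gt0// normr_gt0.
set A := cabs s0 + 1 + e.
have A1 : 1 <= A by rewrite /A; have := cabs_ge0 s0; lra.
set c := Num.min (e / (1 + 2 * A)) 4^-1.
have A2 : 0 < 1 + 2 * A by lra.
have c0 : 0 < c by rewrite lt_min divr_gt0//= invr_gt0.
exists (c ^+ 2), e; split=> //; first by rewrite exprn_gt0.
move=> s r ss r0.
have iS : e <= `|complex.Im s|.
  have := le_Im_cabs (s - s0); rewrite cImD cImN => h.
  have : `|complex.Im s0| <= `|complex.Im s| + `|complex.Im s - complex.Im s0|.
    rewrite -{1}(subrK (complex.Im s) (complex.Im s0)) addrC.
    by rewrite (le_trans (ler_normD _ _))// (distrC (complex.Im s0)).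
  rewrite /e in ss *; lra.
have sA : cabs s <= A.
  by rewrite -(subrK s0 s) (le_trans (cabsD _ _))// /A; lra.
have l1 : c * (1 + r) <= cabs (r%:C - s).
  apply: dist_real_lower => //.
  by rewrite (le_trans iS)// (le_trans _ (le_Im_cabs _))// cImD cImN /= sub0r normrN.
have l2 : c * (1 + r) <= cabs (r%:C + s).
  rewrite -[s]opprK; apply: dist_real_lower; rewrite ?cabsN//.
  by rewrite (le_trans iS)// (le_trans _ (le_Im_cabs _))// cImD !cImN opprK /= add0r.
split; first by rewrite -normr_gt0 (lt_le_trans e0).
rewrite rmorphXn subr_sqr cabsM.
apply: (@le_trans _ _ ((c * (1 + r)) * (c * (1 + r)))); last first.
  by rewrite ler_pM// mulr_ge0// ?addr_ge0// ltW.
rewrite (_ : c * (1 + r) * _ = c ^+ 2 * (1 + r) ^+ 2); last by ring.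
rewrite ler_wpM2l ?sqr_ge0// sqrrD expr1n; nra.
Qed.

Lemma sqr_kernel_neq0 (s : R[i]) (r : R) : complex.Im s != 0 ->
  (r ^+ 2)%:C - s ^+ 2 != 0.
Proof.
move=> i0; have [c [e [c0 e0 H]]] := sqr_kernel_lower i0.
have [|_] := H s `|r| _ (normr_ge0 r); first by rewrite subrr cabs0.
rewrite real_normK ?num_real// => h; rewrite -cabs_gt0 (lt_le_trans _ h)// mulr_gt0//.
by rewrite ltr_pwDl// sqr_ge0.
Qed.

(** The kernel [1 / (r^2 - s^2)] multiplied by [1 + r^2]: off the real axis it is bounded
    in [r], so that it pairs with any integrable density. *)
Definition nkernel (s : R[i]) (r : R) : R[i] := (1 + r ^+ 2)%:C / ((r ^+ 2)%:C - s ^+ 2).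
Definition nkernel' (s : R[i]) (r : R) : R[i] :=
  (1 + r ^+ 2)%:C * (2 * s) / ((r ^+ 2)%:C - s ^+ 2) ^+ 2.

Lemma cder_sqr_kernel (a s : R[i]) :
  has_cderiv (fun s => a - s ^+ 2) s (- (2 * s)).
Proof.
apply: cder_eq (cderB (cder_cst a s) (cderM (cder_id s) (cder_id s))) _.
by rewrite mul1r mulr1 -mulr2n sub0r mulr_natl.
Qed.

Lemma cder_nkernel (s : R[i]) (r : R) : complex.Im s != 0 ->
  has_cderiv (fun s => nkernel s r) s (nkernel' s r).
Proof.
move=> i0; have n0 := sqr_kernel_neq0 r i0.
have H := @cderV R (fun s => (r ^+ 2)%:C - s ^+ 2) s _ n0 (cder_sqr_kernel _ s).
apply: cder_eq (cderMl (1 + r ^+ 2)%:C H) _.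
by rewrite /nkernel' mulrNN exprVn; ring.
Qed.

Lemma ccont_real (h : R -> R) : continuous h -> ccontinuous_on setT (fun r => (h r)%:C).
Proof. by move=> hc; apply: ccontinuous_on_real => x _; exact: hc. Qed.

Lemma ccont_inv {X : topologicalType} (E : set X) (h : X -> R[i]) : (forall x, E x -> h x != 0) ->
  ccontinuous_on E h -> ccontinuous_on E (fun x => (h x)^-1).
Proof. by move=> h0 hc x Ex; exact: ccvgV (h0 x Ex) (hc x Ex). Qed.

Lemma sqr_kernel_cont (a : R[i]) : ccontinuous_on setT (fun r : R => (r ^+ 2)%:C - a).
Proof.
apply: ccontinuous_onD; last exact: ccontinuous_on_cst.
by apply: ccont_real; exact: exprn_continuous.
Qed.

Lemma oneDsqrC_cont : ccontinuous_on setT (fun r : R => (1 + r ^+ 2)%:C).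
Proof. by apply: ccont_real; exact: continuous_oneDsqr. Qed.

Lemma nkernel_cont (s : R[i]) : complex.Im s != 0 -> ccontinuous_on setT (nkernel s).
Proof.
move=> i0; apply: ccontinuous_onM; first exact: oneDsqrC_cont.
by apply: ccont_inv; [move=> x _; exact: sqr_kernel_neq0|exact: sqr_kernel_cont].
Qed.

Lemma Cintegrable_meas (h : R -> R[i]) : Cintegrable mu J h -> Cmeas J h.
Proof.
by move=> [a b]; split; apply/measurable_EFinP; [exact: measurable_int a|exact: measurable_int b].
Qed.

Lemma cabs_le_norm_ReIm (z : R[i]) : cabs z <= norm_ReIm z. Proof. exact: cabs_le. Qed.

Definition stieltjes (G : R -> R[i]) (s : R[i]) : R[i] :=
  Cintegral mu J (fun r => G r * nkernel s r).

Section Transform.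
Variable G : R -> R[i].
Hypothesis iG : Cintegrable mu J G.

Lemma integrable_norm_ReImZ (a : R) : mu.-integrable J (EFin \o (fun r => a * norm_ReIm (G r))).
Proof.
have i1 := norm_ReIm_integrable iG.
rewrite (_ : _ \o _ = (fun r => a%:E * (norm_ReIm (G r))%:E)%E)//.
by apply: integrableZl => //; exact: measurable_halfline.
Qed.

Lemma stieltjes_integrable (s : R[i]) : complex.Im s != 0 ->
  Cintegrable mu J (fun r => G r * nkernel s r).
Proof.
move=> i0; have [c [e [c0 e0 H]]] := sqr_kernel_lower i0.
apply: (@Cintegrable_dom _ (measurableTypeR R) R mu J (@measurable_halfline R) _ (fun r => c^-1 * norm_ReIm (G r))).
- apply: (@CmeasM _ (measurableTypeR R) R J); first exact: Cintegrable_meas.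
  by apply: ccontinuous_T_meas; exact: nkernel_cont.
- exact: integrable_norm_ReImZ.
- move=> r; rewrite /= in_itv /= andbT => r0; have [|_ h] := H s r _ r0.
    by rewrite subrr cabs0.
  rewrite cabsM mulrC ler_pM ?cabs_ge0 ?cabs_le_norm_ReIm//.
  have q0 : 0 < 1 + r ^+ 2 by rewrite ltr_pwDl// sqr_ge0.
  rewrite /nkernel cabsM cabsV cabs_real gtr0_norm//.
  rewrite ler_pdivrMr; last by rewrite (lt_le_trans _ h)// mulr_gt0.
  by rewrite -ler_pdivrMl ?invr_gt0// invrK.
Qed.

Lemma cder_stieltjes (s : R[i]) : complex.Im s != 0 ->
  has_cderiv (stieltjes G) s (Cintegral mu J (fun r => G r * nkernel' s r)).
Proof.
move=> i0; have [c [e [c0 e0 H]]] := sqr_kernel_lower i0.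
set A := cabs s + e.
apply: (@cder_Cintegral _ (measurableTypeR R) R mu J (@measurable_halfline R)
  (fun r s => G r * nkernel s r) (fun r s => G r * nkernel' s r) s e
  (fun r => 2 * A / c ^+ 2 * norm_ReIm (G r))) => //.
- exact: integrable_norm_ReImZ.
- move=> w we; apply: stieltjes_integrable.
  by have [] := H w 0 we (lexx _).
- move=> r w; rewrite /= in_itv /= andbT => r0 we; have [iw h] := H w r we r0.
  split; first by apply: cderMl; exact: cder_nkernel.
  have q0 : 0 < 1 + r ^+ 2 by rewrite ltr_pwDl// sqr_ge0.
  have q1 : 1 <= 1 + r ^+ 2 by rewrite lerDl sqr_ge0.
  have d0 : 0 < cabs ((r ^+ 2)%:C - w ^+ 2) by rewrite (lt_le_trans _ h)// mulr_gt0.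
  rewrite cabsM mulrC ler_pM ?cabs_ge0 ?cabs_le_norm_ReIm//.
  rewrite /nkernel' !cabsM cabsV cabsX !cabs_real gtr0_norm//.
  have -> : cabs (2 : R[i]) = 2.
    have E2 : (2 : R[i]) = (2 : R)%:C by rewrite rmorph_nat.
    by rewrite E2 cabs_real ger0_norm.
  have wA : cabs w <= A by rewrite -(subrK s w) (le_trans (cabsD _ _))// addrC lerD2l ltW.
  rewrite ler_pdivrMr ?exprn_gt0//.
  apply: (@le_trans _ _ (2 * A / c ^+ 2 * (c * (1 + r ^+ 2)) ^+ 2)); last first.
    rewrite ler_wpM2l//; last by rewrite lerXn2r ?nnegrE ?cabs_ge0// mulr_ge0 ?ltW.
    by rewrite divr_ge0 ?sqr_ge0// mulr_ge0// (le_trans (cabs_ge0 w)).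
  have -> : 2 * A / c ^+ 2 * (c * (1 + r ^+ 2)) ^+ 2 = (1 + r ^+ 2) * (2 * A) * (1 + r ^+ 2).
    by field; rewrite gt_eqF.
  by rewrite -[leLHS]mulr1 ler_pM ?mulr_ge0 ?cabs_ge0 ?(ltW q0)// !ler_pM2l.
Qed.

End Transform.

Lemma stieltjesN G s : stieltjes G (- s) = stieltjes G s.
Proof. by rewrite /stieltjes /nkernel sqrrN. Qed.
End StieltjesKernel.

(** * Divided differences and the removable singularity *)
Section DividedDifference.
Variable R : realType.
Notation mu := (@lebesgue_measure R).
Notation J := (`[0%R, +oo[%classic : set R).
Variables (Phi Phi1 Phi2 : R[i] -> R[i]) (D : set R[i]).
Hypothesis oD : copen D.
Hypothesis realD : forall r : R, D r%:C.
Hypothesis dPhi : forall z, D z -> has_cderiv Phi z (Phi1 z).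
Hypothesis dPhi1 : forall z, D z -> has_cderiv Phi1 z (Phi2 z).
Hypothesis bPhi2 : forall z, D z -> exists B : R, cnbhs z [set w | cabs (Phi2 w) <= B].

Lemma cabs_cball_segment (z w u : R[i]) (r t : R) : cabs (z - u) < r -> cabs (w - u) < r ->
  0 <= t <= 1 -> cabs (z + t%:C * (w - z) - u) < r.
Proof.
move=> zr wr /andP[t0 t1].
have -> : z + t%:C * (w - z) - u = (1 - t)%:C * (z - u) + t%:C * (w - u).
  by rewrite rmorphB rmorph1; ring.
rewrite (le_lt_trans (cabsD _ _))// !cabsM !cabs_real (ger0_norm t0) ger0_norm ?subr_ge0//.
have [->|t0'] := eqVneq t 0; first by rewrite subr0 mul1r mul0r addr0.
have tp : 0 < t by rewrite lt_def t0'.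
have : t * cabs (w - u) < t * r by rewrite ltr_pM2l.
have : (1 - t) * cabs (z - u) <= (1 - t) * r by rewrite ler_wpM2l ?subr_ge0// ltW.
lra.
Qed.

(** The mean value inequality applied to the remainder, whose derivative is the
    first-order remainder of [Phi1]. *)
Lemma Phi_taylor2 z : D z -> forall e : R, 0 < e -> exists2 r : R, 0 < r &
  forall w, cabs (w - z) < r ->
  cabs (Phi w - Phi z - Phi1 z * (w - z) - Phi2 z / 2 * (w - z) ^+ 2) <= e * cabs (w - z) ^+ 2.
Proof.
move=> Dz e e0; have [r1 r10 H1] := (cderP _ _ _).1 (dPhi1 Dz) e e0.
have [r2 r20 H2] := oD Dz.
exists (Num.min r1 r2); first by rewrite lt_min r10.
move=> w; rewrite lt_min => /andP[w1 w2].
pose L u := Phi u - Phi1 z * (u - z) - Phi2 z / 2 * ((u - z) * (u - z)).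
have -> : Phi w - Phi z - Phi1 z * (w - z) - Phi2 z / 2 * (w - z) ^+ 2 = L w - L z.
  by rewrite /L expr2; ring.
rewrite expr2 mulrA; apply: cmvt => t t01.
set u := z + t%:C * (w - z).
have uw : cabs (u - z) <= cabs (w - z).
  rewrite /u addrC addKr cabsM cabs_real; move/andP: t01 => [t0 t1].
  by rewrite ger0_norm// ler_piMl ?cabs_ge0.
exists (Phi1 u - Phi1 z - Phi2 z * (u - z)).
  have Du : D u by apply: H2; exact: le_lt_trans w2.
  have dz : has_cderiv (fun v => v - z) u 1.
    by apply: cder_eq (cderB (cder_id u) (cder_cst z u)) _; rewrite subr0.
  apply: cder_eq (cderB (cderB (dPhi Du) (cderMl (Phi1 z) dz))
     (cderMl (Phi2 z / 2) (cderM dz dz))) _.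
  by field.
rewrite (le_trans (H1 _ _))//; first exact: le_lt_trans w1.
by rewrite ler_wpM2l// ltW.
Qed.

(** The difference quotient of [Phi] between [r] and [s], with its limit on the
    diagonal; [divdiff2] is its derivative in [s]. *)
Definition divdiff (r : R) (s : R[i]) : R[i] :=
  if s == r%:C then Phi1 r%:C else (Phi r%:C - Phi s) / (r%:C - s).
Definition divdiff2 (r : R) (s : R[i]) : R[i] :=
  if s == r%:C then Phi2 r%:C / 2 else (divdiff r s - Phi1 s) / (r%:C - s).

(** On the diagonal this is the second-order Taylor expansion of [Phi]. *)
Lemma cder_divdiff (r : R) (s : R[i]) : D s -> has_cderiv (divdiff r) s (divdiff2 r s).
Proof.
move=> Ds; rewrite /divdiff2; case: eqVneq => [sr|sr].
- rewrite sr; apply/cderP => e e0; have [d d0 Hd] := Phi_taylor2 (realD r) e0.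
  exists d => // w wd; rewrite {2}/divdiff eqxx /divdiff; case: eqVneq => [->|wr].
    by rewrite !subrr mulr0 subrr cabs0 mulr0.
  have wr0 : w - r%:C != 0 by rewrite subr_eq0.
  have -> : (Phi r%:C - Phi w) / (r%:C - w) - Phi1 r%:C - Phi2 r%:C / 2 * (w - r%:C) =
    (Phi w - Phi r%:C - Phi1 r%:C * (w - r%:C) - Phi2 r%:C / 2 * (w - r%:C) ^+ 2) / (w - r%:C).
    have rw0 : r%:C - w != 0 by rewrite -oppr_eq0 opprB.
    by field; rewrite wr0 rw0.
  rewrite cabsM cabsV ler_pdivrMr ?cabs_gt0//.
  by rewrite [leRHS](_ : _ = e * cabs (w - r%:C) ^+ 2); [exact: Hd|ring].
- have rs0 : r%:C - s != 0 by rewrite subr_eq0 eq_sym.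
  apply: (@cder_near _ (fun s => (Phi r%:C - Phi s) / (r%:C - s))).
    exists (cabs (s - r%:C)); first by rewrite cabs_gt0 subr_eq0.
    move=> w ws /=; rewrite /divdiff; case: eqVneq => // wr.
    by move: ws; rewrite wr cabsB ltxx.
  have d1 : has_cderiv (fun s => r%:C - s) s (-1).
    by apply: cder_eq (cderB (cder_cst r%:C s) (cder_id s)) _; rewrite sub0r.
  have d2 : has_cderiv (fun s => Phi r%:C - Phi s) s (- Phi1 s).
    by apply: cder_eq (cderB (cder_cst (Phi r%:C) s) (dPhi Ds)) _; rewrite sub0r.
  have d3 := @cderV R (fun s => r%:C - s) s _ rs0 d1.
  apply: cder_eq (cderM d2 d3) _.
  by rewrite /divdiff (negbTE sr); field.
Qed.

Lemma realC_cont : ccontinuous_on setT (fun r : R => r%:C).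
Proof. by apply: (@ccont_real R id) => x; exact: cvg_id. Qed.

Lemma PhiC_cont : ccontinuous_on setT (fun r : R => Phi r%:C).
Proof.
move=> r _; apply: (@ccvg_comp _ _ _ (real_complex R)) (cder_cont (dPhi (realD r))) _.
exact: realC_cont.
Qed.

Lemma divdiff_cont s : D s -> ccontinuous_on setT (fun r => divdiff r s).
Proof.
move=> Ds r1 _; have [q [qE qc qs]] := dPhi Ds.
have dE (r : R) : divdiff r s = q r%:C.
  rewrite /divdiff; case: eqVneq => [<-|sr]; first by rewrite -qs.
  by rewrite qE mulfK// subr_eq0 eq_sym.
have [sr|sr] := eqVneq s r1%:C.
  apply: (@ccvg_eq _ _ _ _ (fun r : R => q r%:C)); first by apply: filterE => r; rewrite /= dE.
  rewrite dE -sr; rewrite sr in qc *.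
  exact: (@ccvg_comp _ _ _ (real_complex R)) (realC_cont I) qc _.
have rs0 : r1%:C - s != 0 by rewrite subr_eq0 eq_sym.
have cB : ccvg (within setT (nbhs r1)) (fun r : R => r%:C - s) (r1%:C - s).
  exact: ccvgB (realC_cont I) (ccvg_cst s).
apply: (@ccvg_eq _ _ _ _ (fun r : R => (Phi r%:C - Phi s) / (r%:C - s))).
  have c0 : 0 < cabs (r1%:C - s) by rewrite cabs_gt0.
  apply: filterS (cB _ c0) => r /= h; rewrite /divdiff; case: eqVneq => // e.
  by move: h; rewrite e subrr sub0r cabsN ltxx.
rewrite /divdiff (negbTE sr); apply: ccvgM; last exact: ccvgV.
exact: ccvgB (PhiC_cont I) (ccvg_cst _).
Qed.

Variable G : R -> R[i].
Hypothesis iG : Cintegrable mu J G.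
(** Thus [G r = r Phi(r) / (1 + r^2)^2], the density for which the first term of the
    splitting is [divdiff_kernel]. *)
Hypothesis density_Phi : forall r : R, r%:C * Phi r%:C = G r * ((1 + r ^+ 2) ^+ 2)%:C.

Definition divdiff_kernel (r : R) (s : R[i]) : R[i] :=
  (r / (1 + r ^+ 2))%:C * (divdiff r s / (r%:C + s)).
Definition divdiff_kernel' (r : R) (s : R[i]) : R[i] :=
  (r / (1 + r ^+ 2))%:C * (divdiff2 r s / (r%:C + s) - divdiff r s / (r%:C + s) ^+ 2).

Lemma addrs_neq0 (r : R) (s : R[i]) : 0 <= r -> 0 < complex.Re s -> r%:C + s != 0.
Proof.
move=> r0 s0; apply/eqP => /(congr1 (@complex.Re R)) /=.
by rewrite cReD /= => h; lra.
Qed.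

Lemma cder_divdiff_kernel (r : R) (s : R[i]) : 0 <= r -> 0 < complex.Re s -> D s ->
  has_cderiv (divdiff_kernel r) s (divdiff_kernel' r s).
Proof.
move=> r0 s0 Ds; have n0 := addrs_neq0 r0 s0.
have d1 : has_cderiv (fun s => r%:C + s) s 1.
  by apply: cder_eq (cderD (cder_cst r%:C s) (cder_id s)) _; rewrite add0r.
have d3 := @cderV R (fun s => r%:C + s) s _ n0 d1.
apply: cderMl; apply: cder_eq (cderM (cder_divdiff r Ds) d3) _.
by rewrite mulr1 mulrN exprVn.
Qed.

Lemma divdiff_kernel_meas (s : R[i]) : 0 < complex.Re s -> D s ->
  Cmeas (J : set (measurableTypeR R)) (fun r => divdiff_kernel r s).
Proof.
move=> s0 Ds; apply: itv_Cmeas.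
have W (h : R -> R[i]) : ccontinuous_on setT h -> ccontinuous_on J h.
  move=> hc x _ e e0; have := hc x I e e0.
  by apply: (@filterS _ (nbhs x)) => t + _; exact.
apply: ccontinuous_onM.
  apply: W; apply: ccont_real => r; apply: cvgM; first exact: cvg_id.
  exact: continuous_oneDsqrV.
apply: ccontinuous_onM; first by apply: W; exact: divdiff_cont.
apply: ccont_inv.
  by move=> r; rewrite /= in_itv /= andbT => r0; exact: addrs_neq0.
apply: W; apply: ccontinuous_onD; [exact: realC_cont|exact: ccontinuous_on_cst].
Qed.

(** The majorant is integrable and uniform for [s] near [r0].  For [r] near [r0] the
    divided differences are bounded by bounds of [Phi1] and [Phi2], through the mean
    value inequality.  Elsewhere [|r - s|] is at least [c (1 + r)], so the quotients
    can be estimated term by term; there [Phi r] is controlled only through the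
    integrable density [G]. *)
Lemma divdiff_kernel_bounds (r0 : R) : 0 < r0 -> exists d a b : R, 0 < d /\
  forall r s, 0 <= r -> cabs (s - r0%:C) < d ->
  [/\ 0 < complex.Re s, D s,
      cabs (divdiff_kernel r s) <= a * norm_ReIm (G r) + b * (1 + r ^+ 2)^-1 &
      cabs (divdiff_kernel' r s) <= a * norm_ReIm (G r) + b * (1 + r ^+ 2)^-1].
Proof.
move=> r00; have Ds0 := realD r0.
have bnd (h h' : R[i] -> R[i]) : has_cderiv h r0%:C (h' r0%:C) ->
    cnbhs r0%:C [set w | cabs (h w) <= cabs (h r0%:C) + 1].
  move=> /cder_cont/(_ _ ltr01)[d d0 Hd]; exists d => // w /Hd /= hw.
  by rewrite -(subrK (h r0%:C) (h w)) (le_trans (cabsD _ _))// addrC lerD2l ltW.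
have [B2 H2] := bPhi2 Ds0.
have [p p0 Hp] := filterI (filterI (bnd _ _ (dPhi Ds0)) (bnd _ _ (dPhi1 Ds0))) (filterI H2 (oD Ds0)).
set B0 := cabs (Phi r0%:C) + 1 in Hp; set B1 := cabs (Phi1 r0%:C) + 1 in Hp.
have B00 : 0 <= B0 by rewrite addr_ge0// cabs_ge0.
have B10 : 0 <= B1 by rewrite addr_ge0// cabs_ge0.
have ball (w : R[i]) : cabs (w - r0%:C) < p ->
    [/\ cabs (Phi w) <= B0, cabs (Phi1 w) <= B1, cabs (Phi2 w) <= B2 & D w].
  by move=> /Hp[[? ?] [? ?]].
have B20 : 0 <= B2.
  have [|_ _ h _] := ball r0%:C; first by rewrite subrr cabs0.
  by apply: le_trans h; exact: cabs_ge0.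
set d := Num.min p r0 / 2.
have d0 : 0 < d by rewrite divr_gt0// lt_min p0.
have dp : 2 * d <= p by rewrite /d mulrC divfK ?pnatr_eq0// ge_min lexx.
have dr : 2 * d <= r0 by rewrite /d mulrC divfK ?pnatr_eq0// ge_min lexx orbT.
set A := r0 + 1 + d; have A1 : 1 <= A by rewrite /A; lra.
have A2 : 0 < 1 + 2 * A by lra.
set c := Num.min (Num.min (d / (1 + 2 * A)) 4^-1) (Num.min 1 d).
have c0 : 0 < c by rewrite !lt_min divr_gt0//= invr_gt0 ltr0n ltr01.
have c1 : c <= Num.min (d / (1 + 2 * A)) 4^-1 by rewrite ge_min lexx.
have c2 : c <= 1 by rewrite !ge_min lexx !orbT.
have c3 : c <= d by rewrite !ge_min lexx !orbT.
clearbody c.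
(* [(1 + r) P] and [(1 + r) Q] dominate [r / (1 + r^2)] times [divdiff] and [divdiff2];
   the terms in [B1] and [B2] serve near the diagonal, the others away from it *)
pose v (r : R) : R := (1 + r ^+ 2)^-1.
pose P (r : R) : R := c^-1 * (norm_ReIm (G r) + B0 * v r) + B1 * v r.
pose Q (r : R) : R := B2 * v r + c^-1 * (P r + B1 * v r).
(* the coefficients of [norm_ReIm (G r)] and [v r] in [c^-1 P + c^-1 Q + c^-2 P] *)
exists d, (c^-1 * c^-1 + c^-1 * (c^-1 * c^-1) + c^-1 * (c^-1 * c^-1)),
  (c^-1 * (c^-1 * B0 + B1) + (c^-1 * (B2 + c^-1 * (c^-1 * B0 + B1 + B1)) + c^-1 * c^-1 * (c^-1 * B0 + B1))).
split=> // r s r0' ss.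
set g := cabs (G r); have gn : g <= norm_ReIm (G r) := cabs_le_norm_ReIm _.
have g0 : 0 <= g := cabs_ge0 _.
have q1 : 1 <= 1 + r ^+ 2 by rewrite lerDl sqr_ge0.
have v0 : 0 < v r by rewrite invr_gt0 (lt_le_trans ltr01).
have ci0 : 0 < c^-1 by rewrite invr_gt0.
have r1 : 0 < 1 + r by lra.
have Rs : d <= complex.Re s.
  have := le_Re_cabs (s - r0%:C); rewrite cReD cReN /= ler_norml => /andP[h _]; lra.
have s0 : 0 < complex.Re s by exact: lt_le_trans Rs.
have sp : cabs (s - r0%:C) < p by rewrite (lt_le_trans ss)//; lra.
have [bs0 bs1 _ Ds] := ball _ sp.
have lp : c * (1 + r) <= cabs (r%:C + s).
  rewrite (le_trans _ (le_Re_cabs _))// (le_trans _ (ler_norm _))// cReD /=.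
  have : c * (1 + r) = c + c * r by ring.
  have : c * r <= r by rewrite ler_piMl.
  lra.
pose W := r / (1 + r ^+ 2).
have W0 : 0 <= W by rewrite mulr_ge0// ltW.
have Wv : W <= v r * (1 + r) by rewrite /W mulrC ler_wpM2l ?(ltW v0)// ler_wpDl.
have WPhi : W * cabs (Phi r%:C) = g * (1 + r ^+ 2).
  have E : W%:C * Phi r%:C = G r * (1 + r ^+ 2)%:C.
    have n0 : (1 + r ^+ 2)%:C != 0 :> R[i].
      by rewrite -cabs_eq0 cabs_real normr_eq0 gt_eqF// (lt_le_trans ltr01).
    have Wq : W%:C * (1 + r ^+ 2)%:C = r%:C.
      by rewrite -rmorphM /W divfK// gt_eqF// (lt_le_trans ltr01).
    by apply: (mulIf n0); rewrite mulrAC Wq density_Phi expr2 rmorphM mulrA.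
  have := congr1 (@cabs R) E; rewrite !cabsM !cabs_real ger0_norm// ger0_norm//.
  by rewrite (le_trans ler01).
have dcs (z w : R[i]) : cabs (z - r0%:C) < p -> cabs (w - r0%:C) < p ->
    cabs (Phi1 w - Phi1 z) <= B2 * cabs (w - z).
  move=> zp wp; apply: cmvt => t /(cabs_cball_segment zp wp) up.
  by have [_ _ ? Du] := ball _ up; exists (Phi2 (z + t%:C * (w - z))) => //; exact: dPhi1.
have near1 : cabs (r%:C - r0%:C) < 2 * d ->
    cabs (divdiff r s) <= B1 /\ cabs (divdiff2 r s) <= B2.
  move=> rd; have rp : cabs (r%:C - r0%:C) < p by exact: lt_le_trans dp.
  have [_ br1 br2 Dr] := ball _ rp.
  rewrite /divdiff2 /divdiff; case: eqVneq => [_|sr].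
    split => //; rewrite cabsM cabsV.
    have -> : cabs (2 : R[i]) = 2.
      have E2 : (2 : R[i]) = (2 : R)%:C by rewrite rmorph_nat.
      by rewrite E2 cabs_real ger0_norm.
    rewrite ler_pdivrMr// (le_trans br2)//; lra.
  have rs0 : r%:C - s != 0 by rewrite subr_eq0 eq_sym.
  split.
    rewrite cabsM cabsV ler_pdivrMr ?cabs_gt0//.
    apply: cmvt => t /(cabs_cball_segment sp rp) up.
    by have [_ ? _ Du] := ball _ up; exists (Phi1 (s + t%:C * (r%:C - s))) => //; exact: dPhi.
  pose L u := Phi u - Phi1 s * (u - s).
  have -> : ((Phi r%:C - Phi s) / (r%:C - s) - Phi1 s) / (r%:C - s) =
      (L r%:C - L s) / (r%:C - s) ^+ 2 by rewrite /L; field.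
  rewrite cabsM cabsV cabsX ler_pdivrMr ?exprn_gt0 ?cabs_gt0//.
  rewrite expr2 mulrA; apply: cmvt => t t01.
  have up := cabs_cball_segment sp rp t01.
  set u := s + t%:C * (r%:C - s) in up *.
  have [_ _ _ Du] := ball _ up.
  exists (Phi1 u - Phi1 s).
    have du : has_cderiv (fun v => v - s) u 1.
      by apply: cder_eq (cderB (cder_id u) (cder_cst s u)) _; rewrite subr0.
    by apply: cder_eq (cderB (dPhi Du) (cderMl (Phi1 s) du)) _; rewrite mulr1.
  rewrite (le_trans (dcs _ _ sp up))// ler_wpM2l//.
  rewrite /u addrC addKr cabsM cabs_real; move/andP: t01 => [t0 t1].
  by rewrite ger0_norm// ler_piMl ?cabs_ge0.
have far1 : 2 * d <= cabs (r%:C - r0%:C) -> c * (1 + r) <= cabs (r%:C - s).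
  move=> rd; apply: (@le_trans _ _ (Num.min (d / (1 + 2 * A)) 4^-1 * (1 + r))).
    by rewrite ler_wpM2r// ltW.
  apply: dist_real_lower => //.
    rewrite -(subrK r0%:C s) (le_trans (cabsD _ _))// cabs_real ger0_norm ?(ltW r00)//.
    rewrite /A; lra.
  have := cabsD (r%:C - s) (s - r0%:C); rewrite subrKA => h; lra.
have far2 : 2 * d <= cabs (r%:C - r0%:C) -> s != r%:C.
  move=> /far1; apply: contraTneq => ->; rewrite subrr cabs0 -ltNge.
  exact: mulr_gt0.
have gn0 : 0 <= norm_ReIm (G r) := le_trans g0 gn.
have r2 : 0 <= (1 + r) ^+ 2 by exact: sqr_ge0.
have B0v0 : 0 <= B0 * v r by rewrite mulr_ge0// ltW.
have Bv0 : 0 <= B1 * v r by rewrite mulr_ge0// ltW.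
have B2v0 : 0 <= B2 * v r by rewrite mulr_ge0// ltW.
have cG0 : 0 <= c^-1 * (norm_ReIm (G r) + B0 * v r) by rewrite mulr_ge0 ?(ltW ci0)// addr_ge0.
have P0 : 0 <= P r by rewrite /P addr_ge0.
have PW : W * cabs (divdiff r s) <= P r * (1 + r).
  have [rd|rd] := ltP (cabs (r%:C - r0%:C)) (2 * d).
    have [h _] := near1 rd.
    have := ler_pM W0 (cabs_ge0 _) Wv h.
    have : 0 <= c^-1 * (norm_ReIm (G r) + B0 * v r) * (1 + r).
      by rewrite mulr_ge0// ltW.
    rewrite /P; lra.
  have rs := far1 rd; have rsn := far2 rd.
  have rs0 : 0 < cabs (r%:C - s) by rewrite cabs_gt0 subr_eq0 eq_sym.
  rewrite /divdiff (negbTE rsn) cabsM cabsV mulrA ler_pdivrMr//.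
  apply: (@le_trans _ _ (P r * (1 + r) * (c * (1 + r)))); last first.
    by rewrite ler_wpM2l// mulr_ge0// ltW.
  have h1 : W * cabs (Phi r%:C - Phi s) <= W * (cabs (Phi r%:C) + B0).
    rewrite ler_wpM2l// (le_trans (cabsD _ _))// cabsN lerD2l//.
  rewrite (le_trans h1)// mulrDr WPhi.
  have h2 : W * B0 <= v r * (1 + r) * B0 by rewrite ler_wpM2r.
  have h3 : g * (1 + r ^+ 2) <= norm_ReIm (G r) * (1 + r) ^+ 2.
    rewrite ler_pM// ?(le_trans ler01)// (_ : (1 + r) ^+ 2 = 1 + r ^+ 2 + 2 * r); last by ring.
    by rewrite lerDl mulr_ge0.
  have h4 : v r * (1 + r) * B0 <= B0 * v r * (1 + r) ^+ 2.
    rewrite (_ : v r * (1 + r) * B0 = B0 * v r * (1 + r)); last by ring.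
    rewrite ler_wpM2l ?mulr_ge0 ?(ltW v0)//.
    rewrite (_ : (1 + r) ^+ 2 = 1 + r + (r + r ^+ 2)); last by ring.
    by rewrite lerDl addr_ge0// sqr_ge0.
  have -> : P r * (1 + r) * (c * (1 + r)) =
      (norm_ReIm (G r) + B0 * v r) * (1 + r) ^+ 2 + c * (B1 * v r) * (1 + r) ^+ 2.
    by rewrite /P; field; rewrite gt_eqF.
  have : 0 <= c * (B1 * v r) * (1 + r) ^+ 2.
    by rewrite mulr_ge0// mulr_ge0// ltW.
  lra.
have Q0 : 0 <= Q r.
  by rewrite /Q addr_ge0// mulr_ge0 ?(ltW ci0)// addr_ge0.
have QW : W * cabs (divdiff2 r s) <= Q r * (1 + r).
  have [rd|rd] := ltP (cabs (r%:C - r0%:C)) (2 * d).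
    have [_ h] := near1 rd.
    rewrite (le_trans (ler_pM W0 (cabs_ge0 _) Wv h))//.
    rewrite (_ : v r * (1 + r) * B2 = B2 * v r * (1 + r)); last by ring.
    by rewrite ler_wpM2r ?(ltW r1)// /Q lerDl mulr_ge0 ?(ltW ci0)// addr_ge0.
  have rs := far1 rd; have rsn := far2 rd.
  have rs0 : 0 < cabs (r%:C - s) by rewrite cabs_gt0 subr_eq0 eq_sym.
  rewrite /divdiff2 (negbTE rsn) cabsM cabsV mulrA ler_pdivrMr//.
  apply: (@le_trans _ _ (Q r * (1 + r) * (c * (1 + r)))); last first.
    by rewrite ler_wpM2l// mulr_ge0 ?(ltW r1).
  have h1 : W * cabs (divdiff r s - Phi1 s) <= P r * (1 + r) + B1 * v r * (1 + r).
    rewrite (le_trans (ler_wpM2l W0 (cabsD _ _)))// mulrDr cabsN lerD//.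
    rewrite (_ : B1 * v r * (1 + r) = v r * (1 + r) * B1); last by ring.
    by rewrite ler_pM// cabs_ge0.
  rewrite (le_trans h1)//.
  have -> : Q r * (1 + r) * (c * (1 + r)) =
      c * (B2 * v r) * (1 + r) ^+ 2 + (P r + B1 * v r) * (1 + r) ^+ 2.
    by rewrite /Q; field; rewrite gt_eqF.
  rewrite -mulrDl (le_trans (_ : _ <= (P r + B1 * v r) * (1 + r) ^+ 2))//.
    rewrite ler_wpM2l ?addr_ge0// (_ : (1 + r) ^+ 2 = 1 + r + (r + r ^+ 2)); last by ring.
    by rewrite lerDl addr_ge0// sqr_ge0.
  by rewrite lerDr mulr_ge0// mulr_ge0// ltW.
have T0 : 0 < cabs (r%:C + s) by rewrite (lt_le_trans _ lp)// mulr_gt0.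
have T1 : W * (cabs (divdiff r s) / cabs (r%:C + s)) <= c^-1 * P r.
  rewrite mulrA ler_pdivrMr// (le_trans PW)//.
  rewrite [leLHS](_ : _ = c^-1 * P r * (c * (1 + r))); last by field; rewrite gt_eqF.
  by rewrite ler_wpM2l// mulr_ge0// ltW.
have T2 : W * (cabs (divdiff2 r s) / cabs (r%:C + s)) <= c^-1 * Q r.
  rewrite mulrA ler_pdivrMr// (le_trans QW)//.
  rewrite [leLHS](_ : _ = c^-1 * Q r * (c * (1 + r))); last by field; rewrite gt_eqF.
  by rewrite ler_wpM2l// mulr_ge0// ltW.
have T3 : W * (cabs (divdiff r s) / cabs (r%:C + s) ^+ 2) <= c^-1 * c^-1 * P r.
  rewrite expr2 invfM mulrA mulrA -(mulrA W) ler_pdivrMr// (le_trans T1)//.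
  rewrite (_ : c^-1 * P r = c^-1 * c^-1 * P r * c); last by field; rewrite gt_eqF.
  rewrite ler_wpM2l ?mulr_ge0 ?(ltW ci0)//.
  by rewrite (le_trans _ lp)// ler_peMr ?(ltW c0)// lerDl.
have -> : (c^-1 * c^-1 + c^-1 * (c^-1 * c^-1) + c^-1 * (c^-1 * c^-1)) * norm_ReIm (G r) +
  (c^-1 * (c^-1 * B0 + B1) + (c^-1 * (B2 + c^-1 * (c^-1 * B0 + B1 + B1)) +
    c^-1 * c^-1 * (c^-1 * B0 + B1))) * (1 + r ^+ 2)^-1 =
  c^-1 * P r + (c^-1 * Q r + c^-1 * c^-1 * P r).
  by rewrite /Q /P /v; ring.
split=> //.
- rewrite /divdiff_kernel cabsM cabs_real (ger0_norm W0) cabsM cabsV (le_trans T1)//.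
  have cQ : 0 <= c^-1 * Q r by rewrite mulr_ge0// ltW.
  have cP : 0 <= c^-1 * c^-1 * P r by rewrite mulr_ge0// mulr_ge0// ltW.
  by rewrite lerDl addr_ge0.
- rewrite /divdiff_kernel' cabsM cabs_real (ger0_norm W0).
  rewrite (le_trans (ler_wpM2l W0 (cabsD _ _)))// mulrDr cabsN !cabsM !cabsV cabsX.
  by rewrite (le_trans (lerD T2 T3))// lerDr mulr_ge0// ltW.
Qed.

Lemma divdiff_kernel_integrable (r0 : R) : 0 < r0 -> exists2 d : R, 0 < d &
  forall s, cabs (s - r0%:C) < d -> Cintegrable mu J (fun r => divdiff_kernel r s).
Proof.
move=> r00; have [d [a [b [d0 H]]]] := divdiff_kernel_bounds r00; exists d => // s ss.
have [s0 Ds _ _] := H 0 s (lexx _) ss.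
apply: (@Cintegrable_dom _ (measurableTypeR R) R mu J (@measurable_halfline R) _
  (fun r => a * norm_ReIm (G r) + b * (1 + r ^+ 2)^-1)).
- exact: divdiff_kernel_meas.
- exact: integrable_lincomb (norm_ReIm_integrable iG) (@oneDsqrV_integrable R).
- by move=> r; rewrite /= in_itv /= andbT => r0'; have [] := H r s r0' ss.
Qed.

Lemma cder_divdiff_kernel_integral (r0 : R) : 0 < r0 ->
  has_cderiv (fun s => Cintegral mu J (fun r => divdiff_kernel r s)) r0%:C
    (Cintegral mu J (fun r => divdiff_kernel' r r0%:C)).
Proof.
move=> r00; have [d [a [b [d0 H]]]] := divdiff_kernel_bounds r00.
have [d' d'0 H'] := divdiff_kernel_integrable r00.
apply: (@cder_Cintegral _ (measurableTypeR R) R mu J (@measurable_halfline R)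
  divdiff_kernel divdiff_kernel' r0%:C (Num.min d d')
  (fun r => a * norm_ReIm (G r) + b * (1 + r ^+ 2)^-1)).
- by rewrite lt_min d0.
- exact: integrable_lincomb (norm_ReIm_integrable iG) (@oneDsqrV_integrable R).
- by move=> w; rewrite lt_min => /andP[_]; exact: H'.
- move=> r w; rewrite /= in_itv /= andbT lt_min => r0' /andP[wd _].
  have [w0 Dw _ h] := H r w r0' wd.
  by split => //; exact: cder_divdiff_kernel.
Qed.

End DividedDifference.

(** * The logarithmic term *)
Section LogIntegral.
Variable R : realType.
Notation mu := (@lebesgue_measure R).
Notation J := (`[0%R, +oo[%classic : set R).

(** The density [G] for which [Phi] is the constant [1]. *)
Definition weight0 (r : R) : R[i] := (r / (1 + r ^+ 2) ^+ 2)%:C.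

Lemma oneDsqr_pos (r : R) : 0 < 1 + r ^+ 2.
Proof. by rewrite ltr_pwDl// sqr_ge0. Qed.

Lemma oneDsqrC_neq0 (r : R) : (1 + r ^+ 2)%:C != 0 :> R[i].
Proof. by rewrite -cabs_eq0 cabs_real normr_eq0 gt_eqF// oneDsqr_pos. Qed.

Lemma weight0_integrable : Cintegrable mu J weight0.
Proof.
apply: (@Cintegrable_dom _ (measurableTypeR R) R mu J (@measurable_halfline R) _
  (fun r => (1 + r ^+ 2)^-1)).
- apply: ccontinuous_T_meas; apply: ccont_real => r.
  apply: cvgM; first exact: cvg_id.
  apply: cvgV; first by rewrite expf_eq0 /= gt_eqF// oneDsqr_pos.
  rewrite expr2; under eq_fun do rewrite expr2.
  by apply: cvgM; exact: continuous_oneDsqr.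
- exact: oneDsqrV_integrable.
- move=> r; rewrite /= in_itv /= andbT => r0; rewrite cabs_real ger0_norm; last first.
    by rewrite divr_ge0// sqr_ge0.
  have q := oneDsqr_pos r.
  rewrite ler_pdivrMr ?exprn_gt0// expr2 mulKf ?gt_eqF//; nra.
Qed.

(** The imaginary part of [r^2 - s^2] vanishes only if [Re s = 0], and then the real
    part is positive. *)
Lemma log_dom_ratio (s : R[i]) (r : R) : 0 < complex.Im s ->
  log_dom (((r ^+ 2)%:C - s ^+ 2) / (1 + r ^+ 2)%:C).
Proof.
move=> s0 [].
set q := 1 + r ^+ 2; have q0 : 0 < q := oneDsqr_pos r.
have -> : ((r ^+ 2)%:C - s ^+ 2) / q%:C = (q^-1)%:C * ((r ^+ 2)%:C - s ^+ 2).
  by rewrite mulrC fmorphV.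
rewrite cReZ cImZ expr2 => /eqP.
rewrite mulf_eq0 invr_eq0 gt_eqF//= cImD cImN cImM /= sub0r oppr_eq0.
rewrite [X in _ + X]mulrC -mulr2n mulrn_eq0 /= mulf_eq0 (gt_eqF s0) orbF => /eqP sr.
rewrite pmulr_rle0 ?invr_gt0// cReD cReN cReM /= sr mul0r sub0r opprK.
by have := sqr_ge0 r; have := mulr_gt0 s0 s0; lra.
Qed.

Lemma clog1 : clog (1 : R[i]) = 0.
Proof. by rewrite /clog cabs1 ln1 /= mul0r atan0 mulr0. Qed.

(** As [0 < arg s < pi], the right-hand side has its imaginary part in
    [(- pi, pi)]. *)
Lemma clogN_sqr (s : R[i]) : 0 < complex.Im s ->
  clog (- s ^+ 2) = 2 * clog s - Complex 0 pi.
Proof.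
move=> s0.
have ls : log_dom s by move=> [h _]; rewrite h ltxx in s0.
have E : cexp (2 * clog s - Complex 0 pi) = - s ^+ 2.
  rewrite cexpD mulr_natl mulr2n cexpD cexp_clog// cexpN.
  have -> : cexp (Complex 0 pi) = -1 :> R[i].
    rewrite /cexp /= expR0 cospi sinpi mulr0 mul1r.
    by apply/eqP; rewrite eq_complex /= oppr0 !eqxx.
  by rewrite invrN1 mulrN1 expr2.
rewrite -E cexpK//.
  have := clog_Im_gt0 s0; have /andP[_] := clog_Im s.
  rewrite cImD cImN mulr_natl mulr2n cImD /= => h1 h2; apply/andP; split; lra.
rewrite E; have := @log_dom_ratio s 0 s0.
by rewrite expr0n /= addr0 rmorph1 divr1 sub0r.
Qed.

(** The integrand has the primitive [clog ((r^2 - s^2) / (1 + r^2)) / 2], whose argument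
    stays off the cut; it tends to [0] at infinity and equals [clog s - i pi / 2] at
    [0]. *)
Lemma log_integral (s : R[i]) : 0 < complex.Im s ->
  (1 + s ^+ 2) * stieltjes weight0 s = Complex 0 (pi / 2) - clog s.
Proof.
move=> s0; have i0 : complex.Im s != 0 by rewrite gt_eqF.
have int := stieltjes_integrable weight0_integrable i0.
rewrite /stieltjes -(@CintegralZ _ (measurableTypeR R) R mu J (@measurable_halfline R) _ _ int).
pose u (z : R[i]) := (z * z - s ^+ 2) / (1 + z * z).
pose g (z : R[i]) := 2^-1 * clog (u z).
pose h (r : R) := (1 + s ^+ 2) * (weight0 r * nkernel s r).
pose H (r : R) := g (0 + r%:C * 1).
have rr (r : R) : 0 + r%:C * 1 = r%:C by rewrite add0r mulr1.
have uE (r : R) : u r%:C = ((r ^+ 2)%:C - s ^+ 2) / (1 + r ^+ 2)%:C.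
  by rewrite /u rmorphD rmorph1 -rmorphM expr2.
have n1 (r : R) := oneDsqrC_neq0 r.
have n2 (r : R) := sqr_kernel_neq0 r i0.
have hE (r : R) : h r = (1 + s ^+ 2) * r%:C / ((1 + r ^+ 2)%:C * ((r ^+ 2)%:C - s ^+ 2)).
  rewrite /h /weight0 /nkernel rmorphM fmorphV rmorphXn /=.
  move: (n1 r) (n2 r); move: (1 + r ^+ 2)%:C ((r ^+ 2)%:C - s ^+ 2) => a b a0 b0.
  by field; rewrite a0 b0.
have dg (r : R) : has_cderiv g (0 + r%:C * 1) (h r).
  rewrite rr; set z := r%:C.
  have zz : z * z = (r ^+ 2)%:C by rewrite -rmorphM -expr2.
  have zz1 : 1 + z * z = (1 + r ^+ 2)%:C by rewrite zz rmorphD rmorph1.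
  have m1 : 1 + z * z != 0 by rewrite zz1.
  have d1 (a : R[i]) : has_cderiv (fun w => w * w + a) z (2 * z).
    apply: cder_eq (cderD (cderM (cder_id z) (cder_id z)) (cder_cst a z)) _.
    by rewrite mul1r mulr1 addr0 mulr_natl mulr2n.
  have d2 : has_cderiv (fun w => 1 + w * w) z (2 * z).
    by apply: cder_near (d1 1); apply: filterE => w /=; rewrite addrC.
  have d3 := cderM (d1 (- s ^+ 2)) (@cderV R (fun w => 1 + w * w) z _ m1 d2).
  have lu : log_dom (u z) by rewrite uE; exact: log_dom_ratio.
  apply: cder_eq (cderMl 2^-1 (@cder_comp R u (@clog R) z _ _ d3 (cder_clog lu))) _.
  have m2 : z * z - s ^+ 2 != 0 by rewrite zz.
  rewrite hE /u -zz -zz1 -/z; field; by rewrite m1 m2.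
have hc : ccontinuous_on setT h.
  apply: ccontinuous_onM; first exact: ccontinuous_on_cst.
  apply: ccontinuous_onM; last exact: nkernel_cont.
  apply: ccont_real => r; apply: cvgM; first exact: cvg_id.
  apply: cvgV; first by rewrite expf_eq0 /= gt_eqF// oneDsqr_pos.
  rewrite expr2; under eq_fun do rewrite expr2.
  by apply: cvgM; exact: continuous_oneDsqr.
rewrite (@Cintegral_FTC2y R h H 0 hc).
- rewrite /H rr sub0r /g uE expr0n /= addr0 rmorph1 divr1 sub0r clogN_sqr//.
  rewrite mulrBr mulrA mulVf ?pnatr_eq0// mul1r opprB; congr (_ - _).
  apply: (mulfI (_ : (2 : R[i]) != 0)); first by rewrite pnatr_eq0.
  rewrite mulrA divff ?pnatr_eq0// mul1r mulr_natl mulr2n.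
  by apply/eqP; rewrite eq_complex /= addr0 eqxx/=; apply/eqP; lra.
- exact: (@CintegrableZ _ (measurableTypeR R) R mu J (@measurable_halfline R) _ _ int).
- by move=> r; have [] := cder_path (dg r); rewrite mulr1.
- rewrite -(mulr0 (2^-1 : R[i])) -clog1; apply: ccvgM; first exact: ccvg_cst.
  apply: (@ccvg_comp _ _ _ (fun n : nat => u (0 + n%:R%:C * 1))) (clog_cont _) _; last first.
    by move=> [_ /=]; rewrite ler10.
  apply: (@ccvg_eq _ _ _ _ (fun n : nat => 1 - (1 + s ^+ 2) * ((1 + n%:R ^+ 2)^-1)%:C)).
    apply: filterE => n; rewrite /mkset rr uE fmorphV /=.
    have -> : (n%:R ^+ 2)%:C = (1 + n%:R ^+ 2)%:C - 1 :> R[i].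
      by rewrite rmorphD rmorph1 addrC addKr.
    by move: (n1 n%:R); move: (1 + n%:R ^+ 2)%:C => a a0; field.
  rewrite -[X in ccvg _ _ X]subr0 -(mulr0 (1 + s ^+ 2)); apply: ccvgB; first exact: ccvg_cst.
  apply: ccvgM; first exact: ccvg_cst.
  apply/ccvg_ReIm; split => /=; last exact: cvg_cst.
  apply/cvgrPdist_lt => e e0.
  have [N _ HN] := near_infty_natSinv_lt (PosNum e0).
  exists N.+1 => // n /= Nn; rewrite sub0r normrN gtr0_norm ?invr_gt0 ?oneDsqr_pos//.
  have := HN n.-1; rewrite prednK; last by case: n Nn.
  move=> /(_ _) hh; apply: le_lt_trans (hh _); last by rewrite /= -ltnS prednK//; case: n Nn {hh}.
  rewrite lef_pV2 ?posrE ?oneDsqr_pos ?ltr0n//; last by case: n Nn {hh}.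
  have : (1 : R) <= n%:R by rewrite ler1n; case: n Nn {hh}.
  by move=> h1; nra.
Qed.
End LogIntegral.

(** * Continuation across the half-line *)
Section Continuation.
Variable R : realType.
Notation mu := (@lebesgue_measure R).
Notation J := (`[0%R, +oo[%classic : set R).
Variables (F0 F1 F2 : R[i] -> R[i]).
Notation D := (@strip_dom R).
Hypothesis dF0 : forall z, D z -> has_cderiv F0 z (F1 z).
Hypothesis dF1 : forall z, D z -> has_cderiv F1 z (F2 z).
Hypothesis bF2 : forall z, D z -> exists B : R, cnbhs z [set w | cabs (F2 w) <= B].
Hypothesis F0_even : forall z, D z -> F0 (- z) = F0 z.
Let G (r : R) : R[i] := F0 r%:C * r%:C / (1 + r ^+ 2)%:C.
Hypothesis iG : Cintegrable mu J G.

Let Phi (z : R[i]) := F0 z * (1 + z * z).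
Let Phi1 (z : R[i]) := F1 z * (1 + z * z) + F0 z * (2 * z).
Let Phi2 (z : R[i]) := F2 z * (1 + z * z) + F1 z * (2 * z) + (F1 z * (2 * z) + F0 z * 2).

Lemma real_strip_dom (r : R) : D r%:C.
Proof. by rewrite /strip_dom /= normr0 => -[_]; rewrite leNgt invr_gt0 ltr0n. Qed.

Lemma cder_1sqr (z : R[i]) : has_cderiv (fun w => 1 + w * w) z (2 * z).
Proof.
apply: cder_eq (cderD (cder_cst 1 z) (cderM (cder_id z) (cder_id z))) _.
by rewrite mul1r mulr1 add0r mulr_natl mulr2n.
Qed.

Lemma cder_double (z : R[i]) : has_cderiv (fun w => 2 * w) z 2.
Proof. by apply: cder_eq (cderMl 2 (cder_id z)) _; rewrite mulr1. Qed.

Lemma cder_Phi z : D z -> has_cderiv Phi z (Phi1 z).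
Proof. by move=> Dz; exact: cderM (dF0 Dz) (cder_1sqr z). Qed.

Lemma cder_Phi1 z : D z -> has_cderiv Phi1 z (Phi2 z).
Proof.
move=> Dz; exact: cderD (cderM (dF1 Dz) (cder_1sqr z)) (cderM (dF0 Dz) (cder_double z)).
Qed.

Lemma Phi2_loc_bounded z : D z -> exists B : R, cnbhs z [set w | cabs (Phi2 w) <= B].
Proof.
move=> Dz.
pose lb (h : R[i] -> R[i]) := exists B : R, cnbhs z [set w | cabs (h w) <= B].
have lbD h1 h2 : lb h1 -> lb h2 -> lb (fun w => h1 w + h2 w).
  move=> [B1 H1] [B2 H2]; exists (B1 + B2); apply: filterS (filterI H1 H2) => w [a b].
  by rewrite /= (le_trans (cabsD _ _))// lerD.
have lbM h1 h2 : lb h1 -> lb h2 -> lb (fun w => h1 w * h2 w).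
  move=> [B1 H1] [B2 H2]; exists (B1 * B2); apply: filterS (filterI H1 H2) => w [a b].
  by rewrite /= cabsM ler_pM ?cabs_ge0.
have lbc h d : has_cderiv h z d -> lb h.
  move=> /cder_cont/(_ _ ltr01) H; exists (cabs (h z) + 1); apply: filterS H => w /= hw.
  by rewrite -(subrK (h z) (h w)) (le_trans (cabsD _ _))// addrC lerD2l ltW.
have l1 := lbc _ _ (cder_1sqr z); have l2 := lbc _ _ (cder_double z).
have l3 := lbc _ _ (dF0 Dz); have l4 := lbc _ _ (dF1 Dz).
have l5 := lbc _ _ (cder_cst 2 z).
by apply: (lbD); apply: (lbD); apply: (lbM) => //; exact: bF2.
Qed.

Lemma density_Phi (r : R) : r%:C * Phi r%:C = G r * ((1 + r ^+ 2) ^+ 2)%:C.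
Proof.
have E : 1 + r%:C * r%:C = (1 + r ^+ 2)%:C :> R[i] by rewrite rmorphD rmorph1 rmorphXn expr2.
rewrite /Phi /G E rmorphXn /=; move: (oneDsqrC_neq0 r); move: (1 + r ^+ 2)%:C => a a0.
by field.
Qed.

Let dk := divdiff_kernel Phi Phi1.

(** Off the real axis both terms of the difference converge; on it only the integral
    of the combined kernel does.  The absolute value makes the function even on the
    real axis, as it is elsewhere. *)
Definition regular_part (s : R[i]) : R[i] :=
  if complex.Im s == 0 then Cintegral mu J (fun r => dk r `|complex.Re s|%:C)
  else stieltjes G s - Phi s * stieltjes (@weight0 R) s.

Lemma regular_partN s : D s -> regular_part (- s) = regular_part s.
Proof.
move=> Ds; rewrite /regular_part cImN oppr_eq0 cReN normrN.
by case: ifP => // _; rewrite !stieltjesN /Phi F0_even// mulrNN.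
Qed.

(** Subtracting the two Stieltjes integrals under the integral sign gives the kernel
    with the removable singularity. *)
Lemma regular_part_right s : D s -> 0 < complex.Re s ->
  regular_part s = Cintegral mu J (fun r => dk r s).
Proof.
move=> Ds s0; rewrite /regular_part; case: eqVneq => [i0|i0].
  rewrite (_ : `|complex.Re s|%:C = s)//.
  by rewrite gtr0_norm//; case: (s) i0 => a b /= ->.
have i1 := stieltjes_integrable iG i0.
have i2 := stieltjes_integrable (@weight0_integrable R) i0.
have i3 := @CintegrableZ _ (measurableTypeR R) R mu J (@measurable_halfline R) (Phi s) _ i2.
rewrite /stieltjes -(@CintegralZ _ (measurableTypeR R) R mu J (@measurable_halfline R) (Phi s) _ i2).
rewrite -(@CintegralB _ (measurableTypeR R) R mu J (@measurable_halfline R) _ _ i1 i3).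
apply: eq_Cintegral => r; rewrite /= in_itv /= andbT => r0.
have n1 : r%:C - s != 0.
  apply/eqP => /(congr1 (@complex.Im R)); rewrite cImD cImN /= sub0r => /eqP.
  by rewrite oppr_eq0; apply/negP.
have n2 := addrs_neq0 r0 s0.
rewrite /dk /divdiff_kernel /divdiff ifN; last by apply: contraNneq n1 => ->; rewrite subrr.
rewrite /nkernel /weight0 /G /Phi.
rewrite !rmorphM !fmorphV !rmorphXn /= -expr2.
have -> : 1 + r%:C * r%:C = (1 + r ^+ 2)%:C :> R[i] by rewrite rmorphD rmorph1 rmorphXn expr2.
have n3 : r%:C ^+ 2 - s ^+ 2 != 0 by rewrite subr_sqr mulf_neq0.
move: (oneDsqrC_neq0 r); move: (1 + r ^+ 2)%:C => a a0.
field; by rewrite a0 n1 n2 n3.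
Qed.

(** Off the real axis the two Stieltjes integrals are holomorphic; near the positive
    axis the divided-difference kernel is used, and near the negative axis evenness.
    At [0] both singularities [r = s] and [r = - s] meet the end of the half-line. *)
Lemma cder_regular_part s : D s -> s != 0 -> exists d, has_cderiv regular_part s d.
Proof.
move=> Ds s0; have [i0|i0] := eqVneq (complex.Im s) 0; last first.
  have d1 := cder_stieltjes iG i0.
  have d2 := cder_stieltjes (@weight0_integrable R) i0.
  exists (Cintegral mu J (fun r => G r * nkernel' s r) -
    (Phi1 s * stieltjes (@weight0 R) s +
     Phi s * Cintegral mu J (fun r => @weight0 R r * nkernel' s r))).
  apply: cder_near (cderB d1 (cderM (cder_Phi Ds) d2)).
  exists `|complex.Im s|; first by rewrite normr_gt0.
  move=> w ws /=; rewrite /regular_part ifN//; apply: contraTneq ws => wi.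
  rewrite -leNgt (le_trans _ (le_Im_cabs _))// cImD cImN wi sub0r normrN//.
have right (r0 : R) : 0 < r0 -> exists d, has_cderiv regular_part r0%:C d.
  move=> r00.
  have := cder_divdiff_kernel_integral (@strip_dom_open R) (fun r => @real_strip_dom r) cder_Phi cder_Phi1 Phi2_loc_bounded iG density_Phi r00.
  move=> H; eexists; apply: cder_near H.
  have [e e0 He] := strip_dom_open (@real_strip_dom r0).
  exists (Num.min e r0); first by rewrite lt_min e0.
  move=> w; rewrite lt_min => /andP[/He Dw wr] /=; rewrite regular_part_right//.
  have := le_lt_trans (le_Re_cabs _) wr; rewrite cReD cReN /= ltr_norml => /andP[h _]; lra.
have sE : s = (complex.Re s)%:C by case: (s) i0 => a b /= ->.
have [r0|r0|r0] := ltgtP (complex.Re s) 0.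
- have [d Hd] : exists d, has_cderiv regular_part (- s) d.
    by rewrite sE -rmorphN; apply: right; rewrite oppr_gt0.
  exists (- d); apply: (@cder_near _ (fun w => regular_part (- w))).
    by have := strip_dom_open Ds; apply: filterS => w /=; exact: regular_partN.
  by apply: cder_eq (cder_comp (cderN (cder_id s)) Hd) _; rewrite mulrN1.
- by rewrite sE; exact: right.
- by move: s0; rewrite sE r0 eqxx.
Qed.

Lemma stieltjes_continuation s : 0 < complex.Im s -> D s ->
  stieltjes G s = regular_part s + F0 s * (Complex 0 (pi / 2) - clog s).
Proof.
move=> s0 Ds; rewrite /regular_part gt_eqF//= -log_integral// /Phi expr2 mulrA subrK//.
Qed.

End Continuation.

(** * Continuation of the resolvent *)
Section Resolvent.
Variable R : realType.
Let M := 'M[R]_3.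
Notation leb := (@lebesgue_measure R).
Notation J := (`[0%R, +oo[%classic : set R).
Variables (mu nu : {measure set (mxBorel R) -> \bar R}).
Variables (f : M -> R[i]) (y : M).
Hypothesis plancherel : plancherel_normalized mu nu.
Hypothesis hf : Cc_smooth_X f.
Hypothesis hy : SL3 y.
Notation Fz := (F mu nu f y).

Lemma rhoX_gt0 : 0 < @rhoX R. Proof. by rewrite /rhoX sqrtr_gt0. Qed.

Definition scale (z : R[i]) : R[i] := (rhoX^-1)%:C * z.

Lemma Re_scale z : complex.Re (scale z) = complex.Re z / rhoX.
Proof. by rewrite /scale cReZ mulrC. Qed.
Lemma Im_scale z : complex.Im (scale z) = complex.Im z / rhoX.
Proof. by rewrite /scale cImZ mulrC. Qed.

Lemma strip_dom_scale z : strip_dom (scale z) <-> ~ imaginary_cuts z.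
Proof.
have r0 := rhoX_gt0.
have E : (complex.Re (scale z) = 0 /\ 2^-1 <= `|complex.Im (scale z)|) <-> imaginary_cuts z.
  rewrite Re_scale Im_scale normrM (gtr0_norm (_ : 0 < rhoX^-1)) ?invr_gt0//.
  rewrite ler_pdivlMr// (mulrC 2^-1); split => -[h1 h2]; split=> //.
    by move/eqP: h1; rewrite mulf_eq0 invr_eq0 (gt_eqF r0) orbF => /eqP.
  by rewrite h1 mul0r.
by split => h /E; exact: h.
Qed.

Definition radial_density (r : R) : R[i] := Fz r%:C * r%:C / (1 + r ^+ 2)%:C.

Definition resolvent_const : R[i] := (cardW%:R)^-1 * ((rhoX ^+ 2)^-1)%:C.

Lemma rhoX2C_neq0 : (rhoX ^+ 2)%:C != 0 :> R[i].
Proof.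
by rewrite -cabs_eq0 cabs_real normr_eq0 expf_eq0 /= gt_eqF ?rhoX_gt0.
Qed.

(** Substituting [z = rhoX s] in the Plancherel formula. *)
Lemma plancherel_kernel (z : R[i]) (r : R) : complex.Im z != 0 ->
  Fz r%:C * r%:C / ((rhoX ^+ 2 * r ^+ 2)%:C - z ^+ 2) =
  ((rhoX ^+ 2)^-1)%:C * (radial_density r * nkernel (scale z) r).
Proof.
move=> z0; have n1 := oneDsqrC_neq0 r; have n2 := rhoX2C_neq0.
have i0 : complex.Im (scale z) != 0.
  by rewrite Im_scale mulf_eq0 invr_eq0 negb_or z0 gt_eqF ?rhoX_gt0.
have := sqr_kernel_neq0 r i0.
rewrite /radial_density /nkernel.
have -> : scale z ^+ 2 = z ^+ 2 / (rhoX ^+ 2)%:C.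
  by rewrite /scale exprMn fmorphV /= exprVn rmorphXn mulrC.
have E1 : (rhoX ^+ 2 * r ^+ 2)%:C = (rhoX ^+ 2)%:C * (r ^+ 2)%:C := rmorphM _ _ _.
have E2 : ((rhoX ^+ 2)^-1)%:C = ((rhoX ^+ 2)%:C)^-1 := fmorphV _ _.
rewrite E1 E2.
move: n1 n2; move: (1 + r ^+ 2)%:C (r ^+ 2)%:C (rhoX ^+ 2)%:C => a b c a0 c0 h.
have h2 : c * b - z ^+ 2 != 0.
  rewrite (_ : c * b - z ^+ 2 = c * (b - z ^+ 2 / c)); last by field.
  by rewrite mulf_neq0.
by field; rewrite a0 c0 (mulrC b) h2.
Qed.

(** At [z = i rhoX] the denominator of the Plancherel formula is [rhoX^2 (1 + r^2)], so
    its integrability is what is claimed. *)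
Lemma radial_density_integrable : Cintegrable leb J radial_density.
Proof.
have [i1 _] := @plancherel f y (Complex 0 rhoX) hf hy rhoX_gt0.
have := @CintegrableZ _ (measurableTypeR R) R leb J (@measurable_halfline R) (rhoX ^+ 2)%:C _ i1.
apply: (@eq_Cintegrable _ (measurableTypeR R) R leb J (@measurable_halfline R)) => r _.
have -> : Complex 0 rhoX ^+ 2 = - (rhoX ^+ 2)%:C :> R[i].
  by rewrite expr2; apply/eqP; rewrite eq_complex /= expr2; apply/andP; split; apply/eqP; ring.
rewrite opprK -rmorphD /= /radial_density.
rewrite (_ : rhoX ^+ 2 * r ^+ 2 + rhoX ^+ 2 = rhoX ^+ 2 * (1 + r ^+ 2)); last by ring.
have E1 : (rhoX ^+ 2 * (1 + r ^+ 2))%:C = (rhoX ^+ 2)%:C * (1 + r ^+ 2)%:C := rmorphM _ _ _.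
rewrite E1; move: (oneDsqrC_neq0 r) rhoX2C_neq0.
move: (1 + r ^+ 2)%:C (rhoX ^+ 2)%:C => a c a0 c0.
by field; rewrite a0 c0.
Qed.

Lemma resolvent_stieltjes z : 0 < complex.Im z ->
  resolvent mu z f y = resolvent_const * stieltjes radial_density (scale z).
Proof.
move=> z0; have [_ ->] := @plancherel f y z hf hy z0.
have i0 : complex.Im (scale z) != 0.
  by rewrite Im_scale mulf_eq0 invr_eq0 negb_or !gt_eqF// rhoX_gt0.
have int := stieltjes_integrable radial_density_integrable i0.
rewrite /resolvent_const -mulrA; congr (_ * _).
rewrite /stieltjes -(@CintegralZ _ (measurableTypeR R) R leb J (@measurable_halfline R) _ _ int).
by apply: eq_Cintegral => r _; apply: plancherel_kernel; rewrite gt_eqF.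
Qed.

Lemma clog_scale z : log_dom z -> clog (scale z) = clog z - (ln rhoX)%:C.
Proof.
move=> lz; have r0 := rhoX_gt0.
have E : cexp (clog z - (ln rhoX)%:C) = scale z.
  rewrite cexpD cexp_clog// /scale mulrC; congr (_ * _).
  by rewrite cexpN /cexp /= cos0 sin0 mulr0 mulr1 lnK ?posrE// fmorphV.
rewrite -E cexpK//; first by rewrite cImD cImN /= subr0; exact: clog_Im.
rewrite E => -[h1 h2]; apply: lz; split.
  by move/eqP: h1; rewrite Im_scale mulf_eq0 invr_eq0 (gt_eqF r0) orbF => /eqP.
by move: h2; rewrite Re_scale pmulr_lle0 ?invr_gt0.
Qed.

Variables (F1 F2 : R[i] -> R[i]).
Hypothesis dF : forall z, strip_dom z -> has_cderiv Fz z (F1 z).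
Hypothesis dF1 : forall z, strip_dom z -> has_cderiv F1 z (F2 z).
Hypothesis bF2 : forall z, strip_dom z -> exists B : R, cnbhs z [set w | cabs (F2 w) <= B].
Hypothesis F_evenness : forall z, strip_dom z -> Fz (- z) = Fz z.

(** [stieltjes_continuation] at [s = cexp zeta / rhoX], with [clog s] replaced by
    [zeta - ln rhoX]. *)
Definition log_continuation (zeta : R[i]) : R[i] :=
  let s := scale (cexp zeta) in
  resolvent_const * (regular_part Fz F1 s +
    Fz s * (Complex 0 (pi / 2) - (zeta - (ln rhoX)%:C))).

Lemma resolvent_log_continuation z : 0 < complex.Im z -> ~ imaginary_cuts z ->
  resolvent mu z f y = log_continuation (clog z).
Proof.
move=> z0 /strip_dom_scale Dz.
have lz : log_dom z by move=> [h _]; rewrite h ltxx in z0.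
rewrite resolvent_stieltjes// /log_continuation cexp_clog//; congr (_ * _).
rewrite -clog_scale//.
apply: stieltjes_continuation => //.
by rewrite Im_scale divr_gt0// rhoX_gt0.
Qed.

Lemma scale_neq0 z : z != 0 -> scale z != 0.
Proof.
move=> z0; rewrite /scale mulf_neq0// -cabs_eq0 cabs_real normr_eq0 invr_eq0.
by rewrite gt_eqF// rhoX_gt0.
Qed.

Lemma cder_log_continuation zeta : ~ imaginary_cuts (cexp zeta) ->
  exists d, has_cderiv log_continuation zeta d.
Proof.
move=> /strip_dom_scale Ds.
have [d Hd] := cder_regular_part dF dF1 bF2 F_evenness radial_density_integrable Ds
  (scale_neq0 (cexp_neq0 _)).
have ds := cderMl (rhoX^-1)%:C (cder_cexp zeta).
eexists; apply: cderMl; apply: cderD; first exact: cder_comp ds Hd.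
apply: cderM; first exact: cder_comp ds (dF Ds).
apply: cderB; first exact: cder_cst.
by apply: cderB; [exact: cder_id|exact: cder_cst].
Qed.

Lemma cexpD2pi (zeta : R[i]) : cexp (zeta + Complex 0 (2 * pi)) = cexp zeta.
Proof.
rewrite cexpD (_ : cexp (Complex 0 (2 * pi)) = 1) ?mulr1//.
by rewrite mulr_natl /cexp /= expR0 cos2pi sin2pi mulr0 mulr1.
Qed.

Lemma log_continuationD2pi zeta : log_continuation (zeta + Complex 0 (2 * pi)) =
  log_continuation zeta - Complex 0 (2 * pi) / ((rhoX ^+ 2)%:C * cardW%:R) *
    Fz ((rhoX^-1)%:C * cexp zeta).
Proof.
rewrite /log_continuation cexpD2pi -/(scale (cexp zeta)) /resolvent_const.
have E : ((rhoX ^+ 2)^-1)%:C = ((rhoX ^+ 2)%:C)^-1 :> R[i] := fmorphV _ _.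
by rewrite E [((rhoX ^+ 2)%:C * _)^-1]invfM; ring.
Qed.

(** On the upper half-plane the resolvent is kept, since [F] and [log_continuation] are
    singular on the upper imaginary cut while the resolvent is not. *)
Definition sheet_continuation (z : R[i]) : R[i] :=
  if 0 < complex.Im z then resolvent mu z f y else log_continuation (clog z).

Lemma sheet_continuationE z : ~ imaginary_cuts z ->
  sheet_continuation z = log_continuation (clog z).
Proof.
by move=> hz; rewrite /sheet_continuation; case: ifP => // z0; exact: resolvent_log_continuation.
Qed.

(** On the upper half-plane the Plancherel integral is differentiated directly;
    elsewhere in the slit plane [s] avoids both cuts of [F] and [log_continuation]
    applies. *)
Lemma cder_sheet_continuation z : slit_plane z -> exists d, has_cderiv sheet_continuation z d.
Proof.
move=> [lz hz]; have [z0|z0] := ltP 0 (complex.Im z).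
  have i0 : complex.Im (scale z) != 0.
    by rewrite Im_scale mulf_eq0 invr_eq0 negb_or !gt_eqF// rhoX_gt0.
  have ds : has_cderiv scale z (rhoX^-1)%:C.
    by apply: cder_eq (cderMl (rhoX^-1)%:C (cder_id z)) _; rewrite mulr1.
  have H := cderMl resolvent_const (cder_comp ds (cder_stieltjes radial_density_integrable i0)).
  eexists; apply: cder_near H; exists (complex.Im z) => // w wz.
  have w0 : 0 < complex.Im w.
    have := le_lt_trans (le_Im_cabs _) wz; rewrite cImD cImN ltr_norml => /andP[h _]; lra.
  by rewrite /= /sheet_continuation w0 resolvent_stieltjes.
have cz : ~ imaginary_cuts z.
  move=> [h1 h2]; apply: hz; split => //.
  by move: h2; rewrite ler0_norm// lerNr.
have E : cexp (clog z) = z by exact: cexp_clog.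
have [d Hd] : exists d, has_cderiv log_continuation (clog z) d.
  by apply: cder_log_continuation; rewrite E.
eexists; apply: cder_near (cder_comp (cder_clog lz) Hd).
have ds : has_cderiv scale z (rhoX^-1)%:C.
  by apply: cder_eq (cderMl (rhoX^-1)%:C (cder_id z)) _; rewrite mulr1.
have [e e0 He] := strip_dom_open ((strip_dom_scale z).2 cz).
have [e' e'0 He'] := cder_cont ds e0.
exists e' => // w /He' /He /strip_dom_scale hw /=.
by rewrite sheet_continuationE.
Qed.

(** The value on the preimages of the cuts matters only on the principal sheet, where
    it has to agree with [sheet_continuation] on the upper cut. *)
Definition surface_continuation (zeta : R[i]) : R[i] :=
  if asbool (imaginary_cuts (cexp zeta)) then sheet_continuation (cexp zeta)
  else log_continuation zeta.

Lemma cder_surface_continuation zeta : log_surface zeta ->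
  exists d, has_cderiv surface_continuation zeta d.
Proof.
move=> hz; have [d Hd] := cder_log_continuation hz; exists d.
apply: cder_near Hd.
have [e e0 He] := strip_dom_open ((strip_dom_scale _).2 hz).
have [e' e'0 He'] := cder_cont (cderMl (rhoX^-1)%:C (cder_cexp zeta)) e0.
exists e' => // w /He' /He /strip_dom_scale hw /=.
by rewrite /surface_continuation asboolF.
Qed.

Lemma surface_continuation_sheet zeta : principal_sheet zeta -> slit_plane (cexp zeta) ->
  surface_continuation zeta = sheet_continuation (cexp zeta).
Proof.
move=> hz [ls _]; rewrite /surface_continuation; case: asboolP => // hc.
by rewrite sheet_continuationE// cexpK.
Qed.

Lemma surface_continuation_monodromy zeta : principal_sheet zeta ->
  slit_plane (cexp zeta) -> ~ imaginary_cuts (cexp zeta) ->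
  surface_continuation (zeta + Complex 0 (2 * pi)) =
  sheet_continuation (cexp zeta) -
    Complex 0 (2 * pi) / ((rhoX ^+ 2)%:C * cardW%:R) * Fz ((rhoX^-1)%:C * cexp zeta).
Proof.
move=> hz hs hc; rewrite -surface_continuation_sheet// /surface_continuation cexpD2pi.
by rewrite asboolF// log_continuationD2pi.
Qed.

End Resolvent.

Theorem corollary4 (R : realType)
    (mu nu : {measure set (mxBorel R) -> \bar R})
    (haar_nu : haar_measure (@SO3 R) nu) (nu1 : nu (@SO3 R) = 1%E)
    (haar_mu : haar_measure (@SL3 R) mu)
    (plancherel : plancherel_normalized mu nu)
    (f : 'M[R]_3 -> R[i]) (y : 'M[R]_3) (hf : Cc_smooth_X f) (hy : SL3 y) :
  exists (Rf : R[i] -> R[i]) (Rlog : R[i] -> R[i]),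
    [/\ (* the resolvent, extended to the slit plane *)
        (forall z : R[i], 0 < complex.Im z -> Rf z = resolvent mu z f y) /\
        holomorphic_on (@slit_plane R) Rf,
        (* its extension to the logarithmic surface *)
        forall zeta : R[i], principal_sheet zeta -> slit_plane (cexp zeta) ->
          Rlog zeta = Rf (cexp zeta),
        holomorphic_on (@log_surface R) Rlog &
        (* the value at z e^{2 i pi}, where z = cexp zeta *)
        forall zeta : R[i], principal_sheet zeta ->
          slit_plane (cexp zeta) -> ~ imaginary_cuts (cexp zeta) ->
          Rlog (zeta + Complex 0 (2 * pi)) =
            Rf (cexp zeta) -
            Complex 0 (2 * pi) / ((rhoX ^+ 2)%:C * cardW%:R) *
              F mu nu f y ((rhoX^-1)%:C * cexp zeta)].
Proof.
have [_ f_smooth [C [cC C_SL3 f_supp]]] := hf.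
have nu_fin : (nu (@SO3 R) < +oo)%E by rewrite nu1 ltry.
have mu_fin : (mu C < +oo)%E by have [_ _ + _] := haar_mu; exact.
have [F1 [F2 [dF dF1 bF2]]] :=
  F_cderiv2 nu_fin hy f_smooth mu_fin cC C_SL3 f_supp.
have Fe := F_even nu_fin hy f_smooth mu_fin cC C_SL3 f_supp.
exists (sheet_continuation mu nu f y F1), (surface_continuation mu nu f y F1); split.
- split; first by move=> z z0; rewrite /sheet_continuation z0.
  move=> z hz.
  have [d Hd] := cder_sheet_continuation plancherel hf hy dF dF1 bF2 Fe hz.
  exact: cder_derivable Hd.
- by move=> zeta; exact: surface_continuation_sheet.
- move=> zeta hz.
  have [d Hd] := cder_surface_continuation plancherel hf hy dF dF1 bF2 Fe hz.
  exact: cder_derivable Hd.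
- by move=> zeta; exact: surface_continuation_monodromy.
Qed.
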